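(* Let $1\le L\le N<M$ be integers and let $D=\mathrm{diag}(D_N,0_{M-N})$ be an $M\times M$ diagonal matrix of rank $N$, where $D_N=\mathrm{diag}(d_1,\ldots,d_N)$ with $d_1,\ldots,d_N>0$. Then $\mathrm{invcov}_L(D)$ is a diagonal matrix that decomposes as $$\mathrm{invcov}_L(D)=\mathrm{diag}(\Lambda_L(D_N),\mu I_{M-N}),$$ where $$\Lambda_L(D_N)=\int_{\Omega_{L,N}}\Phi(\Phi^{*}D_N\Phi)^{-1}\Phi^{*}\,d\phi=\mathrm{diag}(\lambda_1,\ldots,\lambda_N),\qquad \lambda_k=\frac{\partial}{\partial d_k}\int_{\Omega_{L,N}}\mathrm{Tr}\log(\Phi^{*}D_N\Phi)\,d\phi\quad(1\le k\le N),$$ and $$\mu=\mathrm{Tr}\Big[\mathbb{E}\big((X^{*}D_NX)^{-1}\big)\Big],$$ where the average is taken over the ensemble of $N\times L$ Gaussian random matrices $X$ with independent complex entries with zero mean and unit variance.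
   Context: $\mathrm{invcov}_L(D):=\mathbb{E}_\Psi\big(\Psi^{*}(\Psi D\Psi^{*})^{-1}\Psi\big)$, where $\Psi$ is distributed according to the Haar (isotropic) probability measure on $\{\Psi\in\mathbb{C}^{L\times M}:\Psi\Psi^*=I_L\}$, which is invariant under $\Psi\mapsto\Psi\Theta$ for every $M\times M$ unitary $\Theta$. $\Omega_{L,N}=\{\Phi\in\mathbb{C}^{N\times L}:\Phi^{*}\Phi=I_L\}$ is the Stiefel manifold, with $d\phi$ its isotropic probability measure (invariant under left multiplication by $N\times N$ unitaries). $A^*$ is the conjugate transpose, $\mathrm{Tr}$ the non-normalized trace, $I_{M-N}$ the identity matrix and $0_{M-N}$ the zero matrix of size $M-N$, and $\log$ of a positive definite matrix is defined by functional calculus. The partial derivative is that of the integral regarded as a function of $(d_1,\ldots,d_N)$. *)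

(* Defs.v *)
From HB Require Import structures.
From mathcomp Require Import all_boot all_order all_algebra.
From mathcomp Require Import complex.
From mathcomp Require Import all_classical all_reals all_analysis.

Set Implicit Arguments.
Unset Strict Implicit.
Unset Printing Implicit Defensive.

Import Order.TTheory GRing.Theory Num.Theory.
Import numFieldNormedType.Exports.

Local Open Scope classical_set_scope.
Local Open Scope ring_scope.
Local Open Scope sesquilinear_scope.
Local Open Scope complex_scope.

(* Complex matrices with their Borel sigma-algebra. The alias R[i]^o only
   selects the topology of the modulus on R[i]; it is convertible to R[i]. *)
Notation borelmx R m n := (g_sigma_algebraType (@open 'M[R[i]^o]_(m, n))).

(* Both Haar measures below are presented as Borel probability measures on the
   whole matrix space that are carried by the Stiefel manifold and have the
   stated invariance; these two properties determine them uniquely. *)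
Definition haar_coisometry (R : realType) (L M : nat)
    (P : probability (borelmx R L M) R) : Prop :=
  P [set Psi | (Psi : 'M[R[i]]_(L, M)) *m Psi ^t* = 1%:M] = 1%E /\
  forall Theta : 'M[R[i]]_M, Theta \is unitarymx ->
  forall B : set (borelmx R L M), measurable B ->
    P [set Psi | B ((Psi : 'M[R[i]]_(L, M)) *m Theta)] = P B.

Definition haar_stiefel (R : realType) (L N : nat)
    (Q : probability (borelmx R N L) R) : Prop :=
  Q [set Phi | (Phi : 'M[R[i]]_(N, L)) ^t* *m Phi = 1%:M] = 1%E /\
  forall U : 'M[R[i]]_N, U \is unitarymx ->
  forall B : set (borelmx R N L), measurable B ->
    Q [set Phi | B (U *m (Phi : 'M[R[i]]_(N, L)))] = Q B.

(* Independent standard complex Gaussian entries, E|X_ij|^2 = 1: the real and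
   imaginary parts are 2 N L independent real normal variables of mean 0 and
   variance 1/2. The second argument of normal_prob is the standard deviation.
   Subfamilies of events are covered by taking the other sets to be setT. *)
Definition gaussian_ensemble (R : realType) (N L : nat)
    (G : probability (borelmx R N L) R) : Prop :=
  forall A B : 'I_N -> 'I_L -> set R,
    (forall i j, measurable (A i j)) -> (forall i j, measurable (B i j)) ->
    G [set X | forall i j, A i j (complex.Re ((X : 'M[R[i]]_(N, L)) i j)) /\
                           B i j (complex.Im ((X : 'M[R[i]]_(N, L)) i j))] =
    (\prod_(i < N) \prod_(j < L)
       (normal_prob 0 (Num.sqrt 2^-1) (A i j) *
        normal_prob 0 (Num.sqrt 2^-1) (B i j)))%E.

Section expectation.
Context d (T : measurableType d) (R : realType) (P : probability T R).

Definition cexp (f : T -> R[i]) : R[i] :=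
  fine 'E_P[fun w => complex.Re (f w)] +i* fine 'E_P[fun w => complex.Im (f w)].

Definition mxexp m n (f : T -> 'M[R[i]]_(m, n)) : 'M[R[i]]_(m, n) :=
  \matrix_(i, j) cexp (fun w => f w i j).

Definition cintegrable (f : T -> R[i]) : Prop :=
  P.-integrable setT (fun w => (complex.Re (f w))%:E) /\
  P.-integrable setT (fun w => (complex.Im (f w))%:E).

Definition mxintegrable m n (f : T -> 'M[R[i]]_(m, n)) : Prop :=
  forall i j, cintegrable (fun w => f w i j).

End expectation.

Definition cdiag (R : realType) (n : nat) (d : 'rV[R]_n) : 'M[R[i]]_n :=
  diag_mx (map_mx (real_complex R) d).

Definition bdiag (R : realType) (N M : nat) (leNM : (N <= M)%N)
    (A : 'M[R[i]]_N) (B : 'M[R[i]]_(M - N)) : 'M[R[i]]_M :=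
  castmx (subnKC leNM, subnKC leNM) (block_mx A 0 0 B).

(* Functional calculus for a Hermitian positive definite A, from the unitary
   diagonalization A = V^-1 * diag s * V with V = spectralmx A and
   s = spectral_diag A (whose entries are then real and positive). *)
Definition mxlog (R : realType) (n : nat) (A : 'M[R[i]]_n) : 'M[R[i]]_n :=
  invmx (spectralmx A) *m
  diag_mx (map_mx (fun z => (ln (complex.Re z))%:C) (spectral_diag A)) *m
  spectralmx A.

Definition invcov_integrand (R : realType) (L M : nat) (D : 'M[R[i]]_M)
    (Psi : 'M[R[i]]_(L, M)) : 'M[R[i]]_M :=
  Psi ^t* *m invmx (Psi *m D *m Psi ^t*) *m Psi.

Definition invcov (R : realType) (L M : nat)
    (P : probability (borelmx R L M) R) (D : 'M[R[i]]_M) : 'M[R[i]]_M :=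
  mxexp P (invcov_integrand D).

Definition Lambda_integrand (R : realType) (L N : nat) (DN : 'M[R[i]]_N)
    (Phi : 'M[R[i]]_(N, L)) : 'M[R[i]]_N :=
  Phi *m invmx (Phi ^t* *m DN *m Phi) *m Phi ^t*.

Definition Lambda (R : realType) (L N : nat)
    (Q : probability (borelmx R N L) R) (DN : 'M[R[i]]_N) : 'M[R[i]]_N :=
  mxexp Q (Lambda_integrand DN).

Definition trlog_integrand (R : realType) (L N : nat) (DN : 'M[R[i]]_N)
    (Phi : 'M[R[i]]_(N, L)) : R[i] :=
  \tr (mxlog (Phi ^t* *m DN *m Phi)).

(* Taking the real part loses nothing: for d > 0 the trace is real. *)
Definition trlog_mean (R : realType) (L N : nat)
    (Q : probability (borelmx R N L) R) (d : 'rV[R]_N) : R^o :=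
  complex.Re (cexp Q (trlog_integrand (cdiag d))).

Definition lambda (R : realType) (L N : nat)
    (Q : probability (borelmx R N L) R) (d : 'rV[R]_N) (k : 'I_N) : R :=
  'D_(delta_mx 0 k) (trlog_mean Q) d.

Definition invgram (R : realType) (L N : nat) (DN : 'M[R[i]]_N)
    (X : 'M[R[i]]_(N, L)) : 'M[R[i]]_L :=
  invmx (X ^t* *m DN *m X).

Definition mu (R : realType) (L N : nat)
    (G : probability (borelmx R N L) R) (DN : 'M[R[i]]_N) : R[i] :=
  \tr (mxexp G (@invgram R L N DN)).

(* The same trace in [0, +oo]: the diagonal of invgram is nonnegative, and its
   mean is +oo when L = N, a value that mu, being finite, cannot hold. *)
Definition emu (R : realType) (L N : nat)
    (G : probability (borelmx R N L) R) (DN : 'M[R[i]]_N) : \bar R :=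
  (\sum_(l < L) 'E_G[fun X => complex.Re (@invgram R L N DN X l l)])%E.

(* Main.v *)
(** Write [Pi Z = Z (Z^* Z)^-1 Z^*] for the orthogonal projector on the column
    space of [Z]. The matrix [Z (Z^* D Z)^-1 Z^*] depends on [Z] through [Pi Z]
    only, and there is at most one probability measure on projectors of a given
    rank which is invariant under unitary conjugation. Haar measures on Stiefel
    manifolds can therefore be traded for Gaussian matrices in such integrals.

    Split an [M x L] Gaussian matrix into independent blocks [X] ([N] rows) and
    [Y] ([M - N] rows). As [D] vanishes on the last [M - N] coordinates,
    [Z^* D Z = X^* D_N X]; the upper diagonal entries of invcov are those of
    [E X (X^* D_N X)^-1 X^*], which is [Lambda], and the lower ones are
    [E y (X^* D_N X)^-1 y^* = Tr E (X^* D_N X)^-1] for a row [y] of [Y].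
    The off-diagonal entries vanish by invariance under sign flips.

    For the [lambda_k], let [phi] be the [k]-th row of [Phi]. Then
    [det (A + t phi^* phi) = det A (1 + t l)] for [A = Phi^* D_N Phi], where
    [l = phi A^-1 phi^*] is the [k]-th diagonal entry of the integrand of
    [Lambda]; it lies in [0, 1 / d_k], so that the second-order remainder of
    [ln (1 + t l)] is uniform in [Phi].

    For [L < N] the trace in [mu] is finite: adding a row [y] to [X], the entry
    [q] of [1 - Pi (X; y)] at that row satisfies [y (X^* X)^-1 y^* <= 1 / q],
    and [1 - Pi (X; y)] has the law of [Pi W] with [W] Gaussian with
    [N + 1 - L >= 2] columns, for which [1 / Pi W_kk <= |W|^2 / |w_k|^2]. *)

(* The measures are known only through what characterises them: invariance and support for the Haar
   measures, values on boxes for the Gaussian ensemble. Uniqueness on projectors is therefore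
   obtained by comparing masses of balls, without averaging over the unitary group, and unitary
   invariance of the Gaussian law comes from translation invariance of a weighted integral.

   As the trace in [mu] may have infinite mean, diagonal entries are compared as integrals of
   nonnegative functions in [0, +oo]; integrability is deduced afterwards. Positive semidefiniteness
   makes this work: it holds for the integrands at every matrix, [invmx] fixing singular matrices,
   and it bounds all entries by diagonal ones.

   Passing from a matrix to its projector requires a measurable function of the projector alone,
   [fproj]. As [D] is singular for invcov, the almost sure invertibility of [Z^* D Z] must be
   transferred too. Finally, [mxlog] uses a chosen eigenbasis; its trace is measurable as a limit of
   logarithms of determinants. *)
Require Import Defs.
From HB Require Import structures.
From mathcomp Require Import all_boot all_order all_algebra.
From mathcomp Require Import complex.
From mathcomp Require Import all_classical all_reals all_analysis.
From mathcomp Require Import measurable_realfun.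
From mathcomp Require Import zify ring lra.
Set Implicit Arguments.
Unset Strict Implicit.
Unset Printing Implicit Defensive.
Import Order.TTheory GRing.Theory Num.Theory.
Import numFieldNormedType.Exports.
Local Open Scope classical_set_scope.
Local Open Scope ring_scope.
Local Open Scope sesquilinear_scope.
Local Open Scope complex_scope.

(** * Measurability of matrix-valued functions *)

Lemma ReD (R : realType) (x y : R[i]) :
  complex.Re (x + y) = complex.Re x + complex.Re y.
Proof. by case: x y => a b [c d]. Qed.

Lemma ImD (R : realType) (x y : R[i]) :
  complex.Im (x + y) = complex.Im x + complex.Im y.
Proof. by case: x y => a b [c d]. Qed.

Lemma ReN (R : realType) (x : R[i]) : complex.Re (- x) = - complex.Re x.
Proof. by case: x. Qed.

Lemma ImN (R : realType) (x : R[i]) : complex.Im (- x) = - complex.Im x.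
Proof. by case: x. Qed.

Lemma ReM (R : realType) (x y : R[i]) :
  complex.Re (x * y) = complex.Re x * complex.Re y - complex.Im x * complex.Im y.
Proof. by case: x y => a b [c d]. Qed.

Lemma ImM (R : realType) (x y : R[i]) :
  complex.Im (x * y) = complex.Re x * complex.Im y + complex.Im x * complex.Re y.
Proof. by case: x y => a b [c d]; rewrite /= addrC [X in _ = _ + X]mulrC [X in X + _]mulrC; congr (_ + _); rewrite mulrC. Qed.

Lemma Re_conj (R : realType) (x : R[i]) : complex.Re (x^*) = complex.Re x.
Proof. by case: x. Qed.

Lemma Im_conj (R : realType) (x : R[i]) : complex.Im (x^*) = - complex.Im x.
Proof. by case: x. Qed.

Section cmeas.
Context d (T : measurableType d) (R : realType).
Implicit Types f g : T -> R[i].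

Definition cmeas f := measurable_fun setT (fun w => complex.Re (f w)) /\
  measurable_fun setT (fun w => complex.Im (f w)).

Lemma cmeas_cst (c : R[i]) : cmeas (fun _ => c).
Proof. by split; exact: measurable_cst. Qed.

Lemma cmeas_ext f g : f =1 g -> cmeas f -> cmeas g.
Proof. by move=> /funext ->. Qed.

Lemma cmeasD f g : cmeas f -> cmeas g -> cmeas (fun w => f w + g w).
Proof.
move=> [f1 f2] [g1 g2]; split.
  under eq_fun do rewrite ReD; exact: measurable_funD.
under eq_fun do rewrite ImD; exact: measurable_funD.
Qed.

Lemma cmeasN f : cmeas f -> cmeas (fun w => - f w).
Proof.
move=> [f1 f2]; split.
  under eq_fun do rewrite ReN; exact: measurable_funN.
under eq_fun do rewrite ImN; exact: measurable_funN.
Qed.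

Lemma cmeasM f g : cmeas f -> cmeas g -> cmeas (fun w => f w * g w).
Proof.
move=> [f1 f2] [g1 g2]; split.
  under eq_fun do rewrite ReM.
  by apply: measurable_funB; apply: measurable_funM.
under eq_fun do rewrite ImM.
by apply: measurable_funD; apply: measurable_funM.
Qed.

Lemma cmeas_conj f : cmeas f -> cmeas (fun w => (f w)^*).
Proof.
move=> [f1 f2]; split; first by under eq_fun do rewrite Re_conj.
under eq_fun do rewrite Im_conj; exact: measurable_funN.
Qed.

Lemma cmeas_real (f : T -> R) : measurable_fun setT f ->
  cmeas (fun w => (f w)%:C).
Proof. by move=> mf; split => //=; exact: measurable_cst. Qed.

Lemma cmeas_sum (I : Type) (r : seq I) (P : pred I) (F : I -> T -> R[i]) :
  (forall i, cmeas (F i)) -> cmeas (fun w => \sum_(i <- r | P i) F i w).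
Proof.
move=> mF; elim: r => [|i r IHr].
  by under eq_fun do rewrite big_nil; exact: cmeas_cst.
under eq_fun do rewrite big_cons.
by case: (P i) => //; exact: cmeasD.
Qed.

Lemma cmeas_prod (I : Type) (r : seq I) (P : pred I) (F : I -> T -> R[i]) :
  (forall i, cmeas (F i)) -> cmeas (fun w => \prod_(i <- r | P i) F i w).
Proof.
move=> mF; elim: r => [|i r IHr].
  by under eq_fun do rewrite big_nil; exact: cmeas_cst.
under eq_fun do rewrite big_cons.
by case: (P i) => //; exact: cmeasM.
Qed.

Lemma cmeas_if (b : T -> bool) f g : measurable_fun setT b ->
  cmeas f -> cmeas g -> cmeas (fun w => if b w then f w else g w).
Proof.
move=> mb [f1 f2] [g1 g2]; split.
  rewrite (_ : (fun _ => _) = (fun w => if b w then complex.Re (f w) else complex.Re (g w))).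
    exact: measurable_fun_ifT.
  by apply/funext => w; case: (b w).
rewrite (_ : (fun _ => _) = (fun w => if b w then complex.Im (f w) else complex.Im (g w))).
  exact: measurable_fun_ifT.
by apply/funext => w; case: (b w).
Qed.

Lemma cmeas_eq f g : cmeas f -> cmeas g -> measurable_fun setT (fun w => f w == g w).
Proof.
move=> [f1 f2] [g1 g2]; under eq_fun do rewrite eq_complex.
by apply: measurable_and; apply: measurable_fun_eqr.
Qed.

Lemma cmeas_measurable_eq f g : cmeas f -> cmeas g -> measurable [set w | f w = g w].
Proof.
move=> mf mg; have := cmeas_eq mf mg; move=> /(_ measurableT [set true]).
rewrite setTI => H; have := H _; rewrite (_ : _ @^-1` _ = [set w | f w = g w]); first by apply.
by apply/seteqP; split => w /= /eqP.
Qed.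

Lemma measurable_inv_fun (h : T -> R) : measurable_fun setT h ->
  measurable_fun setT (fun w => (h w)^-1).
Proof.
move=> mh.
have mi : measurable_fun [set: R] (fun x : R => x^-1).
  have -> : (fun x : R => x^-1) = (fun x => if x == 0 then 0 else x^-1).
    by apply/funext => x; case: eqP => // ->; rewrite invr0.
  apply: measurable_fun_if => //.
    by apply: measurable_fun_eqr => //; exact: measurable_cst.
  rewrite setTI.
  have -> : (eq_op^~ 0) @^-1` [set false] = [set x : R | x != 0].
    by apply/seteqP; split => x /= => [->|/negbTE].
  apply: open_continuous_measurable_fun; first exact: open_neq.
  move=> x; rewrite inE /=; exact: inv_continuous.
exact: measurableT_comp mi mh.
Qed.

Lemma cmeasV f : cmeas f -> cmeas (fun w => (f w)^-1).
Proof.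
move=> mf; have [m1 m2] := mf.
have E : (fun w => (f w)^-1) =
    (fun w => (f w)^* * (((complex.Re (f w))^+2 + (complex.Im (f w))^+2)^-1)%:C).
  apply/funext => w.
  have [->|f0] := eqVneq (f w) 0; first by rewrite invr0 conjC0 mul0r.
  by rewrite invC_norm mulrC -add_Re2_Im2 [X in _ = _ * X]fmorphV.
rewrite E; apply: cmeasM; first exact: cmeas_conj.
apply: cmeas_real; apply: measurable_inv_fun.
by apply: measurable_funD; apply: measurable_funX.
Qed.

End cmeas.

Lemma measurable_forall_fin d (T : measurableType d) (I : finType) (P : I -> set T) :
  (forall i, measurable (P i)) -> measurable [set w | forall i, P i w].
Proof.
move=> mP; rewrite (_ : [set w | _] = \bigcap_(i in [set: I]) P i).
  by apply: fin_bigcap_measurable => // i _; exact: mP.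
by apply/seteqP; split => w /= H i //; exact: H.
Qed.

Lemma measurable_preimage d d' (T : measurableType d) (T' : measurableType d')
    (f : T -> T') (B : set T') :
  measurable_fun setT f -> measurable B -> measurable [set w | B (f w)].
Proof. by move=> mf mB; rewrite -[X in measurable X]setTI; exact: mf. Qed.

Lemma measurable_lt d (T : measurableType d) (R : realType) (f g : T -> R) :
  measurable_fun setT f -> measurable_fun setT g -> measurable [set w | f w < g w].
Proof.
by move=> mf mg; apply: (measurable_preimage (measurable_fun_ltr mf mg) (B := [set true])).
Qed.

Lemma measurable_le d (T : measurableType d) (R : realType) (f g : T -> R) :
  measurable_fun setT f -> measurable_fun setT g -> measurable [set w | f w <= g w].
Proof.
by move=> mf mg; apply: (measurable_preimage (measurable_fun_ler mf mg) (B := [set true])).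
Qed.

Lemma normc_leD (R : realType) (z : R[i]) :
  `|z| <= (`|complex.Re z| + `|complex.Im z|)%:C.
Proof.
rewrite normc_def lecR -[leRHS]ger0_norm ?addr_ge0// -sqrtr_sqr ler_wsqrtr//.
rewrite sqrrD !real_normK ?num_real// -addrA [X in _ <= _ + X]addrC addrA lerDl.
by rewrite mulrn_wge0 ?mulr_ge0.
Qed.

Section mmeas.
Context d (T : measurableType d) (R : realType).

Definition mmeas m n (f : T -> 'M[R[i]]_(m, n)) :=
  forall i j, cmeas (fun w => f w i j).

(** Boxes with rational centres. Their index type is countable, so an open set is a countable union
    of them, and Borel measurability of a matrix-valued map reduces to measurability of its
    entries. *)
Definition rbox m n (q : 'M[rat * rat]_(m, n) * nat) : set 'M[R[i]]_(m, n) :=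
  [set X | forall i j,
    `|complex.Re (X i j) - ratr (q.1 i j).1| < q.2.+1%:R^-1 /\
    `|complex.Im (X i j) - ratr (q.1 i j).2| < q.2.+1%:R^-1].

Lemma rbox_exists m n (X : 'M[R[i]]_(m, n)) k : exists q, rbox (q, k) X.
Proof.
have Hr (x : R) : exists r : rat, `|x - ratr r| < k.+1%:R^-1.
  have /rat_in_itvoo[r] : x - k.+1%:R^-1 < x + k.+1%:R^-1.
    by rewrite ltrBlDr -addrA ltrDl addr_gt0// invr_gt0.
  by rewrite in_itv /= => /andP[a b]; exists r; rewrite distrC ltr_distl a.
pose r x := sval (cid (Hr x)).
have rP x : `|x - ratr (r x)| < k.+1%:R^-1 by rewrite /r; case: cid.
exists (\matrix_(i, j) (r (complex.Re (X i j)), r (complex.Im (X i j)))) => i j /=.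
by rewrite mxE /=; split; exact: rP.
Qed.

(** Each of the real and imaginary parts varies by less than [2 / (k + 1)] inside a box, and the
    modulus is at most the sum of the two; hence the 4. *)
Lemma rbox_close m n q k (X Y : 'M[R[i]]_(m, n)) i j :
  rbox (q, k) X -> rbox (q, k) Y -> `|X i j - Y i j| < (4 * k.+1%:R^-1)%:C.
Proof.
move=> /(_ i j)[/= a b] /(_ i j)[/= a' b'].
apply: (le_lt_trans (normc_leD _)); rewrite ltcR ReD ImD ReN ImN.
have tri (x y z e : R) : `|x - z| < e -> `|y - z| < e -> `|x - y| < 2 * e.
  move=> h h'; rewrite (_ : x - y = (x - z) - (y - z)); last by rewrite opprB addrA subrK.
  by apply: (le_lt_trans (ler_normB _ _)); rewrite mulr2n mulrDl !mul1r ltrD.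
have := ltrD (tri _ _ _ _ a a') (tri _ _ _ _ b b').
by rewrite -mulrDl -natrD.
Qed.

Lemma open_rbox m n (U : set 'M[R[i]^o]_(m, n)) (X : 'M[R[i]]_(m, n)) :
  open U -> U X -> exists q, rbox q X /\ rbox q `<=` U.
Proof.
rewrite openE => oU /oU /nbhs_ballP[e /= e0 eU].
(* The radius of the ball is a positive element of [R[i]]. The order there compares only numbers
   with equal imaginary parts, so the radius is real. *)
have [er ee] : 0 < complex.Re e /\ e = (complex.Re e)%:C.
  move: e0; rewrite ltcE /= => /andP[/eqP ime ->]; split => //.
  by case: {eU} e ime => a b /= ->.
have [k] : exists k, 0 + k.+1%:R^-1 < complex.Re e / 4 :> R by apply: ltr_add_invr; rewrite divr_gt0.
rewrite add0r ltr_pdivlMr// mulrC => ke.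
have [q qX] := rbox_exists X k; exists (q, k); split => // Y qY.
apply: eU; split => // i j; rewrite -ball_normE /=; apply: (lt_trans (rbox_close i j qX qY)).
by rewrite ee ltcR.
Qed.

Lemma mmeas_measurable m n (f : T -> 'M[R[i]]_(m, n)) : mmeas f ->
  measurable_fun setT (f : T -> borelmx R m n).
Proof.
move=> mf; apply: (@measurability _ _ T (borelmx R m n) setT f (@open 'M[R[i]^o]_(m, n))) => //.
move=> _ [U oU <-]; rewrite setTI.
have -> : f @^-1` U = \bigcup_q (if `[<rbox q `<=` U>] then [set w | rbox q (f w)] else set0).
  apply/seteqP; split => w /=.
    by move=> /(open_rbox oU)[q [qw qU]]; exists q => //; rewrite asboolT.
  by move=> [q _]; case: asboolP => // qU /=; exact: qU.
apply: countable_bigcupT_measurable; first exact: countableP.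
move=> q; case: asboolP => // _.
apply: measurable_forall_fin => i; apply: measurable_forall_fin => j.
have [m1 m2] := mf i j.
apply: measurableI; apply: measurable_lt => //; apply: measurableT_comp => //;
  exact: measurable_funB.
Qed.

End mmeas.

Section mmeas_closure.
Context d (T : measurableType d) (R : realType).

Lemma mmeas_id m n : mmeas (fun X : borelmx R m n => (X : 'M[R[i]]_(m, n))).
Proof.
have oc (f : 'M[R[i]^o]_(m, n) -> R) : continuous f -> measurable_fun setT (f : borelmx R m n -> R).
  move=> cf _; apply: (measurability _ (RGenOpens.measurableE R)) => //.
  move=> _ [_ [x [y ->]] <-]; rewrite setTI; apply: sub_sigma_algebra.
  by apply: open_comp; [move=> z _; exact: cf|exact: interval_open].
have cont (g : R[i] -> R) i j : (forall x y, `|g x - g y|%:C <= `|x - y|) ->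
    continuous (fun X : 'M[R[i]^o]_(m, n) => g (X i j)).
  move=> gl X A /nbhs_ballP[e /= e0 eA].
  apply/nbhs_ballP; exists (e%:C) => /=; first by rewrite ltcR.
  move=> Y [_ /(_ i j)]; rewrite -ball_normE /= => H.
  by apply: eA; rewrite -ball_normE /= -ltcR; apply: le_lt_trans H; exact: gl.
move=> i j; split; apply: oc; apply: cont => x y.
  by rewrite -ReN -ReD; exact: normc_ge_Re.
(* Multiplication by [i] preserves the modulus and turns the imaginary part into minus the real
   part, which reduces this bound to the one for [Re]. *)
rewrite -ImN -ImD -[leRHS]mulr1 -[X in _ <= _ * X](normCi R[i]) -normrM mulrC.
by apply: le_trans (normc_ge_Re _); rewrite ReM /= mul0r mul1r sub0r normrN.
Qed.

Lemma measurable_mmeas m n (f : T -> 'M[R[i]]_(m, n)) :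
  measurable_fun setT (f : T -> borelmx R m n) -> mmeas f.
Proof.
move=> mf i j; have [m1 m2] := @mmeas_id m n i j.
by split; [exact: (measurableT_comp m1 mf)|exact: (measurableT_comp m2 mf)].
Qed.

Lemma mmeas_comp d' (T' : measurableType d') m n (f : T -> 'M[R[i]]_(m, n)) (g : T' -> T) :
  mmeas f -> measurable_fun setT g -> mmeas (f \o g).
Proof.
move=> mf mg i j; have [m1 m2] := mf i j.
by split; [exact: (measurableT_comp m1 mg)|exact: (measurableT_comp m2 mg)].
Qed.

Lemma mmeas_cst m n (A : 'M[R[i]]_(m, n)) : mmeas (fun _ : T => A).
Proof. by move=> i j; exact: cmeas_cst. Qed.

Lemma mmeasD m n (f g : T -> 'M[R[i]]_(m, n)) : mmeas f -> mmeas g ->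
  mmeas (fun w => f w + g w).
Proof. by move=> mf mg i j; under [X in cmeas X]eq_fun do rewrite mxE; exact: cmeasD. Qed.

Lemma mmeasN m n (f : T -> 'M[R[i]]_(m, n)) : mmeas f -> mmeas (fun w => - f w).
Proof. by move=> mf i j; under [X in cmeas X]eq_fun do rewrite mxE; exact: cmeasN. Qed.

Lemma mmeasB m n (f g : T -> 'M[R[i]]_(m, n)) : mmeas f -> mmeas g ->
  mmeas (fun w => f w - g w).
Proof. by move=> mf mg; apply: mmeasD => //; exact: mmeasN. Qed.

Lemma mmeasM m n p (f : T -> 'M[R[i]]_(m, n)) (g : T -> 'M[R[i]]_(n, p)) :
  mmeas f -> mmeas g -> mmeas (fun w => f w *m g w).
Proof.
move=> mf mg i j; under [X in cmeas X]eq_fun do rewrite mxE.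
by apply: cmeas_sum => k; exact: cmeasM.
Qed.

Lemma mmeasZ m n (c : T -> R[i]) (f : T -> 'M[R[i]]_(m, n)) : cmeas c -> mmeas f ->
  mmeas (fun w => c w *: f w).
Proof. by move=> mc mf i j; under [X in cmeas X]eq_fun do rewrite mxE; exact: cmeasM. Qed.

Lemma mmeas_adj m n (f : T -> 'M[R[i]]_(m, n)) : mmeas f -> mmeas (fun w => (f w) ^t*).
Proof. by move=> mf i j; under [X in cmeas X]eq_fun do rewrite !mxE; exact: cmeas_conj. Qed.

Lemma cmeas_tr n (f : T -> 'M[R[i]]_n) : mmeas f -> cmeas (fun w => \tr (f w)).
Proof. by move=> mf; apply: cmeas_sum => i; exact: mf. Qed.

Lemma cmeas_det n (f : T -> 'M[R[i]]_n) : mmeas f -> cmeas (fun w => \det (f w)).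
Proof.
move=> mf; apply: cmeas_sum => s; apply: cmeasM; first exact: cmeas_cst.
by apply: cmeas_prod => i; exact: mf.
Qed.

Lemma mmeas_invmx n (f : T -> 'M[R[i]]_n) : mmeas f -> mmeas (fun w => invmx (f w)).
Proof.
move=> mf i j.
(* [invmx] returns its argument when the determinant vanishes, and is given by cofactors otherwise;
   both branches are measurable. *)
apply: (cmeas_ext (f := fun w => if \det (f w) == 0 then f w i j
                                 else (\det (f w))^-1 * (\adj (f w)) i j)).
  move=> w; rewrite /invmx unitmxE unitfE; case: eqP => //= _.
  by rewrite !mxE.
apply: cmeas_if; first by apply: cmeas_eq; [exact: cmeas_det|exact: cmeas_cst].
  exact: mf.
apply: cmeasM; first by apply: cmeasV; exact: cmeas_det.
under [X in cmeas X]eq_fun do rewrite mxE /cofactor.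
apply: cmeasM; first exact: cmeas_cst.
apply: cmeas_det => k l; under [X in cmeas X]eq_fun do rewrite !mxE; exact: mf.
Qed.

Lemma mmeas_col_mx m1 m2 n (f : T -> 'M[R[i]]_(m1, n)) (g : T -> 'M[R[i]]_(m2, n)) :
  mmeas f -> mmeas g -> mmeas (fun w => col_mx (f w) (g w)).
Proof.
move=> mf mg i j; under [X in cmeas X]eq_fun do rewrite mxE.
by case: (fintype.split i) => k; [exact: mf|exact: mg].
Qed.

End mmeas_closure.

(** * The squared Frobenius norm *)

Section fnorm2.
Context (R : realType).

(** It serves twice: as the distance in the comparison of ball masses, because unitary
    multiplication on either side preserves it, and as the exponent of the Gaussian density. *)
Definition fnorm2 m n (X : 'M[R[i]]_(m, n)) : R := complex.Re (\tr (X *m X ^t*)).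

Lemma Re_sum (I : Type) (r : seq I) (P : pred I) (F : I -> R[i]) :
  complex.Re (\sum_(i <- r | P i) F i) = \sum_(i <- r | P i) complex.Re (F i).
Proof. by apply: (big_morph _ (@ReD R)). Qed.

Lemma fnorm2E m n (X : 'M[R[i]]_(m, n)) :
  fnorm2 X = \sum_i \sum_j (complex.Re (X i j) ^+ 2 + complex.Im (X i j) ^+ 2).
Proof.
rewrite /fnorm2 Re_sum; apply: eq_bigr => i _; rewrite mxE Re_sum.
by apply: eq_bigr => j _; rewrite !mxE ReM Re_conj Im_conj mulrN opprK !expr2.
Qed.

Lemma fnorm2_ge0 m n (X : 'M[R[i]]_(m, n)) : 0 <= fnorm2 X.
Proof.
by rewrite fnorm2E; apply: sumr_ge0 => i _; apply: sumr_ge0 => j _; rewrite addr_ge0 ?sqr_ge0.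
Qed.

Lemma adjM m n p (A : 'M[R[i]]_(m, n)) (B : 'M[R[i]]_(n, p)) :
  (A *m B) ^t* = B ^t* *m A ^t*.
Proof. by rewrite trmx_mul map_mxM. Qed.

Lemma adjB m n (A B : 'M[R[i]]_(m, n)) : (A - B) ^t* = A ^t* - B ^t*.
Proof. by apply/matrixP => i j; rewrite !mxE rmorphB. Qed.

Lemma adj1 n : (1%:M : 'M[R[i]]_n) ^t* = 1%:M.
Proof. by rewrite trmx1 map_mx1. Qed.

Lemma unitary_mulK n (U : 'M[R[i]]_n) : U \is unitarymx -> U ^t* *m U = 1%:M.
Proof.
by rewrite -trmxC_unitary => /unitarymxP; rewrite trmxCK.
Qed.

Lemma fnorm2_adj m n (X : 'M[R[i]]_(m, n)) : fnorm2 (X ^t*) = fnorm2 X.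
Proof. by rewrite /fnorm2 trmxCK mxtrace_mulC. Qed.

Lemma fnorm2_mull m n (U : 'M[R[i]]_m) (X : 'M[R[i]]_(m, n)) :
  U \is unitarymx -> fnorm2 (U *m X) = fnorm2 X.
Proof.
move=> uU; rewrite /fnorm2 adjM mulmxA mxtrace_mulC -(mulmxA U) (mulmxA (U ^t*)).
by rewrite (unitary_mulK uU) mul1mx.
Qed.

Lemma fnorm2_mulr m n (U : 'M[R[i]]_n) (X : 'M[R[i]]_(m, n)) :
  U \is unitarymx -> fnorm2 (X *m U) = fnorm2 X.
Proof.
move=> uU; have uV : U ^t* \is unitarymx by rewrite trmxC_unitary.
by rewrite -[LHS]fnorm2_adj adjM (fnorm2_mull _ uV) fnorm2_adj.
Qed.

Lemma fnorm2N m n (X : 'M[R[i]]_(m, n)) : fnorm2 (- X) = fnorm2 X.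
Proof.
by rewrite !fnorm2E; apply: eq_bigr => i _; apply: eq_bigr => j _; rewrite mxE ReN ImN !sqrrN.
Qed.

Lemma fnorm2_coord m n (X : 'M[R[i]]_(m, n)) i j :
  complex.Re (X i j) ^+ 2 + complex.Im (X i j) ^+ 2 <= fnorm2 X.
Proof.
rewrite fnorm2E (bigD1 i)//= (bigD1 j)//= -addrA lerDl addr_ge0 ?sumr_ge0// => [k _|k _].
  by rewrite addr_ge0 ?sqr_ge0.
by apply: sumr_ge0 => l _; rewrite addr_ge0 ?sqr_ge0.
Qed.

Lemma fnorm2_small m n (X : 'M[R[i]]_(m, n)) (e : R) :
  (forall i j, `|X i j| <= e%:C) -> fnorm2 X <= (m * n)%:R * e ^+ 2.
Proof.
move=> Xe; rewrite fnorm2E.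
apply: (@le_trans _ _ (\sum_(i < m) \sum_(j < n) e ^+ 2)).
  apply: ler_sum => i _; apply: ler_sum => j _.
  rewrite -lecR add_Re2_Im2 [X in _ <= X]rmorphXn /=.
  by rewrite lerXn2r ?nnegrE// (le_trans _ (Xe i j)).
rewrite (eq_bigr (fun _ => n%:R * e ^+ 2)) => [|i _].
  by rewrite sumr_const card_ord -mulrnAl natrM mulr_natl.
by rewrite sumr_const card_ord mulr_natl.
Qed.

Lemma measurable_fnorm2 d (T : measurableType d) m n (f : T -> 'M[R[i]]_(m, n)) :
  mmeas f -> measurable_fun setT (fun w => fnorm2 (f w)).
Proof.
by move=> mf; have [] : cmeas (fun w => \tr (f w *m (f w) ^t*));
  [apply: cmeas_tr; apply: mmeasM => //; exact: mmeas_adj|].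
Qed.

Lemma continuous_Re_coord m n i j :
  continuous (fun X : 'M[R[i]^o]_(m, n) => complex.Re (X i j)).
Proof.
move=> X A /nbhs_ballP[e /= e0 eA].
apply/nbhs_ballP; exists (e%:C) => /=; first by rewrite ltcR.
move=> Y [_ /(_ i j)]; rewrite -ball_normE /= => H.
apply: eA; rewrite -ball_normE /= -ltcR; apply: le_lt_trans H.
by rewrite -ReN -ReD; exact: normc_ge_Re.
Qed.

Lemma normc_ge_Im (x : R[i]) : `|complex.Im x|%:C <= `|x|.
Proof.
rewrite -[leRHS]mulr1 -[X in _ <= _ * X](normCi R[i]) -normrM mulrC.
by apply: le_trans (normc_ge_Re _); rewrite ReM /= mul0r mul1r sub0r normrN.
Qed.

Lemma continuous_Im_coord m n i j :
  continuous (fun X : 'M[R[i]^o]_(m, n) => complex.Im (X i j)).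
Proof.
move=> X A /nbhs_ballP[e /= e0 eA].
apply/nbhs_ballP; exists (e%:C) => /=; first by rewrite ltcR.
move=> Y [_ /(_ i j)]; rewrite -ball_normE /= => H.
apply: eA; rewrite -ball_normE /= -ltcR; apply: le_lt_trans H.
by rewrite -ImN -ImD; exact: normc_ge_Im.
Qed.

Lemma continuous_fnorm2B m n (A : 'M[R[i]]_(m, n)) :
  continuous ((fun X => fnorm2 (A - X)) : 'M[R[i]^o]_(m, n) -> R).
Proof.
move=> X.
have E (Y : 'M[R[i]^o]_(m, n)) : fnorm2 (A - Y) = \sum_i \sum_j
    ((complex.Re (A i j) - complex.Re (Y i j)) ^+ 2 +
     (complex.Im (A i j) - complex.Im (Y i j)) ^+ 2).
  rewrite fnorm2E; apply: eq_bigr => i _; apply: eq_bigr => j _.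
  by rewrite !mxE ReD ImD ReN ImN.
have FX : Filter (nbhs X) := @nbhs_filter 'M[R[i]^o]_(m, n) X.
rewrite /continuous_at E; under eq_fun do rewrite E.
apply: (@cvg_big R^o) => [|i _]; first exact: (@add_continuous R^o).
apply: (@cvg_big R^o) => [|j _]; first exact: (@add_continuous R^o).
apply: (@cvgD _ R^o); rewrite !expr2; under eq_fun do rewrite expr2.
  apply: cvgM; apply: (@cvgB _ R^o); (exact: cvg_cst || exact: continuous_Re_coord).
apply: cvgM; apply: (@cvgB _ R^o); (exact: cvg_cst || exact: continuous_Im_coord).
Qed.

End fnorm2.

(** * Invariant measures on unitary orbits *)

Lemma fubini_sections d1 d2 (T1 : measurableType d1) (T2 : measurableType d2) (R : realType)
    (mu : probability T1 R) (nu : probability T2 R) (S : set (T1 * T2)) : measurable S ->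
  (\int[mu]_x nu [set y | S (x, y)] = \int[nu]_y mu [set x | S (x, y)])%E.
Proof.
move=> mS; have := @indic_fubini_tonelli _ _ _ _ R mu nu S mS.
rewrite /fubini_F /fubini_G /= => H.
have E1 x : (\int[nu]_y ((\1_S (x, y))%:E) = nu [set y | S (x, y)])%E.
  rewrite -(setIT [set y | S (x, y)]) -integral_indic//.
  exact: (measurable_preimage (pair1_measurable x) mS).
have E2 y : (\int[mu]_x ((\1_S (x, y))%:E) = mu [set x | S (x, y)])%E.
  rewrite -(setIT [set x | S (x, y)]) -integral_indic//.
  exact: (measurable_preimage (pair2_measurable y) mS).
by rewrite (eq_integral _ _ (fun x _ => esym (E1 x))) H; apply: eq_integral => y _; rewrite E2.
Qed.

Lemma measurable_section1 d1 d2 (T1 : measurableType d1) (T2 : measurableType d2) (R : realType)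
    (nu : probability T2 R) (S : set (T1 * T2)) : measurable S ->
  measurable_fun setT (fun x => nu [set y | S (x, y)]).
Proof.
move=> mS; rewrite (_ : (fun _ => _) = nu \o xsection S); first exact: measurable_fun_xsection.
by apply/funext => x /=; congr (nu _); apply/seteqP; split => y /=; rewrite /xsection /= inE.
Qed.

Lemma measurable_section2 d1 d2 (T1 : measurableType d1) (T2 : measurableType d2) (R : realType)
    (mu : probability T1 R) (S : set (T1 * T2)) : measurable S ->
  measurable_fun setT (fun y => mu [set x | S (x, y)]).
Proof.
move=> mS; rewrite (_ : (fun _ => _) = mu \o ysection S); first exact: measurable_fun_ysection.
by apply/funext => x /=; congr (mu _); apply/seteqP; split => y /=; rewrite /ysection /= inE.
Qed.

Section orbit_uniqueness.
Context (R : realType) (n : nat).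
Local Notation X := (borelmx R n n).
Implicit Types (mu nu : probability X R) (p q : 'M[R[i]]_n).

Definition conj_invariant mu := forall U : 'M[R[i]]_n, U \is unitarymx ->
  forall B : set X, measurable B -> mu [set p | B (U *m (p : 'M[R[i]]_n) *m U ^t*)] = mu B.

Definition orbit (p0 : 'M[R[i]]_n) : set X :=
  [set p | exists2 U : 'M[R[i]]_n, U \is unitarymx & (p : 'M[R[i]]_n) = U *m p0 *m U ^t*].

Definition kernel_set (e : R) : set (X * X) :=
  [set pq | fnorm2 ((pq.1 : 'M[R[i]]_n) - pq.2) < e].

Lemma measurable_kernel_set e : measurable (kernel_set e).
Proof.
apply: measurable_lt; last exact: measurable_cst.
apply: measurable_fnorm2; apply: mmeasB; first exact: mmeas_comp (@mmeas_id _ _ _) measurable_fst.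
exact: mmeas_comp (@mmeas_id _ _ _) measurable_snd.
Qed.

Lemma measurable_rbox (r : 'M[rat * rat]_n * nat) : measurable (rbox r : set X).
Proof.
apply: measurable_forall_fin => i; apply: measurable_forall_fin => j.
have [m1 m2] := @mmeas_id R n n i j.
apply: measurableI; apply: measurable_lt => //; apply: measurableT_comp => //;
  exact: measurable_funB.
Qed.

Definition ball_mass mu (e : R) q := mu [set p | fnorm2 ((p : 'M[R[i]]_n) - q) < e].

Lemma measurable_fball e q : measurable [set p : X | fnorm2 ((p : 'M[R[i]]_n) - q) < e].
Proof.
apply: measurable_lt; last exact: measurable_cst.
by apply: measurable_fnorm2; apply: mmeasB; [exact: mmeas_id|exact: mmeas_cst].
Qed.

Lemma ball_mass_orbit mu e (p0 : 'M[R[i]]_n) q : conj_invariant mu -> orbit p0 q ->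
  ball_mass mu e q = ball_mass mu e p0.
Proof.
move=> cmu [U uU ->]; rewrite /ball_mass.
have uV : U ^t* \is unitarymx by rewrite trmxC_unitary.
apply: etrans (cmu _ uV _ (measurable_fball e p0)); congr (mu _); rewrite trmxCK.
have E p : fnorm2 (U ^t* *m p *m U - p0) = fnorm2 (p - U *m p0 *m U ^t*).
  rewrite -[RHS](fnorm2_mull _ uV) -[RHS](fnorm2_mulr _ uU) mulmxBr mulmxBl.
  by rewrite !mulmxA (unitary_mulK uU) mul1mx -(mulmxA p0) (unitary_mulK uU) mulmx1.
by apply/seteqP; split => p /=; rewrite E.
Qed.

(** Countably many boxes of a fixed small size cover the space, so one of them has positive mass and
    hence meets the orbit. The ball around a common point contains that box, and all balls centred
    on the orbit have equal mass. *)
Lemma ball_mass_gt0 mu e (p0 : 'M[R[i]]_n) : conj_invariant mu -> 0 < e ->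
  {ae mu, forall p, orbit p0 p} -> (0 < ball_mass mu e p0)%E.
Proof.
move=> cmu e0 aemu.
(* The left side bounds [fnorm2] of the difference of two points of a box. The 16 is the square of
   4, using [b ^+ 2 <= b] for [b = 1 / (k + 1)]; the added 1 keeps the divisor positive when
   [n = 0]. *)
have [k ke] : exists k, (n * n)%:R * (4 * k.+1%:R^-1) ^+ 2 < e :> R.
  have c0 : 0 < ((n * n)%:R * 16 + 1 : R) by rewrite ltr_wpDl ?mulr_ge0.
  have [k] : exists k, 0 + k.+1%:R^-1 < e / ((n * n)%:R * 16 + 1) :> R.
    by apply: ltr_add_invr; rewrite divr_gt0.
  rewrite add0r ltr_pdivlMr// => ke; exists k; apply: le_lt_trans ke.
  have b0 : 0 <= k.+1%:R^-1 :> R by rewrite invr_ge0.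
  have b1 : k.+1%:R^-1 <= 1 :> R by rewrite invf_le1 ?ler1n.
  have a0 : 0 <= (n * n)%:R :> R by [].
  move: (k.+1%:R^-1) ((n * n)%:R) b0 b1 a0 => b a b0 b1 a0.
  have ab := mulr_ge0 (mulr_ge0 a0 b0) (_ : 0 <= 1 - b); rewrite subr_ge0 in ab.
  have := ab b1; nra.
have [r mur] : exists r : 'M[rat * rat]_n, mu (rbox (r, k)) != 0%E.
  apply: contrapT => /forallNP H.
  pose F (j : nat) : set X :=
    if (unpickle j : option 'M[rat * rat]_n) is Some r then rbox (r, k) else set0.
  have mF j : measurable (F j) by rewrite /F; case: unpickle => // r; exact: measurable_rbox.
  have : (mu [set: X] <= 0)%E.
    have -> : [set: X] = \bigcup_j F j.
      apply/seteqP; split => // Y _; have [r rY] := rbox_exists Y k.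
      by exists (pickle r) => //; rewrite /F pickleK.
    apply: le_trans (measure_sigma_subadditive mu mF (bigcupT_measurable _ mF) _) _ => //.
    rewrite eseries0// => j _ _; rewrite /F; case: unpickle => [r|]; last by rewrite measure0.
    by have := H r; case: eqP.
  by rewrite probability_setT leNgt lte01.
have [p [pr op]] : exists p : X, rbox (r, k) p /\ orbit p0 p.
  apply: contrapT => /forallNP H; move: mur; rewrite -measure_gt0 => mur.
  have [N [mN N0 subN]] := aemu.
  suff : (mu (rbox (r, k)) <= mu N)%E by rewrite N0 leNgt mur.
  apply: le_measure; rewrite ?inE//; first exact: measurable_rbox.
  by move=> x xr; apply: subN => /= ox; exact: (H x).
rewrite -(ball_mass_orbit e cmu op).
apply: (@lt_le_trans _ _ (mu (rbox (r, k)))); first by rewrite measure_gt0.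
apply: le_measure; rewrite ?inE; [exact: measurable_rbox|exact: measurable_fball|].
move=> x xr /=; apply: le_lt_trans ke; apply: fnorm2_small => i j.
by rewrite !mxE; apply: ltW; exact: rbox_close xr pr.
Qed.

Definition thickening (C : set X) (e : R) : set X :=
  [set q | exists2 p, C p & fnorm2 ((p : 'M[R[i]]_n) - q) < e].

Lemma open_thickening (C : set X) e : open (thickening C e : set 'M[R[i]^o]_n).
Proof.
have -> : thickening C e = \bigcup_(p in C) [set q | fnorm2 ((p : 'M[R[i]]_n) - q) < e].
  by apply/seteqP; split => q /= [p Cp H]; exists p.
apply: bigcup_open => p _.
apply: (@open_comp _ R^o (fun q : 'M[R[i]^o]_n => fnorm2 (p - q)) [set x | x < e]).
  by move=> q _; exact: continuous_fnorm2B.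
exact: open_lt.
Qed.

Lemma measurable_open (C : set 'M[R[i]^o]_n) : open C -> measurable (C : set X).
Proof. exact: sub_sigma_algebra. Qed.

Lemma measurable_closed (C : set 'M[R[i]^o]_n) : closed C -> measurable (C : set X).
Proof.
move=> cC; rewrite -(setCK C); apply: measurableC; apply: measurable_open.
exact: closed_openC.
Qed.

(** Both sides come from the measure of one set [S] of pairs under the product measure. Its sections
    at a point of [C] on the orbit are full balls, which gives equality on the left; its sections at
    [y] lie in a ball and are empty off the thickening, which gives the bound on the right. *)
Lemma thickening_mass mu nu (p0 : 'M[R[i]]_n) (C : set X) e : 0 < e ->
  conj_invariant mu -> conj_invariant nu ->
  {ae mu, forall p, orbit p0 p} -> {ae nu, forall p, orbit p0 p} -> measurable C ->
  (ball_mass nu e p0 * mu C <= ball_mass mu e p0 * nu (thickening C e))%E.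
Proof.
move=> e0 cmu cnu amu anu mC.
pose S : set (X * X) := (C `*` setT) `&` kernel_set e.
have mS : measurable S by apply: measurableI; [exact: measurableX|exact: measurable_kernel_set].
have mE := measurable_open (@open_thickening C e).
have mcst (Y : set X) (c : \bar R) : measurable Y ->
    measurable_fun setT (fun x => c * (\1_Y x)%:E)%E.
  by move=> mY; apply: measurable_funeM; apply/measurable_EFinP; exact: measurable_indic.
have L : (\int[mu]_x nu [set y | S (x, y)] = ball_mass nu e p0 * mu C)%E.
  transitivity (\int[mu]_x (ball_mass nu e p0 * (\1_C x)%:E))%E; last first.
    rewrite ge0_integralZl//; first by rewrite integral_indic// setIT.
    by apply/measurable_EFinP; exact: measurable_indic.
  apply: ge0_ae_eq_integral => //.
  - exact: measurable_section1.
  - exact: mcst.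
  - by move=> x _; rewrite mule_ge0.
  case: amu => N [mN N0 subN]; exists N; split => //; apply: subset_trans subN.
  move=> x /= + ox; apply => _; rewrite indicE.
  have [xC|xC] := boolP (x \in C).
    rewrite mule1 -(ball_mass_orbit e cnu ox); congr (nu _).
    apply/seteqP; split => y /=; rewrite -fnorm2N opprB; first by case.
    by move=> ?; split => //; split => //; exact/set_mem.
  rewrite mule0 (_ : [set y | _] = set0) ?measure0//.
  by apply/seteqP; split => // y [[/= Cx]]; move: xC; rewrite notin_setE.
rewrite -L fubini_sections//.
apply: (@le_trans _ _ (\int[nu]_y (ball_mass mu e p0 * (\1_(thickening C e) y)%:E))%E).
  apply: ae_ge0_le_integral => //.
  - exact: measurable_section2.
  - by move=> x _; rewrite mule_ge0.
  - exact: mcst.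
  case: anu => N [mN N0 subN]; exists N; split => //; apply: subset_trans subN.
  move=> y /= + oy; apply => _; rewrite indicE.
  have [yE|yE] := boolP (y \in thickening C e).
    rewrite mule1 -(ball_mass_orbit e cmu oy); apply: le_measure; rewrite ?inE.
    - exact: (measurable_preimage (pair2_measurable y) mS).
    - exact: measurable_fball.
    - by move=> x [].
  rewrite mule0 (_ : [set x | _] = set0) ?measure0//.
  apply/seteqP; split => // x [[/= Cx _] xy]; move: yE; rewrite notin_setE; apply.
  by exists x.
rewrite ge0_integralZl//; first by rewrite integral_indic// setIT.
by apply/measurable_EFinP; exact: measurable_indic.
Qed.

Lemma closed_mass_le mu nu (p0 : 'M[R[i]]_n) (C : set 'M[R[i]^o]_n) :
  conj_invariant mu -> conj_invariant nu ->
  {ae mu, forall p, orbit p0 p} -> {ae nu, forall p, orbit p0 p} -> closed C ->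
  (mu C <= nu C)%E.
Proof.
move=> cmu cnu amu anu cC; have mC := measurable_closed cC.
(* Taking the whole space for [C] compares the two ball masses. Used in both directions this makes
   them equal, so that this positive finite factor can be cancelled. *)
have ball_le m1 m2 e : 0 < e -> conj_invariant m1 -> conj_invariant m2 ->
    {ae m1, forall p, orbit p0 p} -> {ae m2, forall p, orbit p0 p} ->
    (ball_mass m2 e p0 <= ball_mass m1 e p0)%E.
  move=> e0 c1 c2 a1 a2; have := thickening_mass e0 c1 c2 a1 a2 measurableT.
  rewrite probability_setT mule1 => /le_trans; apply.
  rewrite -[leRHS]mule1; apply: lee_wpmul2l => //; apply: probability_le1.
  exact: (measurable_open (@open_thickening _ _)).
have thick e : 0 < e -> (mu C <= nu (thickening C e))%E.
  move=> e0; have := thickening_mass e0 cmu cnu amu anu mC.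
  have -> : ball_mass nu e p0 = ball_mass mu e p0.
    by apply/eqP; rewrite eq_le !ball_le.
  rewrite lee_pmul2l ?fin_num_measure//; first exact: measurable_fball.
  exact: ball_mass_gt0.
(* The thickenings decrease to [C], since [C] is closed, and continuity from above of [nu]
   concludes. *)
pose F k := thickening C k.+1%:R^-1.
have mF k : measurable (F k) by exact: (measurable_open (@open_thickening _ _)).
have FC : \bigcap_k F k = C.
  apply/seteqP; split => x; last first.
    by move=> Cx k _; exists x => //; rewrite subrr /fnorm2 mul0mx mxtrace0 invr_gt0.
  move=> Fx; apply: cC => B /nbhs_ballP[e /= e0 eB].
  have [er ee] : 0 < complex.Re e /\ e = (complex.Re e)%:C.
    move: e0; rewrite ltcE /= => /andP[/eqP ime ->]; split => //.
    by case: {eB} e ime => a b /= ->.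
  have [k] : exists k, 0 + k.+1%:R^-1 < complex.Re e ^+ 2 :> R.
    by apply: ltr_add_invr; rewrite exprn_gt0.
  rewrite add0r => ke; have [p Cp /lt_trans/(_ ke) H] := Fx k I.
  exists p; split => //; apply: eB; split => // i j; rewrite -ball_normE /=.
  rewrite distrC ee normc_def ltcR -[ltRHS]ger0_norm ?(ltW er)// -sqrtr_sqr ltr_sqrt ?exprn_gt0//.
  by apply: le_lt_trans H; have := fnorm2_coord (p - x) i j; rewrite !mxE.
have cv : (nu \o F) x @[x --> \oo] --> nu C.
  rewrite -FC; apply: nonincreasing_cvg_mu => //.
  - by rewrite (le_lt_trans (probability_le1 _ _))// ltry.
  - by rewrite FC.
  - move=> a b ab; apply/subsetPset => x [p Cp H]; exists p => //; apply: lt_le_trans H _.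
    by rewrite lef_pV2 ?posrE// ler_nat ltnS.
apply: cvge_ge cv; apply: nearW => k /=; apply: thick; by rewrite invr_gt0.
Qed.

(* Balls of a given radius centred on the orbit all have the same positive mass,
   for [mu] and, by Fubini, with the same value for [nu]. Integrating the
   indicator of [|p - q| < e] over [C x X] then bounds [mu C] by [nu] of the
   [e]-thickening of [C], and [e] tends to [0]. *)
Lemma orbit_measure_unique mu nu (p0 : 'M[R[i]]_n) :
  conj_invariant mu -> conj_invariant nu ->
  {ae mu, forall p, orbit p0 p} -> {ae nu, forall p, orbit p0 p} ->
  forall B : set X, measurable B -> mu B = nu B.
Proof.
move=> cmu cnu amu anu.
have cl (C : set 'M[R[i]^o]_n) : closed C -> mu C = nu C.
  move=> cC; apply/eqP; rewrite eq_le.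
  by rewrite (closed_mass_le cmu cnu amu anu cC) (closed_mass_le cnu cmu anu amu cC).
have op (A : set 'M[R[i]^o]_n) : open A -> mu A = nu A.
  move=> oA; have mA := measurable_open oA.
  have E (m : probability X R) : m A = (1 - m (~` A))%E.
    by rewrite -probability_setC ?setCK//; exact: measurableC.
  by rewrite !E cl//; exact: open_closedC.
apply: (@measure_unique _ R X (@open 'M[R[i]^o]_n) (fun=> setT)) => //.
- by move=> A B; exact: openI.
- by move=> _; exact: openT.
- by apply/seteqP; split => // x _; exists 0%N.
- by move=> _; rewrite (le_lt_trans (probability_le1 _ _))// ltry.
Qed.

End orbit_uniqueness.

Section law.
Context d d' (T : measurableType d) (T' : measurableType d') (R : realType).

Definition law (P : probability T R) (f : T -> T') (mf : measurable_fun setT f) :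
  probability T' R := distribution P (mfun_Sub (mem_set mf)).

Lemma lawE (P : probability T R) (f : T -> T') (mf : measurable_fun setT f) B :
  law P mf B = P [set w | B (f w)].
Proof. by []. Qed.

Lemma ge0_integral_law (P : probability T R) (f : T -> T') (mf : measurable_fun setT f) (g : T' -> \bar R) :
  measurable_fun setT g -> (forall y, 0 <= g y)%E ->
  (\int[law P mf]_y g y = \int[P]_x g (f x))%E.
Proof. by move=> mg g0; rewrite ge0_integral_distribution. Qed.

Lemma ae_law (P : probability T R) (f : T -> T') (mf : measurable_fun setT f) (B : set T') :
  {ae P, forall w, B (f w)} -> measurable B -> {ae law P mf, forall y, B y}.
Proof.
move=> [N [mN N0 subN]] mB; exists (~` B); split; [exact: measurableC| |by []].
apply/eqP; rewrite eq_le measure_ge0 andbT -N0 lawE; apply: le_measure; rewrite ?inE//.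
by apply: measurable_preimage => //; exact: measurableC.
Qed.

End law.

Lemma ae_imply2 d (T : measurableType d) (R : realType) (P : probability T R)
    (A B C : T -> Prop) : {ae P, forall x, A x} -> {ae P, forall x, B x} ->
  (forall x, A x -> B x -> C x) -> {ae P, forall x, C x}.
Proof. by move=> aA aB h; apply: (filterS2 _ _ aA aB) => x; exact: h. Qed.

Lemma ae_imply d (T : measurableType d) (R : realType) (P : probability T R)
    (A C : T -> Prop) : {ae P, forall x, A x} -> (forall x, A x -> C x) -> {ae P, forall x, C x}.
Proof. by move=> aA h; apply: (filterS _ aA) => x; exact: h. Qed.

Lemma ae_prob1 d (T : measurableType d) (R : realType) (P : probability T R) (A : set T) :
  measurable A -> P A = 1%E -> {ae P, forall w, A w}.
Proof.
move=> mA PA; exists (~` A); split => //; first exact: measurableC.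
by rewrite probability_setC// PA subee.
Qed.

Lemma ae_measure0 d (T : measurableType d) (R : realType) (P : probability T R) (A : set T) :
  measurable A -> {ae P, forall w, A w} -> P (~` A) = 0%E.
Proof.
move=> mA [N [mN N0 subN]]; apply/eqP; rewrite eq_le measure_ge0 andbT -N0.
by apply: le_measure; rewrite ?inE//; exact: measurableC.
Qed.

(** * Orthogonal projectors as a single unitary orbit *)

Section projections.
Context (R : realType).
Implicit Types m n : nat.

(** [W] is an orthonormal basis of the orthogonal complement of the rows of [V]. The last identity
    holds because [V] stacked on [W] is square, so its right inverse is also a left inverse. *)
Lemma schmidt_basis m n (V : 'M[R[i]]_(m, m + n)) : V *m V ^t* = 1%:M ->
  exists W : 'M[R[i]]_(n, m + n),
    [/\ W *m W ^t* = 1%:M, W *m V ^t* = 0, V *m W ^t* = 0 &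
        V ^t* *m V + W ^t* *m W = 1%:M].
Proof.
move=> VV; have uV : V \is unitarymx by apply/unitarymxP.
have [W [WW WV VW]] : exists W : 'M[R[i]]_(n, m + n),
    [/\ W *m W ^t* = 1%:M, W *m V ^t* = 0 & V *m W ^t* = 0].
  set O := orthomx (@Num.conj_op _) (mx_of_hermitian (hermitian1mx _)) V.
  have rk : \rank O = n by rewrite rank_ortho mxrank_unitary// addKn.
  have : exists W : 'M[R[i]]_(\rank O, m + n),
      [/\ W *m W ^t* = 1%:M, W *m V ^t* = 0 & V *m W ^t* = 0].
    exists (schmidt (row_base O)); split.
    - by apply/unitarymxP; rewrite schmidt_unitarymx// rank_leq_col.
    - by apply/orthomx1P; rewrite eqmx_schmidt_free ?row_base_free// eq_row_base.
    - by apply/orthomx1P; rewrite orthomx_sym eqmx_schmidt_free ?row_base_free// eq_row_base.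
  by rewrite rk.
exists W; split => //.
have : (col_mx V W) *m (col_mx V W) ^t* = 1%:M.
  by rewrite tr_col_mx map_row_mx mul_col_row VV WW WV VW -scalar_mx_block.
by move=> /mulmx1C; rewrite tr_col_mx map_row_mx mul_row_col.
Qed.

Definition rproj n m (Z : 'M[R[i]]_(n, m)) : 'M[R[i]]_n :=
  Z *m invmx (Z ^t* *m Z) *m Z ^t*.

Definition fullrank n m (Z : 'M[R[i]]_(n, m)) : bool := Z ^t* *m Z \in unitmx.

Lemma invmxM n (A B : 'M[R[i]]_n) : A \in unitmx -> B \in unitmx ->
  invmx (A *m B) = invmx B *m invmx A.
Proof.
move=> uA uB; have uAB : A *m B \in unitmx by rewrite unitmx_mul uA.
apply: (can_inj (mulKmx uAB)).
by rewrite mulmxV// !mulmxA -(mulmxA A) mulmxV// mulmx1 mulmxV.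
Qed.

Lemma adj_invmx n (A : 'M[R[i]]_n) : (invmx A) ^t* = invmx (A ^t*).
Proof. by rewrite trmx_inv map_invmx. Qed.

(** Multiplying the hypothesis by [v^*] on the right gives the squared norm of [v Z^*]. *)
Lemma gram_kernel n m (Z : 'M[R[i]]_(n, m)) (v : 'rV[R[i]]_m) :
  v *m (Z ^t* *m Z) = 0 -> v *m Z ^t* = 0.
Proof.
move=> H; have : fnorm2 (v *m Z ^t*) = 0.
  by rewrite /fnorm2 adjM trmxCK !mulmxA -(mulmxA v) H mul0mx mxtrace0.
rewrite fnorm2E => /eqP; rewrite psumr_eq0 => [|i _]; last first.
  by apply: sumr_ge0 => j _; rewrite addr_ge0 ?sqr_ge0.
move=> /allP/(_ ord0 (mem_index_enum _))/=.
rewrite psumr_eq0 => [/allP H0|j _]; last by rewrite addr_ge0 ?sqr_ge0.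
apply/matrixP => i j; rewrite ord1 [RHS]mxE.
have := H0 j (mem_index_enum _); rewrite /= paddr_eq0 ?sqr_ge0// !sqrf_eq0 => /andP[a b].
by apply/eqP; rewrite eq_complex a b.
Qed.

Lemma fullrank_rowfree n m (Z : 'M[R[i]]_(n, m)) : fullrank Z = row_free (Z ^t*).
Proof.
apply/idP/idP.
  rewrite /fullrank -row_free_unit => H; apply/row_freeP.
  by have /row_freeP[B HB] := H; exists (Z *m B); rewrite mulmxA.
move=> H; rewrite /fullrank -row_free_unit -kermx_eq0; apply/rowV0P => v /sub_kermxP.
move=> /gram_kernel; move/row_freeP : H => [B HB] /(congr1 (mulmx^~ B)).
by rewrite -mulmxA HB mulmx1 mul0mx.
Qed.

Lemma isometry_fullrank n m (Z : 'M[R[i]]_(n, m)) : Z ^t* *m Z = 1%:M -> fullrank Z.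
Proof. by rewrite /fullrank => ->; exact: unitmx1. Qed.

Lemma rproj_isometry n m (Z : 'M[R[i]]_(n, m)) : Z ^t* *m Z = 1%:M -> rproj Z = Z *m Z ^t*.
Proof. by rewrite /rproj => ->; rewrite invmx1 mulmx1. Qed.

(** Gram-Schmidt on the rows of [Z^*] gives [Z^* = B V] with [B] invertible, and [B] cancels in
    [rproj Z]. *)
Lemma fullrank_polar n m (Z : 'M[R[i]]_(n, m)) : fullrank Z ->
  exists V : 'M[R[i]]_(m, n), V *m V ^t* = 1%:M /\ rproj Z = V ^t* *m V.
Proof.
rewrite fullrank_rowfree => fZ.
have mn : (m <= n)%N by have := rank_leq_col (Z ^t*); rewrite (eqP fZ).
pose V := schmidt (Z ^t*); exists V.
have VV : V *m V ^t* = 1%:M by apply/unitarymxP; exact: schmidt_unitarymx.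
split=> //.
have /submxP[B ZB] : (Z ^t* <= V)%MS by rewrite eqmx_schmidt_free.
have Bu : B \in unitmx.
  rewrite -row_free_unit; apply/row_freeP; move/row_freeP : fZ => [C HC].
  by exists (V *m C); rewrite mulmxA -ZB.
have ZE : Z = V ^t* *m B ^t* by rewrite -[Z]trmxCK ZB adjM.
have Bau : B ^t* \in unitmx by rewrite map_unitmx unitmx_tr.
have gram : Z ^t* *m Z = B *m B ^t* by rewrite ZB ZE mulmxA -(mulmxA B) VV mulmx1.
rewrite /rproj gram invmxM// ZB ZE.
move: (mulmxV Bau) (mulVmx Bu); move: (invmx (B ^t*)) (invmx B) => C' C BC CB.
by rewrite -!mulmxA (mulmxA C) CB mul1mx (mulmxA (B ^t*)) BC mul1mx.
Qed.

(** Complete the orthonormal bases [V] and [V0] of the two column spaces by [W] and [W0]. The matrix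
    [V^* V0 + W^* W0] changes one full basis into the other and conjugates one projector into the
    other. *)
Lemma rproj_orbit n m (Z Z0 : 'M[R[i]]_(n, m)) : fullrank Z -> fullrank Z0 ->
  orbit (rproj Z0) (rproj Z).
Proof.
move=> fZ fZ0; have [k nk] : exists k, n = (m + k)%N.
  exists (n - m)%N; rewrite subnKC//.
  by move: fZ; rewrite fullrank_rowfree => /eqP <-; exact: rank_leq_col.
move: Z Z0 fZ fZ0; rewrite nk => Z Z0 /fullrank_polar[V [VV ->]] /fullrank_polar[V0 [VV0 ->]].
have [W [WW WV VW S]] := schmidt_basis VV.
have [W0 [WW0 WV0 VW0 S0]] := schmidt_basis VV0.
pose U := V ^t* *m V0 + W ^t* *m W0.
have UV : U *m V0 ^t* = V ^t*.
  by rewrite mulmxDl -!mulmxA VV0 WV0 mulmx1 mulmx0 addr0.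
have UW : U *m W0 ^t* = W ^t*.
  by rewrite mulmxDl -!mulmxA VW0 WW0 mulmx1 mulmx0 add0r.
have UVa : V0 *m U ^t* = V by rewrite -[LHS]trmxCK adjM trmxCK UV trmxCK.
have UWa : W0 *m U ^t* = W by rewrite -[LHS]trmxCK adjM trmxCK UW trmxCK.
exists U; first by apply/unitarymxP; rewrite {1}/U mulmxDl -!mulmxA UVa UWa.
by rewrite mulmxA UV -mulmxA UVa.
Qed.

(** The rank is recorded by the trace, which makes the condition a system of measurable
    equations. *)
Definition is_projector n m (p : 'M[R[i]]_n) :=
  [/\ p ^t* = p, p *m p = p & \tr p = m%:R].

Lemma fullrank_projector n m (Z : 'M[R[i]]_(n, m)) : fullrank Z -> is_projector m (rproj Z).
Proof.
move=> /fullrank_polar[V [VV ->]]; split.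
- by rewrite adjM trmxCK.
- by rewrite mulmxA -(mulmxA _ V) VV mulmx1.
- by rewrite mxtrace_mulC VV mxtrace1.
Qed.

Lemma projector_polar n m (p : 'M[R[i]]_n) : is_projector m p ->
  exists V : 'M[R[i]]_(m, n), V *m V ^t* = 1%:M /\ p = V ^t* *m V.
Proof.
move=> [pa pp trp].
have [r [V [VV Vp]]] : exists r, exists V : 'M[R[i]]_(r, n),
    V *m V ^t* = 1%:M /\ (V :=: p)%MS.
  exists (\rank p); exists (schmidt (row_base p)); split.
    by apply/unitarymxP; rewrite schmidt_unitarymx// rank_leq_col.
  apply: eqmx_trans (eq_row_base p); exact: eqmx_schmidt_free (row_base_free p).
have pV : p = V ^t* *m V.
  have /submxP[C pC] : (p <= V)%MS by rewrite Vp.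
  have /submxP[D VD] : (V <= p)%MS by rewrite Vp.
  have VpV : V *m p = V by rewrite VD -mulmxA pp.
  have pE : p = V ^t* *m C ^t* by rewrite -[LHS]pa pC adjM.
  have : V ^t* *m V *m p = p.
    by rewrite {1}pE !mulmxA -(mulmxA _ V) VV mulmx1 -pE.
  by rewrite -mulmxA VpV => ->.
(* [r] is the rank of [p]. It equals [m] because both are the trace of [p] and distinct naturals
   stay distinct in [R[i]]. *)
suff rm : r = m by move: rm V VV pV {Vp} => -> V VV pV; exists V.
apply/eqP; rewrite -(@eqr_nat R[i]) -trp; apply/eqP.
by rewrite [in RHS]pV mxtrace_mulC VV mxtrace1.
Qed.

Lemma projector_orbit n m (Z0 : 'M[R[i]]_(n, m)) p : fullrank Z0 -> is_projector m p ->
  orbit (rproj Z0) p.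
Proof.
move=> fZ0 /projector_polar[V [VV ->]].
have I : V ^t* ^t* *m V ^t* = 1%:M by rewrite trmxCK.
have := rproj_orbit (isometry_fullrank I) fZ0.
by rewrite (rproj_isometry I) trmxCK.
Qed.

Lemma mmeas_measurable_eq d (T : measurableType d) n m (f g : T -> 'M[R[i]]_(n, m)) :
  mmeas f -> mmeas g -> measurable [set w | f w = g w].
Proof.
move=> mf mg; rewrite (_ : [set w | _] = [set w | forall i j, f w i j = g w i j]).
  apply: measurable_forall_fin => i; apply: measurable_forall_fin => j.
  exact: cmeas_measurable_eq.
by apply/seteqP; split => w /= H; [rewrite H|apply/matrixP].
Qed.

Lemma measurable_projector n m :
  measurable [set p : borelmx R n n | is_projector m (p : 'M[R[i]]_n)].
Proof.
rewrite (_ : [set p | _] = [set p : borelmx R n n | (p : 'M[R[i]]_n) ^t* = p] `&`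
  ([set p : borelmx R n n | (p : 'M[R[i]]_n) *m p = p] `&`
   [set p : borelmx R n n | \tr (p : 'M[R[i]]_n) = m%:R])); last first.
  by apply/seteqP; split => p /= [a]; [move=> b c; split|case=> b c; split].
have mi := @mmeas_id R n n.
apply: measurableI; first by apply: mmeas_measurable_eq => //; exact: mmeas_adj.
apply: measurableI; first by apply: mmeas_measurable_eq => //; exact: mmeasM.
by apply: cmeas_measurable_eq; [exact: cmeas_tr|exact: cmeas_cst].
Qed.

Lemma rproj_mull n m (U : 'M[R[i]]_n) (Z : 'M[R[i]]_(n, m)) : U \is unitarymx ->
  rproj (U *m Z) = U *m rproj Z *m U ^t*.
Proof.
move=> uU; have gram : (U *m Z) ^t* *m (U *m Z) = Z ^t* *m Z.
  by rewrite adjM mulmxA -(mulmxA (Z ^t*) _ U) unitary_mulK// mulmx1.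
by rewrite /rproj gram adjM; move: (invmx _) => C; rewrite !mulmxA.
Qed.

Lemma mmeas_rproj d (T : measurableType d) n m (Z : T -> 'M[R[i]]_(n, m)) :
  mmeas Z -> mmeas (fun w => rproj (Z w)).
Proof.
move=> mZ; apply: mmeasM; last exact: mmeas_adj.
by apply: mmeasM => //; apply: mmeas_invmx; apply: mmeasM => //; exact: mmeas_adj.
Qed.

Definition left_invariant n m (mu : probability (borelmx R n m) R) :=
  forall U : 'M[R[i]]_n, U \is unitarymx ->
  forall B : set (borelmx R n m), measurable B ->
    mu [set X | B (U *m (X : 'M[R[i]]_(n, m)))] = mu B.

Lemma measurable_rproj n m :
  measurable_fun setT (fun Z : borelmx R n m => (rproj (Z : 'M[R[i]]_(n, m)) : borelmx R n n)).
Proof. by apply: mmeas_measurable; apply: mmeas_rproj; exact: mmeas_id. Qed.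

Lemma conj_invariant_rproj n m (mu : probability (borelmx R n m) R) :
  left_invariant mu -> conj_invariant (law mu (@measurable_rproj n m)).
Proof.
move=> imu U uU B mB.
have mC : measurable [set X : borelmx R n m | B (rproj (X : 'M[R[i]]_(n, m)))].
  exact: measurable_preimage (@measurable_rproj n m) mB.
have H := imu _ uU _ mC; apply: etrans H.
transitivity (mu [set X : borelmx R n m | B (U *m rproj (X : 'M[R[i]]_(n, m)) *m U ^t*)]).
  by [].
congr (mu _); apply/seteqP; split => X /=; by rewrite rproj_mull.
Qed.

Lemma projector_law_unique n m (mu nu : probability (borelmx R n n) R) :
  conj_invariant mu -> conj_invariant nu ->
  {ae mu, forall p, is_projector m (p : 'M[R[i]]_n)} ->
  {ae nu, forall p, is_projector m (p : 'M[R[i]]_n)} ->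
  forall B : set (borelmx R n n), measurable B -> mu B = nu B.
Proof.
move=> imu inu amu anu.
(* A base point for the orbit: were there no projector of rank [m], the whole space would be
   [mu]-null. *)
have [p0 /projector_polar[V [VV _]]] : exists p : 'M[R[i]]_n, is_projector m p.
  apply: contrapT => /forallNP H; case: amu => N [mN N0 subN].
  have NT : N = setT by apply/seteqP; split => // x _; apply: subN => /= fx; exact: (H x).
  have : mu setT = 0%E by rewrite -NT; exact: N0.
  by rewrite probability_setT => /eqP; rewrite onee_eq0.
have fV : fullrank (V ^t*) by apply: isometry_fullrank; rewrite trmxCK.
have ae (m1 : probability (borelmx R n n) R) :
    {ae m1, forall p, is_projector m (p : 'M[R[i]]_n)} ->
    {ae m1, forall p, orbit (rproj (V ^t*)) p}.
  case=> N [mN N0 subN]; exists N; split => //; apply: subset_trans subN.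
  by move=> x /= + Ox; apply; exact: projector_orbit.
exact: (orbit_measure_unique imu inu (ae _ amu) (ae _ anu)).
Qed.

Lemma ae_fullrank_projector n m (mu : probability (borelmx R n m) R) :
  {ae mu, forall X, fullrank (X : 'M[R[i]]_(n, m))} ->
  {ae law mu (@measurable_rproj n m), forall p, is_projector m (p : 'M[R[i]]_n)}.
Proof.
move=> am1; apply: (@ae_law _ _ _ _ _ _ _ _ [set p : borelmx R n n | is_projector m (p : 'M[R[i]]_n)]).
  case: am1 => N [mN N0 subN]; exists N; split => //.
  by apply: subset_trans subN => x /= + fx; apply; exact: fullrank_projector.
exact: measurable_projector.
Qed.

Lemma rproj_law_unique n m (mu nu : probability (borelmx R n m) R) :
  left_invariant mu -> left_invariant nu ->
  {ae mu, forall X, fullrank (X : 'M[R[i]]_(n, m))} ->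
  {ae nu, forall X, fullrank (X : 'M[R[i]]_(n, m))} ->
  forall B : set (borelmx R n n), measurable B ->
    mu [set X | B (rproj (X : 'M[R[i]]_(n, m)))] = nu [set X | B (rproj (X : 'M[R[i]]_(n, m)))].
Proof.
move=> imu inu amu anu B mB.
exact: (projector_law_unique (conj_invariant_rproj imu) (conj_invariant_rproj inu)
  (ae_fullrank_projector amu) (ae_fullrank_projector anu) mB).
Qed.


End projections.

(** * Gaussian ensembles *)

Section std_normal.
Context (R : realType).
Local Open Scope ereal_scope.
Local Notation leb := (@lebesgue_measure R).

Definition nsd : R := Num.sqrt 2^-1.
Definition nprob : probability (measurableTypeR R) R := normal_prob (0 : R) nsd.

Lemma nsd_neq0 : nsd != 0%R.
Proof. by rewrite gt_eqF// sqrtr_gt0 invr_gt0. Qed.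

(** With variance 1/2 the exponent is exactly [- x ^+ 2], so the weight cancelling the joint density
    of all coordinates is the exponential of [fnorm2]. *)
Lemma normal_pdfN01 (x : R) :
  normal_pdf 0 nsd x = (normal_peak nsd * expR (- x ^+ 2))%R.
Proof.
rewrite normal_pdfE ?nsd_neq0// /normal_fun subr0 /nsd sqr_sqrtr ?invr_ge0//.
by congr (_ * expR _)%R; rewrite -mulr_natr mulVf// divr1.
Qed.

(** The Radon-Nikodym derivative of the normal law agrees almost everywhere with its density, both
    having the same integral over each measurable set. *)
Lemma integral_nprob (h : R -> \bar R) : measurable_fun setT h -> (forall x, 0 <= h x) ->
  \int[nprob]_x h x = \int[leb]_x (h x * (normal_peak nsd * expR (- x ^+ 2))%:E).
Proof.
move=> mh h0; have dom : nprob `<< leb by exact: normal_prob_dominates.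
rewrite -(Radon_Nikodym_SigmaFinite.change_of_variables dom)//.
pose g := Radon_Nikodym_SigmaFinite.f nprob leb.
have gi : leb.-integrable setT g by exact: Radon_Nikodym_SigmaFinite.f_integrable.
have mpdf : measurable_fun setT (fun x => (normal_pdf 0 nsd x)%:E).
  by apply/measurable_EFinP; exact: measurable_normal_pdf.
have ae : ae_eq leb setT g (fun x => (normal_pdf 0 nsd x)%:E).
  apply: integral_ae_eq => // E _ mE.
  by rewrite -(Radon_Nikodym_SigmaFinite.f_integral dom).
apply: ge0_ae_eq_integral => //.
- apply: emeasurable_funM => //; exact: measurable_int gi.
- apply: emeasurable_funM => //; apply: eq_measurable_fun mpdf => x _.
  by rewrite normal_pdfN01.
- by move=> x _; rewrite mule_ge0//; exact: Radon_Nikodym_SigmaFinite.f_ge0.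
- by move=> x _; rewrite mule_ge0// lee_fin mulr_ge0 ?expR_ge0 ?normal_peak_ge0.
case: ae => N [mN N0 subN]; exists N; split => //; apply: subset_trans subN.
by move=> x /= + H; apply => _; rewrite -normal_pdfN01 -H.
Qed.

Lemma integral_lebesgue_shift (h : R -> \bar R) (a : R) :
  measurable_fun setT h -> (forall x, 0 <= h x) ->
  \int[leb]_x h (x + a)%R = \int[leb]_x h x.
Proof.
move=> mh h0; have ms : measurable_fun setT ((fun x => x + a)%R : measurableTypeR R -> measurableTypeR R).
  by apply: measurable_funD.
transitivity (\int[pushforward leb ((fun x => x + a)%R : measurableTypeR R -> measurableTypeR R)]_x h x).
  by rewrite ge0_integral_pushforward.
apply: eq_measure_integral => A mA _; apply/esym/lebesgue_measure_unique => //= _ [[u v]] _ <-.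
rewrite /pushforward /= (_ : _ @^-1` _ = `]u - a, v - a]%classic)%R; last first.
  by apply/seteqP; split => x /=; rewrite !in_itv/= ltrBlDr lerBrDr.
by rewrite !lebesgue_measure_itv/= !lte_fin ltrD2r; case: ifP => // _; rewrite -!EFinB; congr EFin; ring.
Qed.

Lemma measurable_sqr : measurable_fun setT (fun x : R => (x ^+ 2)%R).
Proof. exact: measurable_funX. Qed.

Lemma integral_nprob_weighted (h : R -> \bar R) : measurable_fun setT h -> (forall x, 0 <= h x) ->
  \int[nprob]_x (h x * (expR (x ^+ 2))%:E) = (normal_peak nsd)%:E * \int[leb]_x h x.
Proof.
move=> mh h0; have me : measurable_fun setT (fun x : R => (expR (x ^+ 2))%:E).
  apply/measurable_EFinP; apply: measurableT_comp; [exact: measurable_expR|exact: measurable_sqr].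
rewrite integral_nprob; last 2 first.
- exact: emeasurable_funM.
- by move=> x; rewrite mule_ge0// lee_fin expR_ge0.
rewrite -ge0_integralZl//; last by rewrite lee_fin normal_peak_ge0.
apply: eq_integral => x _; rewrite -muleA -EFinM muleC; congr (_%:E * _).
by rewrite mulrCA -expRD subrr expR0 mulr1.
Qed.

(** The weight cancels the density and leaves a multiple of Lebesgue measure, which is invariant
    under translation. This is the one-dimensional case of [flat_invariant]. *)
Lemma integral_nprob_shift (h : R -> \bar R) (a : R) :
  measurable_fun setT h -> (forall x, 0 <= h x) ->
  \int[nprob]_x (h (x + a)%R * (expR (x ^+ 2))%:E) =
  \int[nprob]_x (h x * (expR (x ^+ 2))%:E).
Proof.
move=> mh h0; rewrite !integral_nprob_weighted//; first by rewrite integral_lebesgue_shift.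
by apply: measurableT_comp mh _; exact: measurable_funD.
Qed.

End std_normal.

Section product_probability.
Context d1 d2 (T1 : measurableType d1) (T2 : measurableType d2) (R : realType).
Variables (P1 : probability T1 R) (P2 : probability T2 R).

Definition prodP : probability (T1 * T2)%type R := (P1 \x P2)%E.

Lemma prodP_rect (A1 : set T1) (A2 : set T2) : measurable A1 -> measurable A2 ->
  prodP (A1 `*` A2) = (P1 A1 * P2 A2)%E.
Proof. by move=> m1 m2; exact: product_measure1E. Qed.

Lemma prodP_integral1 (f : T1 * T2 -> \bar R) : measurable_fun setT f ->
  (forall u, 0 <= f u)%E -> (\int[prodP]_u f u = \int[P1]_x \int[P2]_y f (x, y))%E.
Proof. by move=> mf f0; exact: fubini_tonelli1. Qed.

Lemma prodP_integral2 (f : T1 * T2 -> \bar R) : measurable_fun setT f ->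
  (forall u, 0 <= f u)%E -> (\int[prodP]_u f u = \int[P2]_y \int[P1]_x f (x, y))%E.
Proof. by move=> mf f0; exact: fubini_tonelli2. Qed.

End product_probability.

(** * Boxes and the resampling of one real coordinate *)

Section gaussian_boxes.
Context (R : realType) (N L : nat).
Local Notation X := (borelmx R N L).
Implicit Types (A B : 'I_N -> 'I_L -> set R) (C : bool -> 'I_N -> 'I_L -> set R).
Local Notation "''M'" := ('M[R[i]]_(N, L)).

(** The Boolean tells the real part ([true]) from the imaginary part ([false]), so that the [2 N L]
    real coordinates are handled uniformly. *)
Definition gbox C : set X :=
  [set Y | forall i j, C true i j (complex.Re ((Y : 'M) i j)) /\
                       C false i j (complex.Im ((Y : 'M) i j))].

Definition gmass C : \bar R :=
  (\prod_(p : 'I_N * 'I_L) (nprob R (C true p.1 p.2) * nprob R (C false p.1 p.2)))%E.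

Lemma gaussian_gbox (G : probability X R) C : gaussian_ensemble G ->
  (forall b i j, measurable (C b i j)) -> G (gbox C) = gmass C.
Proof.
move=> gG mC; rewrite (gG (C true) (C false))//.
by rewrite /gmass pair_bigA.
Qed.

Lemma gbox_gaussian (G : probability X R) :
  (forall C, (forall b i j, measurable (C b i j)) -> G (gbox C) = gmass C) ->
  gaussian_ensemble G.
Proof.
move=> gG A B mA mB.
have := gG (fun b => if b then A else B); rewrite /gmass -(pair_bigA _
  (fun i j => nprob R (A i j) * nprob R (B i j))%E) /= => <- //.
by case.
Qed.

Lemma measurable_gbox C : (forall b i j, measurable (C b i j)) -> measurable (gbox C).
Proof.
move=> mC; apply: measurable_forall_fin => i; apply: measurable_forall_fin => j.
have [m1 m2] := @mmeas_id R N L i j.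
by apply: measurableI; [exact: (measurable_preimage m1)|exact: (measurable_preimage m2)].
Qed.

(** Boxes are closed under intersection, so this makes a Gaussian law determined by its values on
    them. An open set is a countable union of rational boxes, which are of this form. *)
Lemma gbox_generate :
  @measurable _ X = <<s [set S | exists C, (forall b i j, measurable (C b i j)) /\ S = gbox C] >>.
Proof.
set gen := [set S | _].
apply/seteqP; split.
  apply: smallest_sub; first exact: smallest_sigma_algebra.
  move=> U oU.
  pose F (q : 'M[rat * rat]_(N, L) * nat) : set (g_sigma_algebraType gen) :=
    if `[<rbox q `<=` U>] then rbox q else set0.
  have mF q : measurable (F q).
    rewrite /F; case: asboolP => // _; apply: sub_sigma_algebra.
    exists (fun b i j => if b then
       [set x : R | `|x - ratr (q.1 i j).1| < q.2.+1%:R^-1] else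
       [set x : R | `|x - ratr (q.1 i j).2| < q.2.+1%:R^-1]); split => //.
    by case=> i j; apply: measurable_lt => //; apply: measurableT_comp => //;
      exact: measurable_funB.
  have -> : U = \bigcup_q F q.
    apply/seteqP; split => w /=.
      by move=> /(open_rbox oU)[q [qw qU]]; exists q => //; rewrite /F asboolT.
    by move=> [q _]; rewrite /F; case: asboolP => // qU /=; exact: qU.
  exact: (countable_bigcupT_measurable (countableP _) mF).
apply: smallest_sub; first exact: sigma_algebra_measurable.
by move=> _ [C [mC ->]]; exact: measurable_gbox.
Qed.

Lemma gaussian_unique (G G' : probability X R) : gaussian_ensemble G -> gaussian_ensemble G' ->
  forall S : set X, measurable S -> G S = G' S.
Proof.
move=> gG gG'; apply: (measure_unique _ (fun=> setT) gbox_generate).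
- move=> _ _ [C [mC ->]] [D [mD ->]]; exists (fun b i j => C b i j `&` D b i j); split.
    by move=> b i j; exact: measurableI.
  apply/seteqP; split => Y /=.
    by move=> [a b] i j; have [? ?] := a i j; have [? ?] := b i j.
  by move=> H; split => i j; have [[? ?] [? ?]] := H i j.
- by move=> _; exists (fun _ _ _ => setT); split => //; apply/seteqP; split.
- by apply/seteqP; split => // x _; exists 0%N.
- by move=> _ [C [mC ->]]; exact: etrans (gaussian_gbox gG mC) (esym (gaussian_gbox gG' mC)).
- by move=> _; rewrite (le_lt_trans (probability_le1 _ _))// ltry.
Qed.

Definition setc (b : bool) (z : R[i]) (x : R) : R[i] :=
  if b then x +i* complex.Im z else complex.Re z +i* x.

(** One real coordinate is replaced by an independent normal variable. The preimage of a box is a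
    product, so a Gaussian law is preserved; this isolates a single coordinate for integration
    without presenting the matrix space as a product. *)
Definition resample (b : bool) i j (u : R * X) : 'M :=
  \matrix_(k, l) if (k, l) == (i, j) then setc b ((u.2 : 'M) k l) u.1 else (u.2 : 'M) k l.

Lemma mmeas_resample b i j :
  mmeas (fun u : measurableTypeR R * X => resample b i j u).
Proof.
move=> k l; have mc : cmeas (fun u : measurableTypeR R * X => (u.2 : 'M) k l).
  exact: mmeas_comp (@mmeas_id R N L) measurable_snd k l.
under [X in cmeas X]eq_fun do rewrite mxE.
case: eqP => // _; have [m1 m2] := mc.
by case: b; split; [exact: measurable_fst|exact: m2|exact: m1|exact: measurable_fst].
Qed.

Definition widen_box C b i j : bool -> 'I_N -> 'I_L -> set R :=
  fun b' k l => if (b' == b) && ((k, l) == (i, j)) then setT else C b' k l.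

Lemma resample_gbox C b i j (u : R * X) :
  gbox C (resample b i j u) <-> C b i j u.1 /\ gbox (widen_box C b i j) u.2.
Proof.
split.
  move=> H; split.
    by have := H i j; rewrite mxE eqxx /setc; case: b H => H [].
  move=> k l; have := H k l; rewrite mxE /widen_box; case: ((k, l) =P (i, j)) => [[-> ->]|_].
    by rewrite /setc; case: b {H} => /= -[].

  by rewrite !andbF.
move=> [Cu H] k l; have := H k l; rewrite mxE /widen_box; case: ((k, l) =P (i, j)) => [[-> ->]|_].
  by rewrite /setc !andbT; case: b Cu {H} => Cu /= -[].
by rewrite !andbF.
Qed.

Lemma gmass_widen C b i j : gmass C = (nprob R (C b i j) * gmass (widen_box C b i j))%E.
Proof.
rewrite /gmass (bigD1 (i, j))//= [in RHS](bigD1 (i, j))//= /widen_box !eqxx !andbT.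
rewrite [X in (_ * X)%E = _](_ : _ = (\prod_(p | p != (i, j)) (nprob R (widen_box C b i j true p.1 p.2) *
   nprob R (widen_box C b i j false p.1 p.2)))%E).
  by rewrite muleA; case: b => /=; rewrite probability_setT ?mul1e ?mule1// [X in (X * _)%E = _]muleC.
by apply: eq_bigr => -[k l] kl; rewrite /widen_box /= (negbTE kl) !andbF.
Qed.

Lemma measurable_resample b i j :
  measurable_fun setT (fun u : measurableTypeR R * X => (resample b i j u : X)).
Proof. exact/mmeas_measurable/mmeas_resample. Qed.

Lemma resample_gaussian (G : probability X R) b i j : gaussian_ensemble G ->
  gaussian_ensemble (law (prodP (nprob R) G) (measurable_resample b i j)).
Proof.
move=> gG; apply: gbox_gaussian => C mC.
rewrite lawE (_ : [set w | _] = C b i j `*` gbox (widen_box C b i j)); last first.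
  by apply/seteqP; split => u /resample_gbox.
have mW : forall b' k l, measurable (widen_box C b i j b' k l).
  by move=> b' k l; rewrite /widen_box; case: ifP.
rewrite prodP_rect; [|exact: mC|exact: measurable_gbox].
by rewrite gaussian_gbox// -gmass_widen.
Qed.

Lemma integral_resample (G : probability X R) b i j (H : X -> \bar R) : gaussian_ensemble G ->
  measurable_fun setT H -> (forall Y, 0 <= H Y)%E ->
  (\int[G]_Y H Y = \int[G]_Y \int[nprob R]_x H (resample b i j (x, Y)))%E.
Proof.
move=> gG mH H0.
transitivity (\int[law (prodP (nprob R) G) (measurable_resample b i j)]_Y H Y)%E.
  by apply: eq_measure_integral => S mS _; apply: gaussian_unique => //; exact: resample_gaussian.
rewrite ge0_integral_law// prodP_integral2//.
exact: measurableT_comp mH (measurable_resample b i j).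
Qed.

End gaussian_boxes.

Lemma mule_cancel (R : realType) (a b c : \bar R) : c \is a fin_num -> (0 < c)%E ->
  (c * a = b * c)%E -> b = a.
Proof.
case: c => // r _; rewrite lte_fin => r0 E.
have : (r^-1%:E * (r%:E * a) = r^-1%:E * (b * r%:E))%E by rewrite E.
by rewrite muleA [in RHS](muleC b) [in RHS]muleA -EFinM mulVf ?gt_eqF// !mul1e.
Qed.

(** * Invariance of the Gaussian law under isometries *)

Section gaussian_isometry.
Context (R : realType) (N L : nat).
Local Notation X := (borelmx R N L).
Local Notation "''M'" := ('M[R[i]]_(N, L)).
Variables (G : probability X R) (gG : gaussian_ensemble G).
Local Open Scope ereal_scope.

Definition gwt (Y : 'M) : \bar R := (expR (fnorm2 Y))%:E.

Lemma gwt_ge0 Y : 0 <= gwt Y.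
Proof. by rewrite lee_fin expR_ge0. Qed.

Lemma measurable_gwt : measurable_fun setT (gwt : X -> \bar R).
Proof.
apply/measurable_EFinP; apply: measurableT_comp; first exact: measurable_expR.
by apply: measurable_fnorm2; exact: mmeas_id.
Qed.

(* The measure [exp(|Y|^2) dG(Y)] is a multiple of Lebesgue measure. *)
Definition flat (F : X -> \bar R) : \bar R := \int[G]_Y (F Y * gwt Y).

Lemma measurable_comp_mx d (T : measurableType d) (F : X -> \bar R) (f : T -> 'M) :
  measurable_fun setT F -> mmeas f -> measurable_fun setT (fun w => F (f w)).
Proof. by move=> mF mf; exact: measurableT_comp mF (mmeas_measurable mf). Qed.

Lemma measurable_addmx (F : X -> \bar R) (a : 'M) :
  measurable_fun setT F -> measurable_fun setT (fun Y : X => F ((Y : 'M) + a)%R).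
Proof.
by move=> mF; apply: measurable_comp_mx => //; apply: mmeasD; [exact: mmeas_id|exact: mmeas_cst].
Qed.

Definition flat_invariant (a : 'M) := forall F : X -> \bar R,
  measurable_fun setT F -> (forall Y, 0 <= F Y) ->
  flat (fun Y => F ((Y : 'M) + a)%R) = flat F.

Lemma flat_invariantD a b : flat_invariant a -> flat_invariant b ->
  flat_invariant (a + b)%R.
Proof.
move=> ia ib F mF F0; have := ia (fun Y => F ((Y : 'M) + b)%R) (measurable_addmx b mF).
rewrite ib// => <- //; apply: eq_integral => Y _; congr (F _ * _).
by rewrite addrA.
Qed.

Lemma flat_invariant0 : flat_invariant 0%R.
Proof. by move=> F mF F0; apply: eq_integral => Y _; rewrite addr0. Qed.

Definition coord_mx (b : bool) i j (t : R) : 'M :=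
  \matrix_(k, l) if (k, l) == (i, j) then setc b 0%R t else 0%R.

Lemma resampleD b i j x t (Y : X) :
  (resample b i j (x, Y) + coord_mx b i j t = resample b i j (x + t, Y))%R.
Proof.
apply/matrixP => k l; rewrite !mxE; case: ifP => _; last by rewrite addr0.
by rewrite /setc; case: b; apply/eqP; rewrite eq_complex /= ?addr0 ?eqxx.
Qed.

Lemma fnorm2_resample b i j x (Y : X) :
  (fnorm2 (resample b i j (x, Y)) = x ^+ 2 + fnorm2 (resample b i j (0, Y)))%R.
Proof.
rewrite !fnorm2E !pair_bigA /= (bigD1 (i, j))//= [in RHS](bigD1 (i, j))//= !mxE eqxx addrA.
congr (_ + _)%R; first by rewrite /setc; case: b => /=; ring.
by apply: eq_bigr => -[k l] /= /negbTE kl; rewrite !mxE kl.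
Qed.

(** After resampling the coordinate in question, [gwt] splits into [expR (x ^+ 2)] and a factor free
    of [x], and the one-dimensional shift applies to the inner integral. *)
Lemma flat_invariant_coord b i j t : flat_invariant (coord_mx b i j t).
Proof.
move=> F mF F0; have mFw : measurable_fun setT (fun Y : X => F Y * gwt Y).
  by apply: emeasurable_funM => //; exact: measurable_gwt.
have Fw0 Y : 0 <= F Y * gwt Y by rewrite mule_ge0// gwt_ge0.
have mFaw : measurable_fun setT (fun Y : X => F ((Y : 'M) + coord_mx b i j t)%R * gwt Y).
  by apply: emeasurable_funM; [exact: measurable_addmx|exact: measurable_gwt].
have Faw0 (Y : X) : 0 <= F ((Y : 'M) + coord_mx b i j t)%R * gwt Y by rewrite mule_ge0// gwt_ge0.
rewrite /flat [LHS](integral_resample b i j gG mFaw Faw0) [RHS](integral_resample b i j gG mFw Fw0).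
apply: eq_integral => Y _.
pose h x := F (resample b i j (x, Y)) * gwt (resample b i j (0%R, Y)).
have E x : gwt (resample b i j (x, Y)) = gwt (resample b i j (0%R, Y)) * (expR (x ^+ 2))%:E.
  by rewrite /gwt fnorm2_resample expRD EFinM muleC.
transitivity (\int[nprob R]_x (h (x + t)%R * (expR (x ^+ 2))%:E)).
  by apply: eq_integral => x _; rewrite E resampleD muleA.
rewrite integral_nprob_shift.
- by apply: eq_integral => x _; rewrite E muleA.
- apply: emeasurable_funM; last exact: measurable_cst.
  apply: measurableT_comp mF _; apply: measurableT_comp (measurable_resample b i j) _.
  exact: measurable_fun_pair.
- by move=> x; rewrite mule_ge0// gwt_ge0.
Qed.

Lemma flat_invariantT a : flat_invariant a.
Proof.
have -> : a = (\sum_(p : 'I_N * 'I_L) (coord_mx true p.1 p.2 (complex.Re (a p.1 p.2)) +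
    coord_mx false p.1 p.2 (complex.Im (a p.1 p.2))))%R.
  apply/matrixP => k l; rewrite summxE (bigD1 (k, l))//= big1 ?addr0.
    by rewrite !mxE eqxx /setc; case: (a k l) => u v; apply/eqP; rewrite eq_complex /= addr0 add0r !eqxx.
  by move=> [i j] kl; rewrite !mxE eq_sym (negbTE kl) addr0.
elim/big_ind : _ => //; first exact: flat_invariant0.
  exact: flat_invariantD.
by move=> p _; apply: flat_invariantD; exact: flat_invariant_coord.
Qed.

Section isometry.
Variables (f g : 'M -> 'M).
Hypothesis mf : measurable_fun setT (f : X -> X).
Hypothesis fD : {morph f : Y Z / (Y + Z)%R}.
Hypothesis fg : cancel g f.
Hypothesis fn : forall Y, fnorm2 (f Y) = fnorm2 Y.

Let flatf (F : X -> \bar R) := flat (fun Y : X => F (f Y)).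

Let flatf_shift (F : X -> \bar R) (a : 'M) : measurable_fun setT F -> (forall Y, 0 <= F Y) ->
  flatf (fun Y => F ((Y : 'M) + a)%R) = flatf F.
Proof.
move=> mF F0; rewrite -[RHS](flat_invariantT (g a)) => [|//|//]; last first.
  exact: measurableT_comp mF mf.
by apply: eq_integral => Y _; rewrite fD fg.
Qed.

(** The factor 2 outweighs [gwt]: the product of the two is [expR (- fnorm2 Y)], positive and at
    most 1. Hence [flat gauss] is positive and finite, and can be cancelled. *)
Let gauss (Y : 'M) : \bar R := (expR (- (2 * fnorm2 Y)))%:E.

Let measurable_gauss : measurable_fun setT (gauss : X -> \bar R).
Proof.
apply/measurable_EFinP; apply: measurableT_comp; first exact: measurable_expR.
apply: measurable_funN; apply: measurable_funM => //.
by apply: measurable_fnorm2; exact: mmeas_id.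
Qed.

Let gauss_ge0 Y : 0 <= gauss Y. Proof. by rewrite lee_fin expR_ge0. Qed.

Let gauss_gwt Y : gauss Y * gwt Y = (expR (- fnorm2 Y))%:E.
Proof. by rewrite /gauss /gwt -EFinM -expRD; congr (expR _)%:E; ring. Qed.

Let flat_gauss_gt0 : 0 < flat gauss.
Proof.
rewrite lt_neqAle integral_ge0 => [|Y _]; last by rewrite mule_ge0// gwt_ge0.
rewrite andbT; apply/negP => /eqP /esym H0.
have m0 : measurable_fun setT (fun Y : X => gauss Y * gwt Y).
  by apply: emeasurable_funM => //; exact: measurable_gwt.
have /(ae_eq_integral_abs G measurableT m0) : \int[G]_Y `|gauss Y * gwt Y| = 0.
  by rewrite -[RHS]H0; apply: eq_integral => Y _; rewrite gee0_abs// mule_ge0// gwt_ge0.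
case=> S [mS S0 subS]; have ST : S = setT.
  apply/seteqP; split => // Y _; apply: subS => /= /(_ I); rewrite gauss_gwt => -[] /eqP.
  by rewrite gt_eqF// expR_gt0.
have : G setT = 0 by rewrite -ST; exact: S0.
by rewrite probability_setT => /eqP; rewrite onee_eq0.
Qed.

Let flat_gauss_fin : flat gauss \is a fin_num.
Proof.
rewrite ge0_fin_numE ?ltW//; apply: (@le_lt_trans _ _ (\int[G]_Y 1)).
  apply: ge0_le_integral => //.
  - by move=> Y _; rewrite mule_ge0// gwt_ge0.
  - by apply: emeasurable_funM => //; exact: measurable_gwt.
  - move=> Y _; rewrite gauss_gwt lee_fin -[leRHS]expR0 ler_expR oppr_le0.
    exact: fnorm2_ge0.
by rewrite integral_cst//= probability_setT mule1 ltry.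
Qed.

(** The classical uniqueness argument for translation-invariant integrals. In the double integral of
    [gauss (f x) * F y], shift [y] by [f x], exchange the integrals, shift [f x] back by [y],
    exchange again, and shift [y] by [- f x], using that [gauss] is even. The result is the double
    integral of [F (f x) * gauss y], and [gauss] has the same integral before and after composition
    with [f]. *)
Lemma flat_isometry (F : X -> \bar R) : measurable_fun setT F -> (forall Y, 0 <= F Y) ->
  flat (fun Y : X => F (f Y)) = flat F.
Proof.
move=> mF F0.
have mff := @measurable_mmeas _ X R _ _ f mf.
have step : flatf gauss * flat F = flatf F * flat gauss.
  have mfst : mmeas (fun u : X * X => f u.1).
    exact: (mmeas_comp mff measurable_fst).
  have msnd : mmeas (fun u : X * X => (u.2 : 'M)).
    exact: (mmeas_comp (@mmeas_id R N L) measurable_snd).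
  have mwt1 : measurable_fun setT (fun u : X * X => gwt u.1).
    exact: measurableT_comp measurable_gwt measurable_fst.
  have mwt2 : measurable_fun setT (fun u : X * X => gwt u.2).
    exact: measurableT_comp measurable_gwt measurable_snd.
  have mwtf : measurable_fun setT (fun Y : X => gauss (f Y) * gwt Y).
    apply: emeasurable_funM; last exact: measurable_gwt.
    exact: measurableT_comp measurable_gauss mf.
  have mwtF : measurable_fun setT (fun Y : X => F (f Y) * gwt Y).
    apply: emeasurable_funM; last exact: measurable_gwt.
    exact: measurableT_comp mF mf.
  have mg1 : measurable_fun setT (fun u : X * X => gauss (f u.1)).
    exact: (measurable_comp_mx measurable_gauss mfst).
  have mF1 : measurable_fun setT (fun u : X * X => F ((u.2 : 'M) + f u.1)%R).
    exact: (measurable_comp_mx mF (mmeasD msnd mfst)).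
  have mg2 : measurable_fun setT (fun u : X * X => gauss (f u.1 - (u.2 : 'M))%R).
    exact: (measurable_comp_mx measurable_gauss (mmeasB mfst msnd)).
  have mF2 : measurable_fun setT (fun u : X * X => F (f u.1)).
    exact: (measurable_comp_mx mF mfst).
  transitivity (\int[G]_x \int[G]_y ((gauss (f x) * F ((y : 'M) + f x)%R) * gwt x * gwt y)).
    rewrite /flatf /flat -ge0_integralZr//; last 2 first.
    - by move=> Y _; rewrite mule_ge0// gwt_ge0.
    - by apply: integral_ge0 => Y _; rewrite mule_ge0// gwt_ge0.
    apply: eq_integral => x _; rewrite -/(flat F) -(flat_invariantT (f x) mF F0) /flat.
    rewrite -ge0_integralZl//; last 3 first.
    - by apply: emeasurable_funM; [exact: measurable_addmx|exact: measurable_gwt].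
    - by move=> Y _; rewrite mule_ge0// gwt_ge0.
    - by rewrite mule_ge0// gwt_ge0.
    by apply: eq_integral => y _; rewrite -!muleA; congr (_ * _); rewrite muleCA.
  rewrite (fubini_tonelli (fun u : X * X => gauss (f u.1) * F ((u.2 : 'M) + f u.1)%R *
     gwt u.1 * gwt u.2)); last 2 first.
  - exact: (emeasurable_funM (emeasurable_funM (emeasurable_funM mg1 mF1) mwt1) mwt2).
  - by move=> u; exact: (mule_ge0 (mule_ge0 (mule_ge0 (gauss_ge0 _) (F0 _)) (gwt_ge0 _)) (gwt_ge0 _)).
  transitivity (\int[G]_y \int[G]_x ((gauss (f x - (y : 'M))%R * F (f x)) * gwt x * gwt y)).
    apply: eq_integral => y _ /=.
    have mH : measurable_fun setT (fun Y : X => gauss (Y - (y : 'M))%R * F Y).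
      have mc : measurable_fun setT (fun Y : X => gauss (Y - (y : 'M))%R).
        apply: (measurable_comp_mx measurable_gauss).
        by apply: mmeasB; [exact: mmeas_id|exact: mmeas_cst].
      exact: (emeasurable_funM mc mF).
    have H0 Y : 0 <= gauss (Y - (y : 'M))%R * F Y by rewrite mule_ge0.
    have mc : measurable_fun setT (fun x : X => F ((y : 'M) + f x)%R).
      by apply: (measurable_comp_mx mF); apply: mmeasD; [exact: mmeas_cst|exact: mff].
    have ml : measurable_fun setT (fun x : X => gauss (f x) * F ((y : 'M) + f x)%R * gwt x).
      exact: (emeasurable_funM (emeasurable_funM (measurableT_comp measurable_gauss mf) mc)
        measurable_gwt).
    have mr : measurable_fun setT (fun x : X => gauss (f x - (y : 'M))%R * F (f x) * gwt x).
      exact: (emeasurable_funM (measurableT_comp mH mf) measurable_gwt).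
    rewrite [LHS](ge0_integralZr _ measurableT ml) ?gwt_ge0//; last first.
      by move=> Y _; exact: (mule_ge0 (mule_ge0 (gauss_ge0 _) (F0 _)) (gwt_ge0 _)).
    apply: etrans _ (esym (ge0_integralZr G measurableT mr
      (fun x _ => mule_ge0 (mule_ge0 (gauss_ge0 _) (F0 _)) (gwt_ge0 _)) (gwt_ge0 y))).
    apply: (congr1 (fun z => z * gwt y)).
    apply: etrans _ (@flatf_shift _ (y : 'M) mH H0).
    apply: eq_integral => x _; apply: (congr1 (fun z => z * gwt x)).
    by rewrite (addrK (y : 'M) (f x)) (addrC (f x) (y : 'M)).
  rewrite -(fubini_tonelli (fun u : X * X => gauss (f u.1 - (u.2 : 'M))%R * F (f u.1) *
     gwt u.1 * gwt u.2)); last 2 first.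
  - exact: (emeasurable_funM (emeasurable_funM (emeasurable_funM mg2 mF2) mwt1) mwt2).
  - by move=> u; exact: (mule_ge0 (mule_ge0 (mule_ge0 (gauss_ge0 _) (F0 _)) (gwt_ge0 _)) (gwt_ge0 _)).
  rewrite /flatf [X in _ = X * _]/flat -ge0_integralZr//; last 2 first.
  - by move=> Y _; rewrite mule_ge0// gwt_ge0.
  - by apply: integral_ge0 => Y _; rewrite mule_ge0// gwt_ge0.
  apply: eq_integral => x _ /=.
  have ms : measurable_fun setT (fun Y : X => gauss ((Y : 'M) + (- f x))%R * gwt Y).
    exact: (emeasurable_funM (measurable_addmx (- f x)%R measurable_gauss) measurable_gwt).
  rewrite -(flat_invariantT (- f x)%R measurable_gauss gauss_ge0) /flat.
  apply: etrans _ (ge0_integralZl G measurableT ms (fun Y _ => mule_ge0 (gauss_ge0 _) (gwt_ge0 _))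
    (mule_ge0 (F0 (f x)) (gwt_ge0 x))).
  apply: eq_integral => y _.
  have -> : gauss (f x - (y : 'M))%R = gauss ((y : 'M) + (- f x))%R.
    by rewrite /gauss -fnorm2N opprB.
  move: (gauss _) (F _) (gwt x) (gwt y) => a b c e.
  by rewrite (muleC a b) -!muleA; congr (_ * _); rewrite muleCA.
have fgauss : flatf gauss = flat gauss.
  by apply: eq_integral => Y _; rewrite /gauss fn.
move: step; rewrite fgauss; exact: mule_cancel.
Qed.

(* An additive bijection [f] scales the translation-invariant [flat] by a
   constant, which is [1] as [f] preserves the Gaussian density. *)
Lemma gaussian_isometry (F : X -> \bar R) : measurable_fun setT F -> (forall Y, 0 <= F Y) ->
  \int[G]_Y F (f Y) = \int[G]_Y F Y.
Proof.
move=> mF F0.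
(* [F' * gwt] is [F], and the exponential factor in [F'] is unchanged by [f]; the claim becomes
   [flat_isometry] for [F']. *)
pose F' (Y : X) := F Y * (expR (- fnorm2 (Y : 'M)))%:E.
have me : measurable_fun setT (fun Y : X => (expR (- fnorm2 (Y : 'M)))%:E).
  apply/measurable_EFinP; apply: measurableT_comp; first exact: measurable_expR.
  by apply: measurable_funN; apply: measurable_fnorm2; exact: mmeas_id.
have E Y : F Y = F' Y * gwt Y.
  by rewrite /F' /gwt -muleA -EFinM -expRD addNr expR0 mule1.
have F'0 Y : 0 <= F' Y by rewrite mule_ge0// lee_fin expR_ge0.
have mF' : measurable_fun setT F' by exact: emeasurable_funM.
have := flat_isometry mF' F'0; rewrite /flat => H.
under [RHS]eq_integral do rewrite E.
rewrite -H; apply: eq_integral => Y _; rewrite E.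
by rewrite /gwt fn.
Qed.

Lemma gaussian_isometry_prob (B : set X) : measurable B -> G [set Y | B (f Y)] = G B.
Proof.
move=> mB; have mi : measurable_fun setT (fun Y : X => (\1_B Y)%:E : \bar R).
  by apply/measurable_EFinP; exact: measurable_indic.
have mS : measurable [set Y : X | B (f Y)] by exact: measurable_preimage mf mB.
have E (S : set X) : measurable S -> \int[G]_Y (\1_S Y)%:E = G S.
  by move=> ?; rewrite integral_indic// setIT.
rewrite -(E _ mB) -(E _ mS).
exact: (gaussian_isometry mi (fun Y => ltac:(by rewrite lee_fin))).
Qed.

End isometry.

Lemma gaussian_left_invariant : left_invariant G.
Proof.
move=> U uU B mB; apply: (@gaussian_isometry_prob (fun Y => U *m Y) (fun Y => U ^t* *m Y)) => //.
- by apply: mmeas_measurable; apply: mmeasM; [exact: mmeas_cst|exact: mmeas_id].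
- by move=> Y Z; rewrite mulmxDr.
- by move=> Y; rewrite mulmxA (unitarymxP uU) mul1mx.
- by move=> Y; rewrite fnorm2_mull.
Qed.

Lemma gaussian_right_unitary (U : 'M[R[i]]_L) (F : X -> \bar R) : U \is unitarymx ->
  measurable_fun setT F -> (forall Y : X, 0 <= F Y) ->
  \int[G]_Y F ((Y : 'M) *m U) = \int[G]_Y F Y.
Proof.
move=> uU mF F0; apply: (@gaussian_isometry (fun Y => Y *m U) (fun Y => Y *m U ^t*)) => //.
- by apply: mmeas_measurable; apply: mmeasM; [exact: mmeas_id|exact: mmeas_cst].
- by move=> Y Z; rewrite mulmxDl.
- by move=> Y; rewrite -mulmxA unitary_mulK// mulmx1.
- by move=> Y; rewrite fnorm2_mulr.
Qed.

End gaussian_isometry.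

(** * The second moment of the normal law *)

Section second_moment.
Context (R : realType).
Local Notation leb := (@lebesgue_measure R).

Let g (x : R) := expR (- x ^+ 2).

Let is_derive_g (x : R) : is_derive x 1 (g : R^o -> R^o) (- (2 * x) * g x).
Proof.
have D1 : is_derive x 1 ((fun y : R => - y ^+ 2) : R^o -> R^o) (- (2 * x)).
  apply: is_derive_eq; rewrite /GRing.scale /=; ring.
have := @is_derive1_comp R (@expR R) (fun y : R => - y ^+ 2) x _ _ (is_derive_expR _) D1.
by rewrite mulrC.
Qed.

Let cvg_g : g x @[x --> +oo] --> (0 : R).
Proof.
apply: (@cvg_comp _ _ _ (fun x : R => x ^+ 2) (fun y => expR (- y))); last exact: cvgr_expR.
apply/cvgryPge => A; near=> x.
apply: (@le_trans _ _ x); first by near: x; apply: nbhs_pinfty_ge; exact: num_real.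
rewrite expr2 ler_peMl//; near: x; apply: nbhs_pinfty_ge; exact: num_real.
Unshelve. all: by end_near. Qed.

Let continuous_g : continuous g.
Proof.
move=> x; apply: (@continuous_comp R R R (fun x : R => - x ^+ 2) (@expR R)).
  by apply: (@cvgN _ R^o); exact: exprn_continuous.
exact: continuous_expR.
Qed.

Lemma gauss_tail (t : R) : 0 <= t ->
  (\int[leb]_(x in `[t, +oo[) (x * g x)%:E = (2^-1 * g t)%:E)%E.
Proof.
move=> t0; pose F (x : R) := - (2^-1 * g x).
have dF (x : R) : is_derive x 1 (F : R^o -> R^o) (x * g x).
  have := @is_deriveN R R^o R^o _ x 1 _ (@is_deriveZ R R^o R^o (g : R^o -> R^o) 2^-1 x 1 _ (is_derive_g x)).
  rewrite /GRing.scale /= => H; apply: is_derive_eq H _.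
  by rewrite mulrA mulrN mulrA mulVf// mul1r mulNr opprK.
rewrite (@ge0_continuous_FTC2y R (fun x => x * g x) F t 0).
- by rewrite /F sub0e -EFinN opprK.
- by move=> x tx; rewrite mulr_ge0 ?expR_ge0// (le_trans t0).
- apply: continuous_subspaceT => x; apply: cvgM; [exact: cvg_id|exact: continuous_g].
- rewrite -[X in _ --> X]oppr0 -[X in - X](mulr0 (2^-1 : R)).
  by apply: (@cvgN _ R^o); apply: cvgMr; exact: cvg_g.
- by move=> x _; case: (dF x).
- apply: cvg_at_right_filter; apply: (@cvgN _ R^o); apply: cvgMr; exact: continuous_g.
- by move=> x _; rewrite derive1E; case: (dF x).
Qed.

Let mg : measurable_fun setT g.
Proof.
apply: measurableT_comp; first exact: measurable_expR.
by apply: measurable_funN; exact: measurable_funX.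
Qed.

(** Write [x ^+ 2 * g x] as the integral of the constant [x * g x] over [t] in [[0, x]] and exchange
    the order. The inner integral over [x >= t] is then [g t / 2] by [gauss_tail]. *)
Let halfline_second_moment :
  (\int[leb]_(x in `[0%R, +oo[) (x ^+ 2 * g x)%:E =
   2^-1%:E * \int[leb]_(x in `[0%R, +oo[) (g x)%:E)%E.
Proof.
pose D : set (R * R) := [set u | 0 <= u.2] `&` [set u | u.2 <= u.1].
have mD : measurable (D : set (measurableTypeR R * measurableTypeR R)).
  apply: measurableI; apply: measurable_le.
  - exact: measurable_cst.
  - exact: measurable_snd.
  - exact: measurable_snd.
  - exact: measurable_fst.
(* The absolute value makes [phi] nonnegative everywhere, as Tonelli requires; on [D] the first
   coordinate is nonnegative and it changes nothing. *)
pose phi (u : R * R) := (`|u.1 * g u.1| * \1_D u)%:E : \bar R.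
have mxg : measurable_fun setT (fun x : R => `|x * g x|).
  by apply: measurableT_comp => //; apply: measurable_funM.
have mphi : measurable_fun setT (phi : measurableTypeR R * measurableTypeR R -> \bar R).
  apply/measurable_EFinP; apply: measurable_funM; last exact: measurable_indic.
  exact: measurableT_comp mxg measurable_fst.
have phi0 u : (0 <= phi u)%E by rewrite lee_fin mulr_ge0.
have mitv (a : R) : measurable (`[a, +oo[%classic : set R) by exact: measurable_itv.
have := @fubini_tonelli _ _ _ _ R leb leb phi mphi phi0.
rewrite [X in X = _ -> _](_ : _ = \int[leb]_(x in `[0%R, +oo[) (x ^+ 2 * g x)%:E)%E; last first.
  rewrite [RHS]integral_mkcond; apply: eq_integral => x _; rewrite patchE.
  case: ifPn => [|]; rewrite ?inE ?notin_setE /= in_itv /= andbT.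
    move=> x0; transitivity (\int[leb]_t ((`|x * g x|)%:E * (\1_`[0%R, x]%classic t)%:E))%E.
      apply: eq_integral => t _; rewrite /phi EFinM !indicE; congr (_ * (nat_of_bool _)%:R%:E)%E.
      apply/idP/idP; rewrite !inE /D /= in_itv /=; first by move=> [-> ->].
      by move=> /andP.
    rewrite ge0_integralZl//; last first.
      by apply/measurable_EFinP; exact: measurable_indic.
    have El : leb (`[0%R, x]%classic `&` setT) = x%:E.
      rewrite setIT; have -> := @lebesgue_measure_itv R `[0%R, x].
      rewrite /= lte_fin; case: ltgtP x0 => // [_ _|<- //].
      by rewrite -EFinB subr0.
    rewrite integral_indic//; apply: etrans (congr1 (fun z => (_ * z)%E) El) _.
    by rewrite -EFinM ger0_norm ?mulr_ge0 ?expR_ge0//; congr EFin; ring.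
  move=> x0; apply: integral0_eq => t _; rewrite /phi indicE /=.
  case: (boolP (_ \in D)) => [|_]; last by rewrite mulr0.
  by rewrite inE /D /= => -[a b]; case: x0; exact: le_trans a b.
move=> ->; rewrite -ge0_integralZl//; last 2 first.
- by apply/measurable_EFinP; exact: measurable_funTS.
- by move=> x _; rewrite lee_fin expR_ge0.
rewrite [RHS]integral_mkcond; apply: eq_integral => t _; rewrite patchE.
case: ifPn => [|]; rewrite ?inE ?notin_setE /= in_itv /= andbT => t0.
  rewrite -EFinM -gauss_tail// [RHS]integral_mkcond; apply: eq_integral => x _; rewrite patchE.
  rewrite /phi indicE; case: ifPn => [|]; rewrite ?inE ?notin_setE /= in_itv /= andbT => tx.
    rewrite mem_set; last by split.
    by rewrite mulr1 ger0_norm// mulr_ge0 ?expR_ge0// (le_trans t0).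
  rewrite memNset ?mulr0// => -[_ /=]; exact: tx.
apply: integral0_eq => x _; rewrite /phi indicE memNset ?mulr0// => -[/= ? _]; exact: t0.
Qed.

(** The integral of [g] over the line is never computed: multiplied by the peak it is the total mass
    1 of the normal law, and by parity the half-line identity extends to the line. *)
Lemma nprob_second_moment : (\int[nprob R]_x (x ^+ 2)%:E = 2^-1%:E)%E.
Proof.
have m2 : measurable_fun setT (fun x : R => x ^+ 2 * g x) by apply: measurable_funM => //; exact: measurable_funX.
have sym2 : (\int[leb]_x (x ^+ 2 * g x)%:E = 2%:E * \int[leb]_(x in `[0%R, +oo[) (x ^+ 2 * g x)%:E)%E.
  rewrite set_itvcy; apply: ge0_symfun_integralT => //.
  - by move=> x; rewrite mulr_ge0 ?sqr_ge0 ?expR_ge0.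
  - move=> x; apply: cvgM; last exact: continuous_g; exact: exprn_continuous.
  - by move=> x; rewrite /= /g sqrrN.
have sym0 : (\int[leb]_x (g x)%:E = 2%:E * \int[leb]_(x in `[0%R, +oo[) (g x)%:E)%E.
  rewrite set_itvcy; apply: ge0_symfun_integralT => //.
  - by move=> x; rewrite expR_ge0.
  - by move=> x; rewrite /= /g sqrrN.
have one : ((normal_peak (nsd R))%:E * \int[leb]_x (g x)%:E = 1)%E.
  have <- : (\int[nprob R]_x 1 = 1)%E.
    by rewrite integral_cst//= mul1e; exact: probability_setT.
  rewrite integral_nprob// -ge0_integralZl//; last 3 first.
  - exact/measurable_EFinP.
  - by move=> x _; rewrite lee_fin expR_ge0.
  - by rewrite lee_fin normal_peak_ge0.
  by apply: eq_integral => x _; rewrite mul1e EFinM.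
rewrite integral_nprob//; last 2 first.
- by apply/measurable_EFinP; exact: measurable_funX.
- by move=> x; rewrite lee_fin sqr_ge0.
transitivity ((normal_peak (nsd R))%:E * \int[leb]_x (x ^+ 2 * g x)%:E)%E.
  rewrite -ge0_integralZl//; last 3 first.
  - exact/measurable_EFinP.
  - by move=> x _; rewrite lee_fin mulr_ge0 ?sqr_ge0 ?expR_ge0.
  - by rewrite lee_fin normal_peak_ge0.
  by apply: eq_integral => x _; rewrite -!EFinM; congr EFin; rewrite /g; ring.
rewrite sym2 halfline_second_moment.
rewrite [(2%:E * _)%E]muleCA -sym0 [LHS]muleCA one mule1 //.
Qed.

End second_moment.

(** * Positive semidefinite matrices *)

Section psd.
Context (R : realType).
Implicit Types m n : nat.

Definition psd n (H : 'M[R[i]]_n) :=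
  H ^t* = H /\ forall v : 'rV[R[i]]_n, 0 <= complex.Re ((v *m H *m v ^t*) 0 0).

Lemma row_norm_ge0 n (v : 'rV[R[i]]_n) : 0 <= complex.Re ((v *m v ^t*) 0 0).
Proof. by have := fnorm2_ge0 v; rewrite /fnorm2 /mxtrace big_ord1. Qed.

Lemma psd_conj m n (H : 'M[R[i]]_n) (Z : 'M[R[i]]_(m, n)) : psd H -> psd (Z *m H *m Z ^t*).
Proof.
move=> [Ha Hp]; split; first by rewrite !adjM trmxCK Ha mulmxA.
move=> v; have := Hp (v *m Z); rewrite adjM !mulmxA //.
Qed.

Lemma psd_gram m n (D : 'M[R[i]]_n) (X : 'M[R[i]]_(n, m)) : psd D -> psd (X ^t* *m D *m X).
Proof. by move=> /(psd_conj (X ^t*)); rewrite trmxCK. Qed.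

Lemma psd1 n : psd (1%:M : 'M[R[i]]_n).
Proof. by split; [exact: adj1|move=> v; rewrite mulmx1; exact: row_norm_ge0]. Qed.

(** For invertible [A], the inverse is [A^-1 A A^-1] with [A^-1] Hermitian; for singular [A],
    [invmx A] is [A] itself. So the integrands are positive semidefinite everywhere and not only
    almost surely. *)
Lemma psd_invmx n (A : 'M[R[i]]_n) : psd A -> psd (invmx A).
Proof.
move=> pA; case: (boolP (A \in unitmx)) => uA; last by rewrite /invmx (negbTE uA).
have [Aa _] := pA; have Ia : (invmx A) ^t* = invmx A by rewrite adj_invmx Aa.
have := psd_conj (invmx A) pA; rewrite Ia.
by rewrite (mulVmx uA) mul1mx.
Qed.

Lemma psd_diag n (H : 'M[R[i]]_n) i : psd H ->
  0 <= complex.Re (H i i) /\ complex.Im (H i i) = 0.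
Proof.
move=> [Ha Hp]; split.
  have := Hp (delta_mx 0 i); rewrite -rowE.
  have -> : ((delta_mx 0 i : 'rV[R[i]]_n) ^t*) = delta_mx i 0.
    by rewrite trmx_delta map_delta_mx.
  by rewrite -colE !mxE.
have /matrixP/(_ i i) := Ha; rewrite !mxE => /(congr1 (@complex.Im R)).
rewrite Im_conj => /eqP; rewrite eq_sym -subr_eq0 opprK -mulr2n mulrn_eq0 /=.
by move/eqP.
Qed.

Lemma psd_quad2 n (H : 'M[R[i]]_n) i j (c : R[i]) : psd H -> c * c^* = 1 ->
  0 <= complex.Re (H i i) + complex.Re (H j j) + 2 * complex.Re (c^* * H i j).
Proof.
move=> [Ha Hp] c1; have := Hp (delta_mx 0 i + c *: delta_mx 0 j).
have -> : ((delta_mx 0 i + c *: delta_mx 0 j : 'rV[R[i]]_n) ^t*) =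
    delta_mx i 0 + c^* *: delta_mx j 0.
  apply/matrixP => a b; rewrite !mxE rmorphD rmorphM /=.
  by rewrite !conjC_nat !(andbC (b == _)).
rewrite mulmxDl -scalemxAl -!rowE mulmxDr -scalemxAr -!colE.
have -> : ((col i (row i H + c *: row j H) + c^* *: col j (row i H + c *: row j H)) 0 0) =
    H i i + c * H j i + c^* * H i j + (c * c^*) * H j j.
  by rewrite !mxE mulrDr mulrA (mulrC c^* c) !addrA.
rewrite c1 mul1r !ReD; have -> : complex.Re (c * H j i) = complex.Re (c^* * H i j).
  have /matrixP/(_ j i) := Ha; rewrite !mxE => <-.
  by case: (H i j) (c) => a b [e f] /=; ring.
by move=> h; apply: le_trans h _; rewrite le_eqVlt; apply/orP; left; apply/eqP; ring.
Qed.

(** The form is evaluated at [e_i + c e_j] with [c] equal to 1, -1, [i] and [-i]. This reduces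
    integrability of a random positive semidefinite matrix to that of its diagonal. *)
Lemma psd_offdiag n (H : 'M[R[i]]_n) i j : psd H ->
  `|complex.Re (H i j)| <= complex.Re (H i i) + complex.Re (H j j) /\
  `|complex.Im (H i j)| <= complex.Re (H i i) + complex.Re (H j j).
Proof.
move=> pH; have [hi _] := psd_diag i pH; have [hj _] := psd_diag j pH.
have q (a b : R) : a ^+ 2 + b ^+ 2 = 1 ->
    0 <= complex.Re (H i i) + complex.Re (H j j) +
         2 * (a * complex.Re (H i j) + b * complex.Im (H i j)).
  move=> ab; have := @psd_quad2 _ H i j (a +i* b) pH.
  have -> : (a +i* b) * (a +i* b)^* = 1.
    apply/eqP; rewrite eq_complex /=; apply/andP; split; apply/eqP; last by ring.
    by rewrite -ab; ring.
  move=> /(_ erefl) h; apply: le_trans h _; rewrite le_eqVlt; apply/orP; left; apply/eqP.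
  by congr (_ + 2 * _); case: (H i j) => x y /=; ring.
have := q 1 0; have := q (-1) 0; have := q 0 1; have := q 0 (-1).
rewrite !sqrrN !expr1n !expr0n /= !addr0 !add0r !mul0r !addr0 !add0r !mul1r !mulN1r.
move=> /(_ erefl) q1 /(_ erefl) q2 /(_ erefl) q3 /(_ erefl) q4.
by split; rewrite ler_norml; lra.
Qed.

(** The identification of [P] and [s] with [spectralmx] and [spectral_diag] is kept so that [mxlog]
    can be computed from this decomposition. *)
Lemma psd_spectral n (H : 'M[R[i]]_n) : psd H ->
  exists (P : 'M[R[i]]_n) (s : 'rV[R]_n),
    [/\ P \is unitarymx, H = P ^t* *m cdiag s *m P, spectralmx H = P,
        spectral_diag H = map_mx (real_complex R) s & forall l, 0 <= s 0 l].
Proof.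
move=> pH; have [Ha _] := pH.
have nH : H \is normalmx by apply/normalmxP; rewrite Ha.
have uP := spectral_unitarymx H.
have HE := orthomx_spectralP nH; rewrite (invmx_unitary uP) in HE.
set P := spectralmx H in uP HE *; set s := spectral_diag H in HE *.
have sE : P *m H *m P ^t* = diag_mx s.
  rewrite {1}HE !mulmxA (unitarymxP uP) mul1mx -mulmxA (unitarymxP uP) mulmx1 //.
have pS : psd (diag_mx s) by rewrite -sE; exact: psd_conj.
have sl l : s 0 l = (complex.Re (s 0 l))%:C.
  have [_] := psd_diag l pS; rewrite mxE eqxx mulr1n => h.
  by apply/eqP; rewrite eq_complex /= h !eqxx.
have sm : s = map_mx (real_complex R) (\row_l complex.Re (s 0 l)).
  by apply/matrixP => a l; rewrite ord1 !mxE; exact: sl.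
exists P, (\row_l complex.Re (s 0 l)); split => //.
  by rewrite /cdiag -sm.
by move=> l; have [+ _] := psd_diag l pS; rewrite !mxE eqxx mulr1n.
Qed.

Lemma psd_cdiag n (d : 'rV[R]_n) : (forall k, 0 <= d 0 k) -> psd (cdiag d).
Proof.
move=> d0; split.
  apply/matrixP => i j; rewrite !mxE eq_sym; case: eqP => [->|_]; last by rewrite !mulr0n rmorph0.
  by rewrite !mulr1n; apply/eqP; rewrite eq_complex /= oppr0 !eqxx.
move=> v; rewrite mxE Re_sum; apply: sumr_ge0 => k _.
rewrite /cdiag mul_mx_diag !mxE mulrAC ReM /= mulr0 subr0 mulr_ge0//.
by rewrite ReM Re_conj Im_conj mulrN opprK addr_ge0// -expr2 sqr_ge0.
Qed.

Lemma quad_cdiag n (d : 'rV[R]_n) (v : 'rV[R[i]]_n) :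
  complex.Re ((v *m cdiag d *m v ^t*) 0 0) =
  \sum_k d 0 k * (complex.Re (v 0 k) ^+ 2 + complex.Im (v 0 k) ^+ 2).
Proof.
rewrite mxE Re_sum; apply: eq_bigr => k _.
rewrite /cdiag mul_mx_diag !mxE mulrAC ReM /= mulr0 subr0 mulrC; congr (_ * _).
by rewrite ReM Re_conj Im_conj mulrN opprK -!expr2.
Qed.

(** If [v] is in the kernel, the weighted sum of the squared moduli of [v X^*] vanishes; the weights
    being positive, [v X^* = 0], and [v = 0] by full rank. *)
Lemma gram_cdiag_unit n m (d : 'rV[R]_n) (X : 'M[R[i]]_(n, m)) : (forall k, 0 < d 0 k) ->
  fullrank X -> X ^t* *m cdiag d *m X \in unitmx.
Proof.
move=> d0 fX; rewrite -row_free_unit -kermx_eq0; apply/rowV0P => v /sub_kermxP vA.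
have E : (v *m X ^t*) *m cdiag d *m (v *m X ^t*) ^t* =
    (v *m (X ^t* *m cdiag d *m X)) *m v ^t* by rewrite adjM trmxCK !mulmxA.
have := quad_cdiag d (v *m X ^t*); rewrite E vA mul0mx mxE /= => /esym/eqP.
rewrite psumr_eq0 => [/allP w0|k _]; last by rewrite mulr_ge0 ?(ltW (d0 k))// addr_ge0 ?sqr_ge0.
have w : v *m X ^t* = 0.
  apply/matrixP => a k; rewrite ord1 [RHS]mxE; have := w0 k (mem_index_enum _).
  rewrite /= mulf_eq0 (gt_eqF (d0 k)) /= paddr_eq0 ?sqr_ge0// !sqrf_eq0 => /andP[x y].
  by apply/eqP; rewrite eq_complex x y.
have : v *m (X ^t* *m X) = 0 by rewrite mulmxA w mul0mx.
by move=> /(congr1 (mulmx^~ (invmx (X ^t* *m X)))); rewrite (mulmxK fX) mul0mx.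
Qed.

(* [p D p + 1 - p] is [p D p] on the range of a projector [p], and the identity
   on its orthogonal complement. *)
Definition fproj n (D p : 'M[R[i]]_n) : 'M[R[i]]_n :=
  p *m invmx (p *m D *m p + 1%:M - p) *m p.

Lemma mulmx_invmxr n (A B : 'M[R[i]]_n) : A *m B = 1%:M -> A \in unitmx /\ invmx A = B.
Proof.
move=> AB; have [uA uB] := mulmx1_unit AB; split=> //.
by apply: (can_inj (mulKmx uA)); rewrite mulmxV.
Qed.

Lemma rproj_mul n m (Z : 'M[R[i]]_(n, m)) : fullrank Z ->
  rproj Z *m Z = Z /\ Z ^t* *m rproj Z = Z ^t*.
Proof.
move=> fZ; rewrite /rproj; split.
  by rewrite -(mulmxA _ (Z ^t*) Z) (mulmxKV fZ).
by rewrite mulmxA (mulmxA (Z ^t*) Z) (mulmxV fZ) mul1mx.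
Qed.

(** Let [p] be the projector and [B] the right-hand side. From [p B = B = B p] and [p D B = p] it
    follows that [B + 1 - p] inverts [p D p + 1 - p], and compressing by [p] leaves [B]. *)
Lemma fproj_rproj n m (D : 'M[R[i]]_n) (Z : 'M[R[i]]_(n, m)) : fullrank Z ->
  Z ^t* *m D *m Z \in unitmx ->
  rproj Z *m D *m rproj Z + 1%:M - rproj Z \in unitmx /\
  fproj D (rproj Z) = Z *m invmx (Z ^t* *m D *m Z) *m Z ^t*.
Proof.
move=> fZ uA; have [pZ Zp] := rproj_mul fZ.
have [_ pp _] := fullrank_projector fZ.
have [J pE] : exists J, rproj Z = Z *m J *m Z ^t* by exists (invmx (Z ^t* *m Z)).
have AE : Z ^t* *m (D *m Z) = Z ^t* *m D *m Z by rewrite mulmxA.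
move: (rproj Z) pZ Zp pp pE => p pZ Zp pp pE.
move: (Z ^t* *m D *m Z) uA AE => A uA AE.
have [] := conj (mulmxV uA) (mulVmx uA); move: (invmx A) => I AI IA.
pose B := Z *m I *m Z ^t*.
have pB : p *m B = B by rewrite /B mulmxA (mulmxA p) pZ.
have Bp : B *m p = B by rewrite /B -(mulmxA (Z *m I)) Zp.
have pDB : p *m D *m B = p.
  have pDZ : p *m D *m Z = Z *m J *m A.
    by rewrite pE -(mulmxA (Z *m J *m Z ^t*)) -(mulmxA (Z *m J)) AE.
  by rewrite /B mulmxA (mulmxA (p *m D)) pDZ -(mulmxA (Z *m J)) AI mulmx1.
have pDpB : p *m D *m p *m B = p by rewrite -(mulmxA (p *m D)) pB.
have pDpp : p *m D *m p *m p = p *m D *m p by rewrite -(mulmxA (p *m D)) pp.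
have : (p *m D *m p + 1%:M - p) *m (B + 1%:M - p) = 1%:M.
  rewrite mulmxBr mulmxDr mulmx1 !mulmxBl !mulmxDl !mul1mx pDpB pDpp pB pp.
  by apply/matrixP => i j; rewrite !mxE; ring.
move=> /mulmx_invmxr[uC iC]; split => //.
by rewrite /fproj iC mulmxBr mulmxDr mulmx1 pB pp addrK Bp.
Qed.

(** With [fproj_rproj], invertibility of the Gram matrix becomes a property of the projector alone,
    which can be carried from one law to another. If [v] kills the Gram matrix, then [v Z^*] is
    killed by [p D p + 1 - p]. *)
Lemma fproj_unit_gram n m (D : 'M[R[i]]_n) (Z : 'M[R[i]]_(n, m)) : fullrank Z ->
  rproj Z *m D *m rproj Z + 1%:M - rproj Z \in unitmx -> Z ^t* *m D *m Z \in unitmx.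
Proof.
move=> fZ uC; have [pZ Zp] := rproj_mul fZ.
rewrite -row_free_unit -kermx_eq0; apply/rowV0P => v /sub_kermxP vA.
have [J pE] : exists J, rproj Z = Z *m J *m Z ^t* by exists (invmx (Z ^t* *m Z)).
move: (rproj Z) pZ Zp pE uC => p pZ Zp pE uC.
have vp : v *m Z ^t* *m p = v *m Z ^t* by rewrite -(mulmxA v) Zp.
have : v *m Z ^t* *m (p *m D *m p + 1%:M - p) = 0.
  rewrite mulmxBr mulmxDr mulmx1 vp addrK (mulmxA _ (p *m D)) (mulmxA _ p D) vp.
  rewrite pE (mulmxA _ (Z *m J)) (mulmxA _ Z J).
  by rewrite -(mulmxA v) -(mulmxA v (Z ^t* *m D)) vA !mul0mx.
move=> /(congr1 (mulmx^~ (invmx (p *m D *m p + 1%:M - p)))).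
rewrite (mulmxK uC) mul0mx => w.
have : v *m (Z ^t* *m Z) = 0 by rewrite mulmxA w mul0mx.
by move=> /(congr1 (mulmx^~ (invmx (Z ^t* *m Z)))); rewrite (mulmxK fZ) mul0mx.
Qed.

Lemma mmeas_fproj d (T : measurableType d) n (D : 'M[R[i]]_n) (p : T -> 'M[R[i]]_n) :
  mmeas p -> mmeas (fun w => fproj D (p w)).
Proof.
move=> mp; apply: mmeasM => //; apply: mmeasM => //; apply: mmeas_invmx.
apply: mmeasB => //; apply: mmeasD; last exact: mmeas_cst.
by apply: mmeasM => //; apply: mmeasM => //; exact: mmeas_cst.
Qed.


End psd.

(** * Existence and stacking of Gaussian matrices *)

Section gaussian_constructions.
Context (R : realType).

(** Start from the Dirac mass at 0 and resample the coordinates of [s] one after the other; the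
    other coordinates stay deterministic, and are left unconstrained by the boxes considered. *)
Lemma gaussian_partial N L (s : seq (bool * 'I_N * 'I_L)) : uniq s ->
  exists P : probability (borelmx R N L) R, forall C : bool -> 'I_N -> 'I_L -> set R,
    (forall b i j, measurable (C b i j)) ->
    (forall b i j, (b, i, j) \notin s -> C b i j = setT) ->
    P (gbox C) = (\prod_(c <- s) nprob R (C c.1.1 c.1.2 c.2))%E.
Proof.
elim: s => [_|[[b i] j] s IHs /= /andP[cs us]].
  exists (@dirac _ (borelmx R N L) (0 : 'M[R[i]]_(N, L)) R : probability (borelmx R N L) R) => C mC CT.
  rewrite big_nil (_ : gbox C = setT) ?probability_setT//.
  by apply/seteqP; split => // Y _ k l; rewrite !CT.
have [P HP] := IHs us; exists (law (prodP (nprob R) P) (measurable_resample b i j)) => C mC CT.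
rewrite lawE (_ : [set w | _] = C b i j `*` gbox (widen_box C b i j)); last first.
  by apply/seteqP; split => u /resample_gbox.
have mW : forall b' k l, measurable (widen_box C b i j b' k l).
  by move=> b' k l; rewrite /widen_box; case: ifP.
rewrite prodP_rect; [|exact: mC|exact: measurable_gbox].
rewrite big_cons HP//.
  congr (_ * _)%E; rewrite !big_seq; apply: eq_bigr => -[[b' k] l] kls /=.
  rewrite /widen_box; case: ifP => // /andP[/eqP bb /eqP kl].
  by move: cs; rewrite -bb; case: kl kls => -> -> ->.
move=> b' k l kls; rewrite /widen_box; case: ifPn => // h; apply: CT.
rewrite inE negb_or kls andbT; apply: contra h => /eqP[-> -> ->].
by rewrite !eqxx.
Qed.

Lemma gaussian_exists N L : exists G : probability (borelmx R N L) R, gaussian_ensemble G.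
Proof.
have [P HP] := gaussian_partial (index_enum_uniq [the finType of (bool * 'I_N * 'I_L)%type]).
exists P; apply: gbox_gaussian => C mC; rewrite HP//; last first.
  by move=> b i j; rewrite mem_index_enum.
rewrite -(pair_bigA _ (fun c j => nprob R (C c.1 c.2 j))) /=.
rewrite -(pair_bigA _ (fun b i => \prod_(j < L) nprob R (C b i j))%E) /=.
rewrite big_bool /= -big_split /= /gmass -(pair_bigA _
  (fun i j => nprob R (C true i j) * nprob R (C false i j))%E) /=.
by apply: eq_bigr => i _; rewrite big_split.
Qed.

Lemma measurable_col_mx n1 n2 m : measurable_fun setT
  (fun u : borelmx R n1 m * borelmx R n2 m =>
     (col_mx (u.1 : 'M[R[i]]_(n1, m)) (u.2 : 'M[R[i]]_(n2, m)) : borelmx R (n1 + n2) m)).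
Proof.
apply: mmeas_measurable; apply: mmeas_col_mx.
  exact: (mmeas_comp (@mmeas_id R n1 m) measurable_fst).
exact: (mmeas_comp (@mmeas_id R n2 m) measurable_snd).
Qed.

Lemma gaussian_col_mx n1 n2 m (G1 : probability (borelmx R n1 m) R)
    (G2 : probability (borelmx R n2 m) R) : gaussian_ensemble G1 -> gaussian_ensemble G2 ->
  gaussian_ensemble (law (prodP G1 G2) (@measurable_col_mx n1 n2 m)).
Proof.
move=> g1 g2; apply: gbox_gaussian => C mC; rewrite lawE.
pose C1 b (i : 'I_n1) := C b (lshift n2 i); pose C2 b (i : 'I_n2) := C b (rshift n1 i).
rewrite (_ : [set w | _] = gbox C1 `*` gbox C2); last first.
  apply/seteqP; split => -[Y Z] /=.
    move=> H; split => i j /=; first by have := H (lshift n2 i) j; rewrite col_mxEu.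
    by have := H (rshift n1 i) j; rewrite col_mxEd.
  move=> [H1 H2] i j; case: (split_ordP i) => k ->.
    by rewrite col_mxEu; exact: H1.
  by rewrite col_mxEd; exact: H2.
rewrite prodP_rect; [|by apply: measurable_gbox => b i j; exact: mC..].
rewrite (gaussian_gbox g1) ?(gaussian_gbox g2); [|by move=> b i j; exact: mC..].
rewrite /gmass -!(pair_bigA _ (fun i j => nprob R (_ true i j) * nprob R (_ false i j))%E) /=.
by rewrite big_split_ord.
Qed.

End gaussian_constructions.

(** * Null sets and second moments of Gaussian matrices *)

Section gaussian_moments.
Context (R : realType).
Local Open Scope ereal_scope.

(** Such a [t] is a root of the characteristic polynomial of [- A]. *)
Lemma finite_singular_shift n (A : 'M[R[i]]_n) :
  finite_set [set t : R | \det (A + (t%:C)%:M)%R = 0%R].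
Proof.
pose p := char_poly (- A)%R.
have [r pr] := closed_field_poly_normal p.
have lp : lead_coef p = 1%R by exact/monicP/char_poly_monic.
apply: (@sub_finite_set _ _ [set` map (@complex.Re R) r]); last exact: finite_seq.
move=> t /= dt; apply/mapP; exists t%:C => //.
have : root p t%:C.
  rewrite -eigenvalue_root_char /eigenvalue /eigenspace kermx_eq0 row_free_unit.
  rewrite -opprD unitmxE unitfE -scaleN1r detZ dt mulr0 eqxx //.
by rewrite pr lp scale1r root_prod_XsubC.
Qed.

Lemma nprob_finite_set (A : set R) : finite_set A -> nprob R A = 0.
Proof.
move=> fA; have dom : nprob R `<< (@lebesgue_measure R) by exact: normal_prob_dominates.
have mA : measurable (A : set (measurableTypeR R)) by apply: countable_measurable; [by move=> t; exact: measurable_set1|exact: finite_set_countable].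
have /null_content_dominatesP h := dom; apply: h => //.
by apply: countable_lebesgue_measure0; exact: finite_set_countable.
Qed.

(** The [flat] integral of the indicator of [S] is unchanged by a shift along [t A], hence equals
    its average over a normal [t]. Exchanging the integrals gives 0, as a finite set of [t] is null.
    Since [gwt >= 1], [G S] vanishes as well. *)
Lemma gaussian_shift_null N L (G : probability (borelmx R N L) R) (A : 'M[R[i]]_(N, L))
    (S : set (borelmx R N L)) : gaussian_ensemble G -> measurable S ->
  (forall Y : 'M[R[i]]_(N, L), finite_set [set t : R | S (Y + t%:C *: A)%R]) -> G S = 0.
Proof.
move=> gG mS fS.
have mi : measurable_fun setT (fun Y : borelmx R N L => (\1_S Y)%:E : \bar R).
  by apply/measurable_EFinP; exact: measurable_indic.
have i0 (Y : borelmx R N L) : 0 <= (\1_S Y)%:E :> \bar R by rewrite lee_fin.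
pose f (u : R * borelmx R N L) : \bar R :=
  (\1_S ((u.2 : 'M[R[i]]_(N, L)) + (u.1)%:C *: A)%R)%:E * gwt (u.2 : 'M[R[i]]_(N, L)).
have mf : measurable_fun setT (f : measurableTypeR R * borelmx R N L -> \bar R).
  have m1 : measurable_fun setT (fun u : measurableTypeR R * borelmx R N L =>
      (\1_S ((u.2 : 'M[R[i]]_(N, L)) + (u.1)%:C *: A)%R)%:E : \bar R).
    apply: (measurable_comp_mx mi); apply: mmeasD.
      exact: (mmeas_comp (@mmeas_id R N L) measurable_snd).
    by apply: mmeasZ; [apply: cmeas_real; exact: measurable_fst|exact: mmeas_cst].
  exact: (emeasurable_funM m1 (measurableT_comp (@measurable_gwt R N L) measurable_snd)).
have f0 u : 0 <= f u by exact: mule_ge0 (i0 _) (gwt_ge0 _).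
have E1 : \int[nprob R]_t \int[G]_Y f (t, Y) = flat G (fun Y => (\1_S Y)%:E).
  transitivity (\int[nprob R]_t flat G (fun Y => (\1_S Y)%:E)).
    apply: eq_integral => t _.
    exact: (flat_invariantT gG (t%:C *: A)%R mi i0).
  by rewrite integral_cst//= -[RHS]mule1; congr (_ * _); exact: probability_setT.
have E2 : \int[G]_Y \int[nprob R]_t f (t, Y) = 0.
  apply: integral0_eq => Y _.
  have mY : measurable_fun setT (fun t : measurableTypeR R => (\1_S ((Y : 'M[R[i]]_(N, L)) + t%:C *: A)%R)%:E : \bar R).
    apply: (measurable_comp_mx mi); apply: mmeasD; first exact: mmeas_cst.
    by apply: mmeasZ; [apply: cmeas_real; exact: measurable_id|exact: mmeas_cst].
  transitivity ((\int[nprob R]_t (\1_S ((Y : 'M[R[i]]_(N, L)) + t%:C *: A)%R)%:E) * gwt (Y : 'M[R[i]]_(N, L))).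
    exact: (ge0_integralZr (nprob R) measurableT mY (fun t _ => i0 _) (gwt_ge0 _)).
  pose St := [set t : R | S ((Y : 'M[R[i]]_(N, L)) + t%:C *: A)%R].
  have mSt : measurable (St : set (measurableTypeR R)).
    by apply: countable_measurable; [by move=> t; exact: measurable_set1|exact: finite_set_countable (fS Y)].
  transitivity ((\int[nprob R]_t (\1_St t)%:E) * gwt (Y : 'M[R[i]]_(N, L))).
    by congr (_ * _); apply: eq_integral => t _; rewrite !indicE; congr ((nat_of_bool _)%:R%:E); apply/idP/idP; rewrite !inE.
  have -> : \int[nprob R]_t (\1_St t)%:E = nprob R St by rewrite integral_indic// setIT.
  by rewrite (nprob_finite_set (fS Y)) mul0e.
have FT := fubini_tonelli (m1 := nprob R) (m2 := G) f mf f0.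
have F0 : flat G (fun Y => (\1_S Y)%:E) = 0 by rewrite -E1 FT E2.
apply/eqP; rewrite eq_le measure_ge0 andbT -F0 /flat.
have -> : G S = \int[G]_Y (\1_S Y)%:E by rewrite integral_indic// setIT.
apply: (ge0_le_integral G measurableT (fun Y _ => i0 Y) mi).
  exact: (emeasurable_funM mi (@measurable_gwt R N L)).
move=> Y _; rewrite -[leLHS]mule1; apply: (lee_wpmul2l (i0 Y)).
by rewrite /gwt lee_fin -expR0 ler_expR fnorm2_ge0.
Qed.

(** The top [L x L] block is almost surely invertible: shifting by [t] times [pid_mx L] adds [t] to
    its diagonal, so its determinant vanishes for finitely many [t]. *)
Lemma gaussian_fullrank N L (G : probability (borelmx R N L) R) : gaussian_ensemble G ->
  (L <= N)%N -> {ae G, forall X, fullrank (X : 'M[R[i]]_(N, L))}.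
Proof.
move=> gG LN; pose S : set (borelmx R N L) :=
  [set X | \det ((pid_mx L : 'M[R[i]]_(L, N)) *m (X : 'M[R[i]]_(N, L))) = 0%R].
have mS : measurable S.
  apply: cmeas_measurable_eq; last exact: cmeas_cst.
  by apply: cmeas_det; apply: mmeasM; [exact: mmeas_cst|exact: mmeas_id].
exists S; split => //.
  apply: (gaussian_shift_null (A := pid_mx L) gG mS) => Y.
  apply: sub_finite_set (finite_singular_shift ((pid_mx L : 'M[R[i]]_(L, N)) *m Y)) => t /=.
  rewrite /S /= mulmxDr -scalemxAr mul_pid_mx.
  by rewrite minnn (minn_idPr LN) pid_mx_1 scalemx1.
move=> X /=; apply: contra_notP => dX.
rewrite fullrank_rowfree.
have uX : (X : 'M[R[i]]_(N, L)) ^t* *m (pid_mx L) ^t* \in unitmx.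
  rewrite -adjM map_unitmx unitmx_tr unitmxE unitfE; exact/eqP.
apply/row_freeP; exists ((pid_mx L) ^t* *m invmx ((X : 'M[R[i]]_(N, L)) ^t* *m (pid_mx L) ^t*)).
by rewrite mulmxA mulmxV.
Qed.

Lemma gaussian_Re_sqr N L (G : probability (borelmx R N L) R) i j : gaussian_ensemble G ->
  \int[G]_X (complex.Re ((X : 'M[R[i]]_(N, L)) i j) ^+ 2)%:E = 2^-1%:E.
Proof.
move=> gG; have [m1 _] := @mmeas_id R N L i j.
rewrite (integral_resample true i j gG).
- transitivity (\int[G]_X (2^-1)%:E).
    apply: eq_integral => X _; rewrite -[RHS]nprob_second_moment.
    by apply: eq_integral => x _; rewrite mxE eqxx.
  by rewrite integral_cst//= -[RHS]mule1; congr (_ * _); exact: probability_setT.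
- by apply/measurable_EFinP; exact: measurable_funX.
- by move=> Y; rewrite lee_fin sqr_ge0.
Qed.

Lemma gaussian_Im_sqr N L (G : probability (borelmx R N L) R) i j : gaussian_ensemble G ->
  \int[G]_X (complex.Im ((X : 'M[R[i]]_(N, L)) i j) ^+ 2)%:E = 2^-1%:E.
Proof.
move=> gG; have [_ m1] := @mmeas_id R N L i j.
rewrite (integral_resample false i j gG).
- transitivity (\int[G]_X (2^-1)%:E).
    apply: eq_integral => X _; rewrite -[RHS]nprob_second_moment.
    by apply: eq_integral => x _; rewrite mxE eqxx.
  by rewrite integral_cst//= -[RHS]mule1; congr (_ * _); exact: probability_setT.
- by apply/measurable_EFinP; exact: measurable_funX.
- by move=> Y; rewrite lee_fin sqr_ge0.
Qed.

Definition sqmod (z : R[i]) : R := (complex.Re z ^+ 2 + complex.Im z ^+ 2)%R.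

Lemma sqmod_ge0 z : (0 <= sqmod z)%R.
Proof. by rewrite addr_ge0 ?sqr_ge0. Qed.

Lemma measurable_sqmod d (T : measurableType d) (f : T -> R[i]) : cmeas f ->
  measurable_fun setT (fun w => sqmod (f w)).
Proof. by move=> [f1 f2]; apply: measurable_funD; apply: measurable_funX. Qed.

Lemma gaussian_sqmod N L (G : probability (borelmx R N L) R) i j : gaussian_ensemble G ->
  \int[G]_X (sqmod ((X : 'M[R[i]]_(N, L)) i j))%:E = 1.
Proof.
move=> gG; have [m1 m2] := @mmeas_id R N L i j.
under eq_integral do rewrite EFinD.
rewrite ge0_integralD//; last 4 first.
- by move=> X _; rewrite lee_fin sqr_ge0.
- by apply/measurable_EFinP; exact: measurable_funX.
- by move=> X _; rewrite lee_fin sqr_ge0.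
- by apply/measurable_EFinP; exact: measurable_funX.
by rewrite gaussian_Re_sqr// gaussian_Im_sqr// -EFinD; congr EFin; field.
Qed.

(* Diagonalising [H] by a unitary [U] reduces the claim to the second moments
   of the entries of [Y *m U], which has the same law as [Y]. *)
Lemma gaussian_quad N L (G : probability (borelmx R N L) R) (H : 'M[R[i]]_L) k :
  gaussian_ensemble G -> psd H ->
  \int[G]_Y (complex.Re (((Y : 'M[R[i]]_(N, L)) *m H *m Y ^t*) k k))%:E =
  (complex.Re (\tr H))%:E.
Proof.
move=> gG /psd_spectral[U [s [uU HE _ _ s0]]].
have uV : U ^t* \is unitarymx by rewrite trmxC_unitary.
pose F (Y : borelmx R N L) : \bar R :=
  (\sum_l s 0 l * sqmod ((Y : 'M[R[i]]_(N, L)) k l))%:E.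
have mF : measurable_fun setT F.
  apply/measurable_EFinP; apply: measurable_sum => l.
  by apply: measurable_funM => //; apply: measurable_sqmod; exact: mmeas_id.
have F0 Y : 0 <= F Y.
  by rewrite lee_fin; apply: sumr_ge0 => l _; rewrite mulr_ge0// sqmod_ge0.
transitivity (\int[G]_Y F ((Y : 'M[R[i]]_(N, L)) *m U ^t*)).
  apply: eq_integral => Y _; congr EFin.
  have E : (Y : 'M[R[i]]_(N, L)) *m H *m Y ^t* = (Y *m U ^t*) *m cdiag s *m (Y *m U ^t*) ^t*.
    by rewrite HE adjM trmxCK !mulmxA.
  have := quad_cdiag s (row k ((Y : 'M[R[i]]_(N, L)) *m U ^t*)).
  have -> : (row k (Y *m U ^t*) *m cdiag s *m (row k (Y *m U ^t*)) ^t*) 0%R 0%R =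
      ((Y *m U ^t*) *m cdiag s *m (Y *m U ^t*) ^t*) k k.
    by rewrite -row_mul !mxE; apply: eq_bigr => l _; rewrite !mxE.
  rewrite -E => ->; apply: eq_bigr => l _; by rewrite /sqmod !mxE.
rewrite gaussian_right_unitary//.
rewrite /F; under eq_integral do rewrite -sumEFin.
rewrite ge0_integral_sum//; last 2 first.
- move=> l; apply/measurable_EFinP; apply: measurable_funM => //.
  by apply: measurable_sqmod; exact: mmeas_id.
- by move=> l Y _; rewrite lee_fin mulr_ge0// sqmod_ge0.
transitivity (\sum_(l < L) (s 0%R l)%:E).
  apply: eq_bigr => l _; under eq_integral do rewrite EFinM.
  rewrite ge0_integralZl_EFin//; last 2 first.
  - by move=> Y _; rewrite lee_fin sqmod_ge0.
  - by apply/measurable_EFinP; apply: measurable_sqmod; exact: mmeas_id.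
  by rewrite gaussian_sqmod// mule1.
rewrite sumEFin HE mxtrace_mulC mulmxA (unitarymxP uU) mul1mx; congr EFin.
by rewrite /mxtrace Re_sum; apply: eq_bigr => l _; rewrite !mxE eqxx mulr1n.
Qed.

End gaussian_moments.

(** * Finiteness of the inverse Gram trace *)

Section inverse_order.
Context (R : realType).

Lemma quadZ n (c : R) (A : 'M[R[i]]_n) (v : 'rV[R[i]]_n) :
  complex.Re ((v *m (c%:C *: A) *m v ^t*) 0 0) = c * complex.Re ((v *m A *m v ^t*) 0 0).
Proof. by rewrite -scalemxAr -scalemxAl mxE ReM /= mul0r subr0. Qed.

(* Evaluate the form of [B] at [w *m (A^-1 - c^-1 B^-1)]. *)
Lemma psd_inv_antitone n (A B : 'M[R[i]]_n) (c : R) (w : 'rV[R[i]]_n) :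
  0 < c -> psd A -> psd B -> A \in unitmx -> B \in unitmx ->
  (forall v : 'rV[R[i]]_n, c * complex.Re ((v *m B *m v ^t*) 0 0) <=
     complex.Re ((v *m A *m v ^t*) 0 0)) ->
  c * complex.Re ((w *m invmx A *m w ^t*) 0 0) <= complex.Re ((w *m invmx B *m w ^t*) 0 0).
Proof.
move=> c0 [Aa _] [Ba Bp] uA uB AB.
have IAa : (invmx A) ^t* = invmx A by rewrite adj_invmx Aa.
have IBa : (invmx B) ^t* = invmx B by rewrite adj_invmx Ba.
have := conj (mulmxV uA) (mulVmx uA); have := conj (mulmxV uB) (mulVmx uB).
move: (invmx A) (invmx B) IAa IBa => I J Ia Ja [BJ JB] [AI IA].
pose x := w *m I; pose y := w *m J.
have xa : x ^t* = I *m w ^t* by rewrite adjM Ia.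
have ya : y ^t* = J *m w ^t* by rewrite adjM Ja.
have xAx : x *m A *m x ^t* = w *m I *m w ^t*.
  by rewrite xa /x -(mulmxA w) IA mulmx1 mulmxA.
have xBy : x *m B *m y ^t* = w *m I *m w ^t*.
  by rewrite ya /x mulmxA -(mulmxA _ B J) BJ mulmx1.
have yBx : y *m B *m x ^t* = w *m I *m w ^t*.
  by rewrite xa /y -(mulmxA w) JB mulmx1 mulmxA.
have yBy : y *m B *m y ^t* = w *m J *m w ^t*.
  by rewrite ya /y -(mulmxA w) JB mulmx1 mulmxA.
have := AB x; rewrite xAx; set al := complex.Re ((w *m I *m w ^t*) 0 0); set g := complex.Re _.
have := Bp (c%:C *: x - y).
have -> : (c%:C *: x - y) ^t* = c%:C *: x ^t* - y ^t*.
  apply/matrixP => i j; rewrite !mxE rmorphB rmorphM /=; congr (_ * _ - _).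
  by apply/eqP; rewrite eq_complex /= oppr0 !eqxx.
rewrite mulmxBl mulmxBr !mulmxBl -!scalemxAl -!scalemxAr xBy yBx yBy.
have E (u v : 'M[R[i]]_1) : complex.Re ((u - v) 0 0) = complex.Re (u 0 0) - complex.Re (v 0 0).
  by rewrite !mxE ReD ReN.
have EZ (k : R) (u : 'M[R[i]]_1) : complex.Re ((k%:C *: u) 0 0) = k * complex.Re (u 0 0).
  by rewrite mxE ReM /= mul0r subr0.
rewrite !E !EZ -/al -/g; set be := complex.Re ((w *m J *m w ^t*) 0 0) => h1 h2.
have h3 : c * (c * g) <= c * al by rewrite ler_pM2l.
lra.
Qed.

Lemma psd_le_trace n (A : 'M[R[i]]_n) (v : 'rV[R[i]]_n) : psd A ->
  complex.Re ((v *m A *m v ^t*) 0 0) <= complex.Re (\tr A) * complex.Re ((v *m v ^t*) 0 0).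
Proof.
move=> /psd_spectral[U [s [uU HE _ _ s0]]].
have trA : complex.Re (\tr A) = \sum_l s 0 l.
  rewrite HE mxtrace_mulC mulmxA (unitarymxP uU) mul1mx /mxtrace Re_sum.
  by apply: eq_bigr => l _; rewrite !mxE eqxx mulr1n.
have -> : v *m A *m v ^t* = (v *m U ^t*) *m cdiag s *m (v *m U ^t*) ^t*.
  by rewrite HE adjM trmxCK !mulmxA.
have -> : v *m v ^t* = (v *m U ^t*) *m (v *m U ^t*) ^t*.
  by rewrite adjM trmxCK mulmxA -(mulmxA v) unitary_mulK// mulmx1.
rewrite quad_cdiag trA; move: (v *m U ^t*) => x.
have -> : complex.Re ((x *m x ^t*) 0 0) = \sum_k sqmod (x 0 k).
  have := fnorm2E x; rewrite /fnorm2 /mxtrace !big_ord1 //.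
rewrite mulr_sumr; apply: ler_sum => k _; apply: ler_wpM2r; first exact: sqmod_ge0.
by rewrite (bigD1 k)//= lerDl sumr_ge0.
Qed.

Lemma gram_psd n m (X : 'M[R[i]]_(n, m)) : psd (X ^t* *m X).
Proof. by have := psd_gram X (psd1 R n); rewrite mulmx1. Qed.

(** A positive semidefinite matrix is at most its trace times the identity. Applied to the Gram
    matrix, whose trace is [fnorm2 W], and inverted, this bounds the entry from below. *)
Lemma rproj_diag_lb n m (W : 'M[R[i]]_(n, m)) k : fullrank W ->
  fnorm2 (row k W) <= fnorm2 W * complex.Re (rproj W k k).
Proof.
move=> fW; have pA := gram_psd W.
have -> : rproj W k k = (row k W *m invmx (W ^t* *m W) *m (row k W) ^t*) 0 0.
  by rewrite /rproj -row_mul !mxE; apply: eq_bigr => l _; rewrite !mxE.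
have -> : fnorm2 (row k W) = complex.Re ((row k W *m (row k W) ^t*) 0 0).
  by rewrite /fnorm2 /mxtrace big_ord1.
have -> : fnorm2 W = complex.Re (\tr (W ^t* *m W)) by rewrite /fnorm2 mxtrace_mulC.
(* Without columns both sides are 0. Otherwise the trace of the Gram matrix is positive, since a
   positive semidefinite matrix of zero trace is zero, hence singular in positive size. *)
case: m W fW pA => [|m] W fW pA.
  by rewrite ![(_ *m _ : 'M[R[i]]_1) 0 0]mxE !big_ord0 /= mulr0.
set w := row k W; set A := W ^t* *m W in fW pA *; set t := complex.Re (\tr A).
have t0 : 0 < t.
  rewrite lt_neqAle eq_sym; apply/andP; split; last first.
    by rewrite /t /mxtrace Re_sum; apply: sumr_ge0 => i _; have [] := psd_diag i pA.
  apply/eqP => t0.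
  have A0 : A = 0.
    have dg i : complex.Re (A i i) = 0.
      have ge i' : true -> 0 <= complex.Re (A i' i') by move=> _; have [] := psd_diag i' pA.
      move: t0; rewrite /t /mxtrace Re_sum => /eqP; rewrite psumr_eq0//.
      by move=> /allP/(_ i (mem_index_enum _))/eqP.
    apply/matrixP => i j; have := psd_offdiag i j pA; rewrite !dg addr0 !normr_le0 [RHS]mxE.
    by move=> [a b]; apply/eqP; rewrite eq_complex a b.
  by move: fW; rewrite /fullrank -/A A0 unitmxE det0 unitr0.
have uT : (t%:C *: 1%:M : 'M[R[i]]_m.+1) \in unitmx.
  by rewrite unitmxZ ?unitmx1// unitfE fmorph_eq0 gt_eqF.
have pT : psd (t%:C *: 1%:M : 'M[R[i]]_m.+1).
  split; first by apply/matrixP => i j; rewrite !mxE rmorphM /= conjC_nat eq_sym;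
    congr (_ * _); apply/eqP; rewrite eq_complex /= oppr0 !eqxx.
  by move=> v; rewrite quadZ mulmx1 mulr_ge0 ?(ltW t0)// row_norm_ge0.
have := @psd_inv_antitone _ _ A 1 w ltr01 pT pA uT fW; rewrite mul1r.
have -> : invmx (t%:C *: 1%:M : 'M[R[i]]_m.+1) = t^-1%:C *: 1%:M.
  apply: (can_inj (mulKmx uT)); rewrite mulmxV// -scalemxAl mul1mx scalerA.
  by rewrite -[X in X *: _](rmorphM (real_complex R)) /= mulfV ?gt_eqF// scale1r.
rewrite quadZ mulmx1 mulrC ler_pdivrMr// [X in _ -> _ <= X]mulrC; apply => v.
by rewrite mul1r quadZ mulmx1; exact: psd_le_trace.
Qed.

(** If [be] denotes the left side, the diagonal entry of the complementary projector is exactly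
    [1 / (1 + be)], so the bound is [be <= 1 + be]. *)
Lemma leverage_bound n m (X : 'M[R[i]]_(n, m)) (y : 'rV[R[i]]_m) : fullrank X ->
  complex.Re ((y *m invmx (X ^t* *m X) *m y ^t*) 0 0) <=
  (complex.Re ((1%:M - rproj (col_mx X y)) (rshift n ord0) (rshift n ord0)))^-1.
Proof.
move=> fX.
have gram : (col_mx X y) ^t* *m col_mx X y = X ^t* *m X + y ^t* *m y.
  by rewrite tr_col_mx map_row_mx mul_row_col.
have pB := gram_psd X; set B := X ^t* *m X in fX gram pB *.
pose be := complex.Re ((y *m invmx B *m y ^t*) 0 0).
have [pI1 pI2] := psd_conj y (psd_invmx pB).
have beE : y *m invmx B *m y ^t* = be%:C%:M.
  apply/matrixP => i j; rewrite !ord1 [RHS]mxE eqxx mulr1n.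
  apply/eqP; rewrite eq_complex /= eqxx /=.
  by have [_ ->] := psd_diag 0 (psd_conj y (psd_invmx pB)).
have be0 : 0 <= be by have [+ _] := psd_diag 0 (psd_conj y (psd_invmx pB)).
have uA : B + y ^t* *m y \in unitmx.
  rewrite -gram; have : fullrank (col_mx X y); last by [].
  rewrite fullrank_rowfree; have : fullrank X by []; rewrite fullrank_rowfree.
  move=> /row_freeP[C HC]; apply/row_freeP; exists (col_mx C 0).
  by rewrite tr_col_mx map_row_mx mul_row_col HC mulmx0 addr0.
(* Sherman-Morrison *)
have key : invmx (B + y ^t* *m y) *m y ^t* = (1 + be)^-1%:C *: (invmx B *m y ^t*).
  apply: (can_inj (mulKmx uA)); rewrite mulmxA (mulmxV uA) mul1mx -scalemxAr mulmxDl.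
  rewrite !mulmxA (mulmxV fX) mul1mx -(mulmxA (y ^t*) y) -(mulmxA (y ^t*)) beE mul_mx_scalar.
  rewrite -[X in _ *: (X + _)]scale1r -scalerDl scalerA.
  rewrite -[X in (_ * (X + _))](rmorph1 (real_complex R)) -rmorphD -rmorphM /=.
  by rewrite mulVf ?scale1r// gt_eqF// ltr_pwDl.
have -> : complex.Re ((1%:M - rproj (col_mx X y)) (rshift n ord0) (rshift n ord0)) =
    1 - (1 + be)^-1 * be.
  rewrite mxE [X in complex.Re (X + _)]mxE eqxx [X in complex.Re (_ + X)]mxE ReD ReN.
  congr (_ - _); rewrite /rproj gram.
  have -> : (col_mx X y *m invmx (B + y ^t* *m y) *m (col_mx X y) ^t*) (rshift n ord0) (rshift n ord0) =
     (y *m (invmx (B + y ^t* *m y) *m y ^t*)) 0 0.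
    by rewrite tr_col_mx map_row_mx mul_col_mx mul_col_row block_mxEdr mulmxA.
  by rewrite key -scalemxAr mulmxA beE !mxE eqxx ReM /= mul0r subr0.
rewrite -/be -[X in X - _](@mulVf _ (1 + be)); last by rewrite gt_eqF// ltr_pwDl.
by rewrite -mulrBr addrK mulr1 invrK lerDr.
Qed.

End inverse_order.

(** * The mean of the inverse squared norm of a Gaussian row *)

Section inverse_moment.
Context (R : realType).
Local Open Scope ereal_scope.
Local Notation peak := (normal_peak (nsd R)).

Lemma nprob_small (e : R) : (0 <= e)%R ->
  nprob R `[(- e)%R, e]%classic <= (peak * (2 * e))%:E.
Proof.
move=> e0; rewrite /nprob /= /normal_prob.
apply: (@le_trans _ _ (\int[lebesgue_measure]_(x in `[(- e)%R, e]%classic) peak%:E)).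
  apply: ge0_le_integral => //.
  - by move=> x _; rewrite lee_fin normal_pdf_ge0.
  - apply/measurable_EFinP; apply: measurable_funTS; exact: measurable_normal_pdf.
  - by move=> x _; rewrite lee_fin normal_pdf_ub// nsd_neq0.
rewrite integral_cst//= EFinM; apply: lee_wpmul2l; first by rewrite lee_fin normal_peak_ge0.
have -> := @lebesgue_measure_itv R `[(- e)%R, e].
rewrite /= lte_fin; case: ifP => _; last by rewrite lee_fin mulr_ge0.
by rewrite -EFinB lee_fin; lra.
Qed.

(** The power 4 counts the real coordinates of the first two entries, each confined to [[-e, e]]. A
    single complex entry would give only the power 2, too weak for [gaussian_inv_sqnorm]. *)
Lemma gaussian_small_ball r (G : probability (borelmx R 1 r.+2) R) (e : R) :
  gaussian_ensemble G -> (0 <= e)%R ->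
  G [set Y | (fnorm2 (Y : 'M[R[i]]_(1, r.+2)) <= e ^+ 2)%R] <= ((peak * (2 * e)) ^+ 4)%:E.
Proof.
move=> gG e0.
pose C (b : bool) (i : 'I_1) (j : 'I_r.+2) : set R :=
  if (j < 2)%N then `[(- e)%R, e]%classic else setT.
have mC b i j : measurable (C b i j) by rewrite /C; case: ifP => // _; exact: measurable_itv.
apply: (@le_trans _ _ (G (gbox C))).
  apply: le_measure; rewrite ?inE.
  - apply: measurable_le; last exact: measurable_cst.
    by apply: measurable_fnorm2; exact: mmeas_id.
  - exact: measurable_gbox.
  - move=> Y /= Ye i j.
    have h := le_trans (fnorm2_coord (Y : 'M[R[i]]_(1, r.+2)) i j) Ye.
    have sq (x z : R) : (x ^+ 2 + z ^+ 2 <= e ^+ 2 -> -e <= x <= e)%R.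
      move=> xz; rewrite -ler_norml -(@ler_pXn2r _ 2) ?nnegrE// real_normK ?num_real//.
      by apply: le_trans xz; rewrite lerDl sqr_ge0.
    rewrite /C; case: ifP => // _; rewrite /= !in_itv /=; split; first exact: sq h.
    by rewrite addrC in h; exact: sq h.
rewrite gaussian_gbox// /gmass -(pair_bigA _
  (fun i j => nprob R (C true i j) * nprob R (C false i j))) /= big_ord1.
rewrite !big_ord_recl big1 ?mule1 => [|j _]; last by rewrite /C /= !probability_setT mule1.
rewrite /C /=; set x := nprob R _.
have x1 : x <= (peak * (2 * e))%:E by exact: nprob_small.
have x0 : 0 <= x by exact: measure_ge0.
have -> : ((peak * (2 * e)) ^+ 4)%:E = (peak * (2 * e))%:E * (peak * (2 * e))%:E *
   ((peak * (2 * e))%:E * (peak * (2 * e))%:E) by rewrite -!EFinM; congr EFin; ring.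
by apply: lee_pmul; rewrite ?mule_ge0//; apply: lee_pmul.
Qed.

(** [k] is the least index with [4^-(k+1) < S]. Minimality gives the first bound when [k > 0], and
    [S <= 1/4] gives it when [k = 0]. *)
Lemma dyadic_scale (S : R) : (0 < S)%R -> (S <= 4^-1)%R ->
  exists k : nat, (S <= (2^-1 ^+ k) ^+ 2)%R /\ (S^-1 <= 4 ^+ k.+1)%R.
Proof.
move=> S0 S4.
have [k0 Hk0] : exists k, ((2^-1 ^+ k.+1) ^+ 2 < S)%R.
  have [k] : exists k, (0 + k.+1%:R^-1 < S)%R by apply: ltr_add_invr.
  rewrite add0r => kS; exists k; apply: le_lt_trans kS.
  rewrite exprVn exprVn lef_pV2 ?posrE ?exprn_gt0//.
  rewrite -exprM (le_trans (_ : _ <= 2 ^+ k.+1)%R)//.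
    by rewrite -natrX ler_nat ltnW// ltn_expl.
  by rewrite ler_weXn2l ?ler1n// leq_pmulr.
have ex : exists k, ((2^-1 ^+ k.+1) ^+ 2 < S)%R by exists k0.
case: (ex_minnP ex) => k kS kmin; exists k; split.
  case: k kS kmin => [|k] kS kmin; first by rewrite expr0 expr1n (le_trans S4)// invf_le1// ler1n.
  by rewrite leNgt; apply/negP => /kmin; rewrite ltnn.
rewrite -[leRHS]invrK lef_pV2 ?posrE ?invr_gt0 ?exprn_gt0//.
apply: ltW; apply: le_lt_trans kS; rewrite !exprVn lef_pV2 ?posrE ?exprn_gt0//.
by rewrite -exprM mulnC exprM (_ : (2 ^+ 2 = 4 :> R)%R)// expr2 -natrM.
Qed.

(** The inverse squared norm is at most 4 plus the sum over [k] of [4^(k+1)] times the indicator of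
    the ball of radius [2^-k]. The mass of that ball is of order [16^-k], so the series of integrals
    converges geometrically. *)
Lemma gaussian_inv_sqnorm r (G : probability (borelmx R 1 r.+2) R) : gaussian_ensemble G ->
  \int[G]_Y ((fnorm2 (Y : 'M[R[i]]_(1, r.+2)))^-1)%:E < +oo.
Proof.
move=> gG; pose fn (Y : borelmx R 1 r.+2) := fnorm2 (Y : 'M[R[i]]_(1, r.+2)).
have mfn : measurable_fun setT fn by apply: measurable_fnorm2; exact: mmeas_id.
pose B k : set (borelmx R 1 r.+2) := [set Y | (fn Y <= (2^-1 ^+ k) ^+ 2)%R].
have mB k : measurable (B k) by apply: measurable_le => //; exact: measurable_cst.
pose u k Y : \bar R := ((4 ^+ k.+1 : R) * \1_(B k) Y)%:E.
have u0 k Y : 0 <= u k Y by rewrite lee_fin mulr_ge0.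
have mu_ k : measurable_fun setT (u k).
  by apply/measurable_EFinP; apply: measurable_funM => //; exact: measurable_indic.
have bnd Y : ((fn Y)^-1)%:E <= 4%:E + \sum_(k <oo) u k Y.
  have s0 : 0 <= \sum_(k <oo) u k Y by exact: nneseries_ge0.
  have fn0 : (0 <= fn Y)%R by exact: fnorm2_ge0.
  case: (ltP 4^-1%R (fn Y)) => h.
    rewrite -[leLHS]adde0; apply: leeD => //; rewrite lee_fin -[leRHS]invrK lef_pV2 ?posrE ?invr_gt0//.
      exact: ltW.
    by apply: lt_trans h; rewrite invr_gt0.
  move: fn0; rewrite le_eqVlt => /orP[/eqP <-|fn0].
    by rewrite invr0 adde_ge0// lee_fin.
  have [k [k1 k2]] := dyadic_scale fn0 h.
  apply: (@le_trans _ _ (u k Y)).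
    by rewrite /u indicE mem_set// mulr1 lee_fin.
  rewrite -[leLHS]add0e; apply: leeD; first by rewrite lee_fin.
  apply: (@le_trans _ _ (\sum_(0 <= j < k.+1) u j Y)).
    by rewrite big_nat_recr//= -[leLHS]add0e; apply: leeD => //; exact: sume_ge0.
  exact: nneseries_lim_ge.
apply: (@le_lt_trans _ _ (\int[G]_Y (4%:E + \sum_(k <oo) u k Y))).
  apply: ge0_le_integral => //.
  - by move=> Y _; rewrite lee_fin invr_ge0 fnorm2_ge0.
  - by apply/measurable_EFinP; exact: measurable_inv_fun.
  - apply: emeasurable_funD; first exact: measurable_cst.
    exact: ge0_emeasurable_sum.
have ms : measurable_fun setT (fun Y => \sum_(k <oo) u k Y).
  exact: ge0_emeasurable_sum.
rewrite ge0_integralD//; last by move=> Y _; exact: nneseries_ge0.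
rewrite lte_add_pinfty//.
  by rewrite integral_cst//= (_ : G setT = 1) ?mule1 ?ltry//; exact: probability_setT.
rewrite integral_nneseries//.
(* With [q = (peak * 2) ^+ 4], the term of index [k] is at most
   [4 q 4^-k <= 4 q 2^-k = 8 q / 2^(k+1)], the form that [epsilon_trick0] sums. *)
pose c : R := (8 * (peak * 2) ^+ 4)%R.
have c0 : (0 <= c)%R by rewrite mulr_ge0// exprn_ge0// mulr_ge0// normal_peak_ge0.
apply: (@le_lt_trans _ _ (\sum_(k <oo) (c / (2 ^ k.+1)%:R)%:E)); last first.
  by apply: le_lt_trans (epsilon_trick0 _ c0) _; exact: ltry.
apply: lee_nneseries => [k _ _|k _]; first by apply: integral_ge0.
rewrite /u; under eq_integral do rewrite EFinM.
rewrite ge0_integralZl_EFin//; last by apply/measurable_EFinP; exact: measurable_indic.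
rewrite integral_indic// setIT.
have e0 : (0 <= 2^-1 ^+ k :> R)%R by rewrite exprn_ge0// invr_ge0.
have := gaussian_small_ball gG e0; rewrite -/(B k) => h.
apply: (@le_trans _ _ ((4 ^+ k.+1)%:E * ((peak * (2 * 2^-1 ^+ k)) ^+ 4)%:E)).
  by apply: lee_wpmul2l => //; rewrite lee_fin exprn_ge0.
rewrite -EFinM lee_fin /c natrX.
have -> : ((peak * (2 * 2^-1 ^+ k)) ^+ 4 = (peak * 2) ^+ 4 * (2^-1 ^+ k) ^+ 4)%R.
  by rewrite mulrA exprMn.
set q := ((peak * 2) ^+ 4)%R.
have q0 : (0 <= q)%R by rewrite exprn_ge0// mulr_ge0// normal_peak_ge0.
have -> : (8 * q / 2 ^+ k.+1 = q * (4 * 2^-1 ^+ k))%R.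
  by rewrite exprS exprVn; field; rewrite expf_neq0.
rewrite mulrCA ler_wpM2l// exprS -mulrA ler_wpM2l//.
have -> : (4 ^+ k = (2 ^+ k) ^+ 2 :> R)%R by rewrite -exprM mulnC exprM (_ : (2 ^+ 2 = 4 :> R)%R)// expr2 -natrM.
rewrite exprVn; set z := (2 ^+ k : R)%R.
have z1 : (1 <= z)%R by rewrite exprn_ege1// ler1n.
have z0 : (0 < z)%R by exact: lt_le_trans z1.
have -> : (z ^+ 2 * z^-1 ^+ 4 = z^-1 * z^-1)%R by field; rewrite gt_eqF.
by rewrite ler_piMr ?invr_ge0 ?(ltW z0)// invf_le1.
Qed.

End inverse_moment.

Lemma measurable_integral_section d1 d2 (T1 : measurableType d1) (T2 : measurableType d2)
    (R : realType) (P : probability T2 R) (f : T1 * T2 -> \bar R) :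
  measurable_fun setT f -> (forall u, 0 <= f u)%E ->
  measurable_fun setT (fun x => \int[P]_y f (x, y))%E.
Proof. by move=> mf f0; exact: measurable_fun_fubini_tonelli_F. Qed.

(** * Finite mean of the trace when [L < N] *)

Section invgram_finite.
Context (R : realType).
Local Open Scope ereal_scope.

Lemma conj_invariant_compl n (mu : probability (borelmx R n n) R)
    (mf : measurable_fun setT (fun p : borelmx R n n => (1%:M - (p : 'M[R[i]]_n))%R : borelmx R n n)) :
  conj_invariant mu -> conj_invariant (law mu mf).
Proof.
move=> imu U uU B mB.
have mC := measurable_preimage mf mB.
have H := imu _ uU _ mC; apply: etrans H.
transitivity (mu [set p : borelmx R n n | B (U *m (1%:M - (p : 'M[R[i]]_n)) *m U ^t*)%R]).
  by [].
congr (mu _); apply/seteqP; split => p /=;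
  by rewrite mulmxBr mulmxBl mulmx1 (unitarymxP uU).
Qed.

Lemma is_projector_compl n m k (p : 'M[R[i]]_n) : (m + k = n)%N -> is_projector m p ->
  is_projector k (1%:M - p)%R.
Proof.
move=> mk [pa pp trp]; split.
- by rewrite adjB adj1 pa.
- by rewrite mulmxBr mulmx1 mulmxBl mul1mx pp subrr subr0.
- by rewrite raddfB /= mxtrace1 trp -mk natrD addrC addKr.
Qed.

Lemma gaussian_fnorm2 N L (G : probability (borelmx R N L) R) : gaussian_ensemble G ->
  \int[G]_X (fnorm2 (X : 'M[R[i]]_(N, L)))%:E = (N * L)%:R%:E.
Proof.
move=> gG.
transitivity (\int[G]_X \sum_(p : 'I_N * 'I_L) (sqmod ((X : 'M[R[i]]_(N, L)) p.1 p.2))%:E).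
  apply: eq_integral => X _; rewrite fnorm2E pair_bigA /= -sumEFin.
  by apply: eq_bigr.
rewrite ge0_integral_sum//; last 2 first.
- by move=> p; apply/measurable_EFinP; apply: measurable_sqmod; exact: mmeas_id.
- by move=> p X _; rewrite lee_fin sqmod_ge0.
rewrite (eq_bigr (fun=> 1)) => [|p _]; last exact: gaussian_sqmod.
by rewrite sumEFin sumr_const card_prod !card_ord.
Qed.

(** The reciprocal of 1 plus the sum of the [1 / d_k] is used instead of a minimum, which would not
    make sense for an empty family. *)
Lemma lower_bound_pos n (d : 'rV[R]_n) : (forall k, 0 < d 0 k)%R ->
  exists dm : R, (0 < dm)%R /\ (forall k, dm <= d 0 k)%R.
Proof.
move=> d0; exists (1 + \sum_k (d 0 k)^-1)^-1%R.
have s0 : (0 <= \sum_k (d 0 k)^-1)%R by apply: sumr_ge0 => k _; rewrite invr_ge0 ltW.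
have h : (0 < 1 + \sum_k (d 0 k)^-1)%R by rewrite ltr_pwDl.
split=> [|k]; first by rewrite invr_gt0.
rewrite -[leRHS]invrK lef_pV2 ?posrE ?invr_gt0//.
rewrite (bigD1 k)//= addrCA lerDl addr_ge0//.
by apply: sumr_ge0 => j _; rewrite invr_ge0 ltW.
Qed.

Lemma gaussian_coord_neq0 N L (G : probability (borelmx R N L) R) i j : gaussian_ensemble G ->
  {ae G, forall X, (X : 'M[R[i]]_(N, L)) i j <> 0%R}.
Proof.
move=> gG; pose S : set (borelmx R N L) := [set X | (X : 'M[R[i]]_(N, L)) i j = 0%R].
have mS : measurable S.
  by apply: cmeas_measurable_eq; [exact: mmeas_id|exact: cmeas_cst].
exists S; split => //; last by move=> X /=; rewrite not_notE.
apply: (gaussian_shift_null (A := delta_mx i j) gG mS) => Y.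
apply: (@sub_finite_set _ _ [set (- complex.Re (Y i j))%R]) => [t|]; last exact: finite_set1.
rewrite /S /= !mxE !eqxx mulr1 => /(congr1 (@complex.Re R)); rewrite ReD /= => h.
by apply/eqP; rewrite -subr_eq0 opprK addrC h.
Qed.

(** By [rproj_diag_lb] the integrand is at most [|W|^2 / |w|^2] with [w] the last row, that is
    [|Y|^2 / |w|^2 + 1] with [Y] the other rows. Independence factors the mean, and two columns
    suffice for that of [1 / |w|^2]. The absolute value keeps the integrand nonnegative on the null
    set of rank-deficient [W]. *)
Lemma gaussian_inv_leverage n r (G : probability (borelmx R (n + 1) r.+2) R) :
  gaussian_ensemble G -> (r.+2 <= n + 1)%N ->
  \int[G]_W `|(complex.Re (rproj (W : 'M[R[i]]_(n + 1, r.+2)) (rshift n ord0) (rshift n ord0)))^-1|%:E < +oo.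
Proof.
move=> gG rn; set k := rshift n ord0.
pose f (W : borelmx R (n + 1) r.+2) : \bar R :=
  (fnorm2 (W : 'M[R[i]]_(n + 1, r.+2)) * (fnorm2 (row k (W : 'M[R[i]]_(n + 1, r.+2))))^-1)%:E.
have mrow : mmeas (fun W : borelmx R (n + 1) r.+2 => row k (W : 'M[R[i]]_(n + 1, r.+2))).
  by move=> i j; under [X in cmeas X]eq_fun do rewrite mxE; exact: mmeas_id.
have mf : measurable_fun setT f.
  apply/measurable_EFinP; apply: measurable_funM; first by apply: measurable_fnorm2; exact: mmeas_id.
  by apply: measurable_inv_fun; exact: measurable_fnorm2.
have f0 W : 0 <= f W by rewrite lee_fin mulr_ge0 ?invr_ge0 ?fnorm2_ge0.
apply: (@le_lt_trans _ _ (\int[G]_W f W)).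
  apply: ae_ge0_le_integral => //.
  - apply/measurable_EFinP; apply: measurableT_comp => //; apply: measurable_inv_fun.
    by have [] := mmeas_rproj (@mmeas_id R (n + 1) r.+2) k k.
  apply: ae_imply2 (gaussian_fullrank gG rn) (gaussian_coord_neq0 k ord0 gG) _ => W fW nW _.
  have := rproj_diag_lb k fW; set a := fnorm2 (row k _); set F := fnorm2 _; set p := complex.Re _.
  have a0 : (0 < a)%R.
    rewrite lt_neqAle fnorm2_ge0 andbT; apply/negP => /eqP /esym a0; apply: nW.
    have := fnorm2_coord (row k (W : 'M[R[i]]_(n + 1, r.+2))) 0%R ord0.
    rewrite -/a a0 mxE => le0.
    have : (complex.Re ((W : 'M[R[i]]_(n + 1, r.+2)) k ord0) ^+ 2 +
           complex.Im ((W : 'M[R[i]]_(n + 1, r.+2)) k ord0) ^+ 2 == 0)%R.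
      by rewrite eq_le le0 addr_ge0 ?sqr_ge0.
    rewrite paddr_eq0 ?sqr_ge0// !sqrf_eq0 => /andP[x y].
    by apply/eqP; rewrite eq_complex x y.
  move=> aFp; have F0 : (0 <= F)%R by exact: fnorm2_ge0.
  have p0 : (0 < p)%R.
    by rewrite ltNge; apply/negP => p0; have := lt_le_trans a0 aFp; rewrite ltNge mulr_ge0_le0.
  rewrite /f lee_fin ger0_norm ?invr_ge0 ?(ltW p0)// -[leRHS]/(F / a)%R.
  by rewrite ler_pdivlMr// mulrC ler_pdivrMr.
have [G1 g1] := gaussian_exists R n r.+2; have [G2 g2] := gaussian_exists R 1 r.+2.
have -> : \int[G]_W f W = \int[law (prodP G1 G2) (@measurable_col_mx R n 1 r.+2)]_W f W.
  by apply: eq_measure_integral => S mS _; apply: gaussian_unique => //; exact: gaussian_col_mx.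
have mcol : measurable_fun setT (fun u : borelmx R n r.+2 * borelmx R 1 r.+2 =>
    f (col_mx (u.1 : 'M[R[i]]_(n, r.+2)) (u.2 : 'M[R[i]]_(1, r.+2)))).
  exact: measurableT_comp mf (@measurable_col_mx R n 1 r.+2).
rewrite ge0_integral_law// prodP_integral1//.
have fE (Y : borelmx R n r.+2) (w : borelmx R 1 r.+2) :
    f (col_mx (Y : 'M[R[i]]_(n, r.+2)) (w : 'M[R[i]]_(1, r.+2))) <=
    (fnorm2 (Y : 'M[R[i]]_(n, r.+2)))%:E * ((fnorm2 (w : 'M[R[i]]_(1, r.+2)))^-1)%:E + 1.
  rewrite /f.
  have -> : row k (col_mx (Y : 'M[R[i]]_(n, r.+2)) (w : 'M[R[i]]_(1, r.+2))) = w.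
    by apply/matrixP => i j; rewrite mxE col_mxEd; congr (_ _ _); rewrite !ord1.
  have -> : (fnorm2 (col_mx (Y : 'M[R[i]]_(n, r.+2)) (w : 'M[R[i]]_(1, r.+2))) = fnorm2 (Y : 'M[R[i]]_(n, r.+2)) + fnorm2 (w : 'M[R[i]]_(1, r.+2)))%R.
    rewrite !fnorm2E big_split_ord /=; congr (_ + _)%R; apply: eq_bigr => i _; apply: eq_bigr => j _.
      by rewrite col_mxEu.
    by rewrite col_mxEd.
  rewrite -EFinM -EFinD lee_fin mulrDl lerD2l.
  (* The quotient of [fnorm2 w] by itself is 1, or 0 when [w = 0]; hence an inequality. *)
  have [->|h] := eqVneq (fnorm2 (w : 'M[R[i]]_(1, r.+2))) 0%R; first by rewrite mul0r.
  by rewrite mulfV.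
have mi2 : measurable_fun setT (fun w : borelmx R 1 r.+2 => ((fnorm2 (w : 'M[R[i]]_(1, r.+2)))^-1)%:E).
  by apply/measurable_EFinP; apply: measurable_inv_fun; apply: measurable_fnorm2; exact: mmeas_id.
have i20 (w : borelmx R 1 r.+2) : 0 <= ((fnorm2 (w : 'M[R[i]]_(1, r.+2)))^-1)%:E by rewrite lee_fin invr_ge0 fnorm2_ge0.
have fin2 := gaussian_inv_sqnorm g2.
set c := \int[G2]_w _ in fin2.
have c0 : 0 <= c by exact: integral_ge0.
have m1 : measurable_fun setT (fun Y : borelmx R n r.+2 => (fnorm2 (Y : 'M[R[i]]_(n, r.+2)))%:E).
  by apply/measurable_EFinP; apply: measurable_fnorm2; exact: mmeas_id.
have i10 (Y : borelmx R n r.+2) : 0 <= (fnorm2 (Y : 'M[R[i]]_(n, r.+2)))%:E by rewrite lee_fin fnorm2_ge0.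
apply: (@le_lt_trans _ _ (\int[G1]_Y ((fnorm2 (Y : 'M[R[i]]_(n, r.+2)))%:E * c + 1))).
  apply: ge0_le_integral => //.
  - by move=> Y _; apply: integral_ge0 => w _; exact: f0.
  - exact: (measurable_integral_section G2 mcol (fun u => f0 _)).
  - apply: emeasurable_funD; last exact: measurable_cst.
    by apply: emeasurable_funM => //; exact: measurable_cst.
  move=> Y _.
  apply: (@le_trans _ _ (\int[G2]_w ((fnorm2 (Y : 'M[R[i]]_(n, r.+2)))%:E * ((fnorm2 (w : 'M[R[i]]_(1, r.+2)))^-1)%:E + 1))).
    have mY : measurable_fun setT (fun w : borelmx R 1 r.+2 => f (col_mx (Y : 'M[R[i]]_(n, r.+2)) (w : 'M[R[i]]_(1, r.+2)))).
      exact: (measurableT_comp (measurableT_comp mf (@measurable_col_mx R n 1 r.+2)) (pair1_measurable Y)).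
    apply: ge0_le_integral => //.
    apply: emeasurable_funD; last exact: measurable_cst.
    by apply: emeasurable_funM => //; exact: measurable_cst.
  rewrite ge0_integralD//; last 2 first.
  - by move=> w _; exact: mule_ge0 (i10 _) (i20 _).
  - by apply: emeasurable_funM => //; exact: measurable_cst.
  rewrite (ge0_integralZl G2 measurableT mi2 (fun w _ => i20 w) (i10 Y)).
  rewrite integral_cst//= (_ : G2 setT = 1) ?mule1//; exact: probability_setT.
rewrite ge0_integralD//; last 2 first.
- by move=> w _; exact: mule_ge0 (i10 _) c0.
- by apply: emeasurable_funM => //; exact: measurable_cst.
rewrite (ge0_integralZr G1 measurableT m1 (fun w _ => i10 w) c0) gaussian_fnorm2//.
rewrite integral_cst//= (_ : G1 setT = 1) ?mule1//; last exact: probability_setT.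
rewrite lte_add_pinfty ?ltry//; exact: lte_mul_pinfty.
Qed.

Lemma invgram_leverage n m (d : 'rV[R]_n) (c : R) (X : 'M[R[i]]_(n, m)) (y : 'rV[R[i]]_m) :
  (0 < c)%R -> (forall k, c <= d 0 k)%R -> fullrank X ->
  (complex.Re ((y *m invgram (cdiag d) X *m y ^t*) 0 0) <=
   c^-1 * `|(complex.Re ((1%:M - rproj (col_mx X y)) (rshift n ord0) (rshift n ord0)))^-1|)%R.
Proof.
move=> c0 cd fX; have d0 k : (0 < d 0 k)%R by exact: lt_le_trans c0 (cd k).
have pA : psd (X ^t* *m cdiag d *m X) by apply: psd_gram; apply: psd_cdiag => k; exact: ltW.
have uA := gram_cdiag_unit d0 fX.
have q (v : 'rV[R[i]]_m) : (c * complex.Re ((v *m (X ^t* *m X) *m v ^t*) 0 0) <=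
    complex.Re ((v *m (X ^t* *m cdiag d *m X) *m v ^t*) 0 0))%R.
  have -> : v *m (X ^t* *m cdiag d *m X) *m v ^t* = (v *m X ^t*) *m cdiag d *m (v *m X ^t*) ^t*.
    by rewrite adjM trmxCK !mulmxA.
  have -> : v *m (X ^t* *m X) *m v ^t* = (v *m X ^t*) *m (v *m X ^t*) ^t*.
    by rewrite adjM trmxCK !mulmxA.
  move: (v *m _) => x; rewrite quad_cdiag.
  have -> : (complex.Re ((x *m x ^t*) 0 0) = \sum_k sqmod (x 0 k))%R.
    by have := fnorm2E x; rewrite /fnorm2 /mxtrace !big_ord1.
  by rewrite mulr_sumr; apply: ler_sum => j _; apply: ler_wpM2r (cd j); exact: sqmod_ge0.
have h := psd_inv_antitone y c0 pA (gram_psd X) uA fX q.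
by rewrite ler_pdivlMl//; exact: le_trans h (le_trans (leverage_bound y fX) (ler_norm _)).
Qed.

Lemma gaussian_invgram_finite N L (G : probability (borelmx R N L) R) (d : 'rV[R]_N) :
  gaussian_ensemble G -> (L < N)%N -> (forall k, 0 < d 0 k)%R ->
  \int[G]_X (complex.Re (\tr (invgram (cdiag d) (X : 'M[R[i]]_(N, L)))))%:E < +oo.
Proof.
move=> gG LN d0; have [dm [dm0 dmd]] := lower_bound_pos d0.
have [g gg] := gaussian_exists R 1 L.
have pH (X : 'M[R[i]]_(N, L)) : psd (invgram (cdiag d) X).
  by apply: psd_invmx; apply: psd_gram; apply: psd_cdiag => k; exact: ltW.
(* The trace is replaced by the mean of the form at an independent Gaussian row [y], so that the
   pair [(X, y)] becomes a Gaussian matrix with one more row. *)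
under eq_integral => X _ do rewrite -(gaussian_quad 0%R gg (pH X)).
pose k := rshift N (ord0 : 'I_1).
pose F (p : borelmx R (N + 1) (N + 1)) : \bar R :=
  `|(complex.Re ((p : 'M[R[i]]_(N + 1)) k k))^-1|%:E.
have mF : measurable_fun setT F.
  apply/measurable_EFinP; apply: measurableT_comp => //; apply: measurable_inv_fun.
  by have [] := @mmeas_id R (N + 1) (N + 1) k k.
have F0 p : 0 <= F p by rewrite lee_fin.
have mcompl : measurable_fun setT (fun p : borelmx R (N + 1) (N + 1) =>
    (1%:M - (p : 'M[R[i]]_(N + 1)))%R : borelmx R (N + 1) (N + 1)).
  by apply: mmeas_measurable; apply: mmeasB; [exact: mmeas_cst|exact: mmeas_id].
pose Z (u : borelmx R N L * borelmx R 1 L) : 'M[R[i]]_(N + 1, L) :=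
  col_mx (u.1 : 'M[R[i]]_(N, L)) (u.2 : 'M[R[i]]_(1, L)).
have mZ : mmeas Z by apply: measurable_mmeas; exact: measurable_col_mx.
have mFZ : measurable_fun setT (fun u => F (1%:M - rproj (Z u))%R).
  by apply: (measurable_comp_mx mF); apply: mmeasB; [exact: mmeas_cst|exact: mmeas_rproj].
pose s (u : borelmx R N L * borelmx R 1 L) : \bar R :=
  (complex.Re (((u.2 : 'M[R[i]]_(1, L)) *m invgram (cdiag d) (u.1 : 'M[R[i]]_(N, L)) *m (u.2 : 'M[R[i]]_(1, L)) ^t*) 0%R 0%R))%:E.
have s0 u : 0 <= s u by rewrite lee_fin; have [_ h] := pH (u.1 : 'M[R[i]]_(N, L)); exact: h.
have mu1 : mmeas (fun u : borelmx R N L * borelmx R 1 L => (u.1 : 'M[R[i]]_(N, L))).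
  exact: (mmeas_comp (@mmeas_id R N L) measurable_fst).
have mu2 : mmeas (fun u : borelmx R N L * borelmx R 1 L => (u.2 : 'M[R[i]]_(1, L))).
  exact: (mmeas_comp (@mmeas_id R 1 L) measurable_snd).
have ms : measurable_fun setT s.
  apply/measurable_EFinP.
  have mI : mmeas (fun u : borelmx R N L * borelmx R 1 L => invgram (cdiag d) (u.1 : 'M[R[i]]_(N, L))).
    by apply: mmeas_invmx; apply: mmeasM => //; apply: mmeasM; [exact: mmeas_adj|exact: mmeas_cst].
  by have [] := mmeasM (mmeasM mu2 mI) (mmeas_adj mu2) 0%R 0%R.
apply: (@le_lt_trans _ _ (\int[G]_X \int[g]_y (dm^-1%:E * F (1%:M - rproj (Z (X, y)))%R))).
  apply: ae_ge0_le_integral => //.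
  - by move=> X _; apply: integral_ge0 => y _; exact: s0 (X, y).
  - exact: (measurable_integral_section g ms s0).
  - by move=> X _; apply: integral_ge0 => y _; rewrite mule_ge0// lee_fin invr_ge0 ltW.
  - apply: (measurable_integral_section g (f := fun u => dm^-1%:E * F (1%:M - rproj (Z u))%R)).
      by apply: measurable_funeM.
    by move=> u; rewrite mule_ge0// lee_fin invr_ge0 ltW.
  have [N1 [mN1 N10 sub1]] := gaussian_fullrank gG (ltnW LN).
  exists N1; split => //; apply: subset_trans sub1 => X /=; apply: contra_not => fX _.
  apply: ge0_le_integral => //.
  - by move=> y _; exact: s0 (X, y).
  - exact: (measurableT_comp ms (pair1_measurable X)).
  - by apply: measurable_funeM; exact: (measurableT_comp mFZ (pair1_measurable X)).
  move=> y _; rewrite /F -EFinM lee_fin.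
  exact: (invgram_leverage (y : 'M[R[i]]_(1, L)) dm0 dmd fX).
have gZ := gaussian_col_mx gG gg.
rewrite -(prodP_integral1 G g (f := fun u => dm^-1%:E * F (1%:M - rproj (Z u))%R)); last 2 first.
- by apply: measurable_funeM.
- by move=> u; rewrite mule_ge0// lee_fin invr_ge0 ltW.
rewrite (ge0_integralZl _ measurableT mFZ (fun u _ => F0 _)); last by rewrite lee_fin invr_ge0 ltW.
apply: lte_mul_pinfty => //; first by rewrite lee_fin invr_ge0 ltW.
pose Gam := law (prodP G g) (@measurable_col_mx R N 1 L).
have mFr : measurable_fun setT (fun p : borelmx R (N + 1) (N + 1) => F (1%:M - (p : 'M[R[i]]_(N + 1)))%R).
  exact: measurableT_comp mF mcompl.
have mFrr : measurable_fun setT (fun W : borelmx R (N + 1) L => F (1%:M - rproj (W : 'M[R[i]]_(N + 1, L)))%R).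
  exact: measurableT_comp mFr (@measurable_rproj R (N + 1) L).
have -> : \int[prodP G g]_u F (1%:M - rproj (Z u))%R =
    \int[Gam]_W F (1%:M - rproj (W : 'M[R[i]]_(N + 1, L)))%R.
  by rewrite (ge0_integral_law _ (@measurable_col_mx R N 1 L) mFrr).
rewrite -(ge0_integral_law Gam (@measurable_rproj R (N + 1) L) mFr)//.
rewrite -(ge0_integral_law _ mcompl mF)//.
(* [r.+2 = N + 1 - L] is the rank of the projector complementary to that of [(X; y)]. That it is at
   least 2 is the hypothesis [L < N]. *)
pose r := (N - L.+1)%N; have rE : (L + r.+2 = N + 1)%N by rewrite /r; lia.
have [GW gW] := gaussian_exists R (N + 1) r.+2.
have rn : (r.+2 <= N + 1)%N by rewrite -rE leq_addl.
have LN1 : (L <= N + 1)%N by rewrite -rE leq_addr.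
apply: le_lt_trans (gaussian_inv_leverage gW rn).
rewrite -(ge0_integral_law GW (@measurable_rproj R (N + 1) r.+2) mF)//.
rewrite le_eqVlt; apply/orP; left; apply/eqP; apply: eq_measure_integral => S mS _.
apply: (@projector_law_unique R _ r.+2) => //.
- apply: conj_invariant_compl; apply: conj_invariant_rproj; exact: gaussian_left_invariant.
- by apply: conj_invariant_rproj; exact: gaussian_left_invariant.
- apply: (@ae_law _ _ _ _ _ _ _ mcompl [set p : borelmx R (N + 1) (N + 1) | is_projector r.+2 (p : 'M[R[i]]_(N + 1))]).
    have [N1 [mN1 N10 sub1]] := ae_fullrank_projector (gaussian_fullrank gZ LN1).
    exists N1; split => //; apply: subset_trans sub1 => p /=; apply: contra_not.
    exact: is_projector_compl.
  exact: measurable_projector.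
- by apply: ae_fullrank_projector; exact: gaussian_fullrank.
Qed.

End invgram_finite.

(** * Transfer from Gaussian to Haar measures *)

Section transfer.
Context (R : realType).
Local Open Scope ereal_scope.

Lemma transfer_rproj n m (mu nu : probability (borelmx R n m) R) (F : borelmx R n n -> \bar R) :
  left_invariant mu -> left_invariant nu ->
  {ae mu, forall X, fullrank (X : 'M[R[i]]_(n, m))} ->
  {ae nu, forall X, fullrank (X : 'M[R[i]]_(n, m))} ->
  measurable_fun setT F -> (forall p, 0 <= F p) ->
  \int[mu]_X F (rproj (X : 'M[R[i]]_(n, m))) = \int[nu]_X F (rproj (X : 'M[R[i]]_(n, m))).
Proof.
move=> imu inu amu anu mF F0.
rewrite -(ge0_integral_law mu (@measurable_rproj R n m) mF)//.
rewrite -(ge0_integral_law nu (@measurable_rproj R n m) mF)//.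
apply: eq_measure_integral => S mS _; exact: (rproj_law_unique imu inu amu anu mS).
Qed.

Lemma mmeas_Lambda_integrand n m (D : 'M[R[i]]_n) :
  mmeas (fun X : borelmx R n m => Lambda_integrand D (X : 'M[R[i]]_(n, m))).
Proof.
have mi := @mmeas_id R n m.
have mI := mmeas_invmx (mmeasM (mmeasM (mmeas_adj mi) (mmeas_cst _ D)) mi).
exact: mmeasM (mmeasM mi mI) (mmeas_adj mi).
Qed.

Lemma mmeas_invgram n m (D : 'M[R[i]]_n) :
  mmeas (fun X : borelmx R n m => invgram D (X : 'M[R[i]]_(n, m))).
Proof.
have mi := @mmeas_id R n m.
exact: mmeas_invmx (mmeasM (mmeasM (mmeas_adj mi) (mmeas_cst _ D)) mi).
Qed.

Lemma psd_invgram n m (D : 'M[R[i]]_n) (X : 'M[R[i]]_(n, m)) : psd D -> psd (invgram D X).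
Proof. by move=> pD; apply: psd_invmx; exact: psd_gram. Qed.

Lemma psd_Lambda_integrand n m (D : 'M[R[i]]_n) (X : 'M[R[i]]_(n, m)) :
  psd D -> psd (Lambda_integrand D X).
Proof. by move=> pD; apply: psd_conj; exact: (psd_invgram X pD). Qed.

(** [D] need not be invertible, so full rank does not make the Gram matrix invertible. Almost sure
    invertibility under [nu] is expressed as [det C(p) <> 0] for the projector [p] and thereby
    passes to [mu]; the integrand is then [fproj D p] on both sides. *)
Lemma transfer_Lambda n m (mu nu : probability (borelmx R n m) R) (D : 'M[R[i]]_n) k :
  left_invariant mu -> left_invariant nu -> psd D ->
  {ae mu, forall X, fullrank (X : 'M[R[i]]_(n, m))} ->
  {ae nu, forall X, fullrank (X : 'M[R[i]]_(n, m))} ->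
  {ae nu, forall X, (X : 'M[R[i]]_(n, m)) ^t* *m D *m X \in unitmx} ->
  \int[mu]_X (complex.Re (Lambda_integrand D (X : 'M[R[i]]_(n, m)) k k))%:E =
  \int[nu]_X (complex.Re (Lambda_integrand D (X : 'M[R[i]]_(n, m)) k k))%:E.
Proof.
move=> imu inu pD amu anu unu.
pose C (p : 'M[R[i]]_n) := (p *m D *m p + 1%:M - p)%R.
have mC : measurable [set p : borelmx R n n | \det (C (p : 'M[R[i]]_n)) = 0%R].
  apply: cmeas_measurable_eq; last exact: cmeas_cst.
  have mi := @mmeas_id R n n.
  apply: cmeas_det; apply: mmeasB => //; apply: mmeasD; last exact: mmeas_cst.
  by apply: mmeasM => //; apply: mmeasM => //; exact: mmeas_cst.
have umu : {ae mu, forall X, (X : 'M[R[i]]_(n, m)) ^t* *m D *m X \in unitmx}.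
  have E0 := rproj_law_unique imu inu amu anu mC.
  have nu0 : nu [set X | \det (C (rproj (X : 'M[R[i]]_(n, m)))) = 0%R] = 0.
    have mS := measurable_preimage (@measurable_rproj R n m) mC.
    rewrite -[X in nu X]setCK; apply: ae_measure0; first exact: measurableC.
    apply: ae_imply2 anu unu _ => X fX uX /=.
    by have [+ _] := fproj_rproj fX uX; rewrite unitmxE unitfE => /eqP.
  have : {ae mu, forall X, \det (C (rproj (X : 'M[R[i]]_(n, m)))) <> 0%R}.
    exists [set X | \det (C (rproj (X : 'M[R[i]]_(n, m)))) = 0%R]; split.
    - exact: measurable_preimage (@measurable_rproj R n m) mC.
    - by apply: etrans E0 _; exact: nu0.
    - by move=> X /=; rewrite not_notE.
  move=> h; apply: ae_imply2 amu h _ => X fX dX; apply: fproj_unit_gram => //.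
  by rewrite unitmxE unitfE; exact/eqP.
(* The absolute value makes [F] nonnegative at every matrix; it leaves the diagonal entries of the
   integrand, already nonnegative, unchanged. *)
pose F (p : borelmx R n n) : \bar R := `|complex.Re (fproj D (p : 'M[R[i]]_n) k k)|%:E.
have mF : measurable_fun setT F.
  apply/measurable_EFinP; apply: measurableT_comp => //.
  by have [] := mmeas_fproj D (@mmeas_id R n n) k k.
have F0 p : 0 <= F p by rewrite lee_fin.
have E (m1 : probability (borelmx R n m) R) :
    {ae m1, forall X, fullrank (X : 'M[R[i]]_(n, m))} ->
    {ae m1, forall X, (X : 'M[R[i]]_(n, m)) ^t* *m D *m X \in unitmx} ->
    \int[m1]_X (complex.Re (Lambda_integrand D (X : 'M[R[i]]_(n, m)) k k))%:E =
    \int[m1]_X F (rproj (X : 'M[R[i]]_(n, m))).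
  move=> a1 a2; apply: ge0_ae_eq_integral => //.
  - by apply/measurable_EFinP; have [] := @mmeas_Lambda_integrand n m D k k.
  - exact: measurableT_comp mF (@measurable_rproj R n m).
  - by move=> X _; rewrite lee_fin; have [] := psd_diag k (psd_Lambda_integrand (X : 'M[R[i]]_(n, m)) pD).
  apply: ae_imply2 a1 a2 _ => X fX uX _.
  rewrite /F; have [_ ->] := fproj_rproj fX uX; rewrite ger0_norm//.
  by have [] := psd_diag k (psd_Lambda_integrand (X : 'M[R[i]]_(n, m)) pD).
rewrite (E mu amu umu) (E nu anu unu); exact: (transfer_rproj imu inu amu anu mF F0).
Qed.

Lemma fullrank_gram_unit n m (mu : probability (borelmx R n m) R) (d : 'rV[R]_n) :
  (forall k, 0 < d 0 k)%R -> {ae mu, forall X, fullrank (X : 'M[R[i]]_(n, m))} ->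
  {ae mu, forall X, (X : 'M[R[i]]_(n, m)) ^t* *m cdiag d *m X \in unitmx}.
Proof. by move=> d0 amu; apply: ae_imply amu _ => X; exact: gram_cdiag_unit. Qed.

(** [s] exchanges the positive and negative parts of [h], so their integrals agree. If both are
    infinite, the difference is [-oo] by convention and [fine] sends it to 0; this covers
    off-diagonal entries in the case [L = N]. *)
Lemma antisymmetric_integral d (T : measurableType d) (P : probability T R) (h : T -> R)
    (s : T -> T) : measurable_fun setT h -> measurable_fun setT s ->
  (forall B, measurable B -> P [set w | B (s w)] = P B) -> (forall w, h (s w) = - h w)%R ->
  fine (\int[P]_w (h w)%:E) = 0%R.
Proof.
move=> mh ms sP hs.
pose hE w := (h w)%:E.
have mhE : measurable_fun setT hE by apply/measurable_EFinP.
rewrite [integral _ _ _](integralE P setT hE).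
have -> : \int[P]_w hE^\- w = \int[P]_w hE^\+ w.
  have -> : \int[P]_w hE^\+ w = \int[law P ms]_w hE^\+ w.
    apply: eq_measure_integral => B mB _; apply/esym; exact: sP.
  rewrite ge0_integral_law//; last exact: measurable_funepos.
  by apply: eq_integral => w _; rewrite funenegE funeposE /hE hs EFinN.
by case: (\int[P]_w hE^\+ w) => [r| |] //=; rewrite subrr.
Qed.

Lemma mxintegrable_psd d (T : measurableType d) (P : probability T R) n (f : T -> 'M[R[i]]_n) :
  mmeas f -> (forall w, psd (f w)) ->
  (forall k, \int[P]_w (complex.Re (f w k k))%:E < +oo) -> mxintegrable P f.
Proof.
move=> mf pf fin i j.
have mRe k l : measurable_fun setT (fun w => complex.Re (f w k l)) by have [] := mf k l.
have mIm k l : measurable_fun setT (fun w => complex.Im (f w k l)) by have [] := mf k l.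
have R0 w k : (0 <= complex.Re (f w k k))%R by have [] := psd_diag k (pf w).
have iD k : P.-integrable setT (fun w => (complex.Re (f w k k))%:E).
  apply/integrableP; split; first exact/measurable_EFinP.
  by under eq_integral do rewrite gee0_abs ?lee_fin//.
have iS : P.-integrable setT (fun w => (complex.Re (f w i i))%:E + (complex.Re (f w j j))%:E).
  exact: integrableD.
split; apply: (le_integrable measurableT _ _ iS).
- exact/measurable_EFinP.
- move=> w _; have [h _] := psd_offdiag i j (pf w).
  by rewrite -EFinD /= lee_fin [leRHS]ger0_norm// addr_ge0.
- exact/measurable_EFinP.
- move=> w _; have [_ h] := psd_offdiag i j (pf w).
  by rewrite -EFinD /= lee_fin [leRHS]ger0_norm// addr_ge0.
Qed.

(** The integrand [B] satisfies [B D B = B]. At the entry [(k, k)] this says that the sum of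
    [d_j |B_kj|^2] is [B_kk]; keeping only [j = k] gives [d_k B_kk^2 <= B_kk]. *)
Lemma Lambda_diag_bound n m (d : 'rV[R]_n) (X : 'M[R[i]]_(n, m)) k :
  (forall k, 0 < d 0 k)%R -> fullrank X ->
  (complex.Re (Lambda_integrand (cdiag d) X k k) <= (d 0 k)^-1)%R.
Proof.
move=> d0 fX; have uA := gram_cdiag_unit d0 fX.
have pA : psd (X ^t* *m cdiag d *m X) by apply: psd_gram; apply: psd_cdiag => j; exact: ltW.
have Ia : (invmx (X ^t* *m cdiag d *m X)) ^t* = invmx (X ^t* *m cdiag d *m X).
  by have [] := psd_invmx pA.
rewrite /Lambda_integrand.
move: (mulmxV uA) (mulVmx uA) Ia; move: (invmx _) => I AI IA Ia.
pose B := X *m I *m X ^t*.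
have BDB : B *m cdiag d *m B ^t* = B.
  have Ba : B ^t* = B by rewrite /B !adjM trmxCK Ia mulmxA.
  rewrite Ba /B; rewrite -[X *m I *m X ^t* *m _ *m _]mulmxA.
  have -> : cdiag d *m (X *m I *m X ^t*) = (cdiag d *m X) *m (I *m X ^t*) by rewrite !mulmxA.
  rewrite -(mulmxA (X *m I)) (mulmxA (X ^t*)) (mulmxA (X ^t*) (cdiag d)).
  by rewrite -(mulmxA X) (mulmxA I) IA mul1mx mulmxA.
have := quad_cdiag d (row k B).
have -> : (row k B *m cdiag d *m (row k B) ^t*) 0%R 0%R = B k k.
  rewrite -[in RHS]BDB -row_mul !mxE; apply: eq_bigr => l _; by rewrite !mxE.
have rk : (row k B 0 k = B k k)%R by rewrite mxE.
rewrite -/B (bigD1 k)//= rk => h.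
have s0 : (0 <= \sum_(j < n | j != k) d 0 j * (complex.Re (row k B 0 j) ^+ 2 + complex.Im (row k B 0 j) ^+ 2))%R.
  by apply: sumr_ge0 => j _; rewrite mulr_ge0 ?(ltW (d0 j))// addr_ge0 ?sqr_ge0.
have h2 : (d 0 k * complex.Re (B k k) ^+ 2 <= complex.Re (B k k))%R.
  rewrite [leRHS]h mulrDr -[leLHS]addr0 -addrA; apply: lerD; first exact: lexx.
  by apply: addr_ge0 => //; rewrite mulr_ge0 ?sqr_ge0 ?(ltW (d0 k)).
have [b0|b0] := leP (complex.Re (B k k)) 0%R.
  by apply: le_trans b0 _; rewrite invr_ge0 ltW.
move: h2; rewrite expr2 mulrA -[leRHS]mul1r ler_pM2r// => h2.
by rewrite -[leRHS]mul1r ler_pdivlMr// mulrC.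
Qed.

Lemma Lambda_diag_finite n m (mu : probability (borelmx R n m) R) (d : 'rV[R]_n) k :
  (forall k, 0 < d 0 k)%R -> {ae mu, forall X, fullrank (X : 'M[R[i]]_(n, m))} ->
  \int[mu]_X (complex.Re (Lambda_integrand (cdiag d) (X : 'M[R[i]]_(n, m)) k k))%:E < +oo.
Proof.
move=> d0 amu; have pD : psd (cdiag d) by apply: psd_cdiag => j; exact: ltW.
apply: (@le_lt_trans _ _ (\int[mu]_X ((d 0 k)^-1)%:E)).
  apply: ae_ge0_le_integral => //.
  - by move=> X _; rewrite lee_fin; have [] := psd_diag k (psd_Lambda_integrand (X : 'M[R[i]]_(n, m)) pD).
  - by apply/measurable_EFinP; have [] := @mmeas_Lambda_integrand n m (cdiag d) k k.
  - by move=> X _; rewrite lee_fin invr_ge0 ltW.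
  by apply: ae_imply amu _ => X fX _; rewrite lee_fin; exact: Lambda_diag_bound.
by rewrite integral_cst//= (_ : mu setT = 1) ?mule1 ?ltry//; exact: probability_setT.
Qed.

Lemma invmx_conj n (U A : 'M[R[i]]_n) : U \is unitarymx ->
  invmx (U ^t* *m A *m U) = U ^t* *m invmx A *m U.
Proof.
move=> uU; have uUm := unitarymx_unit uU.
have uV : U ^t* \in unitmx by apply: unitarymx_unit; rewrite trmxC_unitary.
have [uA|nA] := boolP (A \in unitmx).
  rewrite !invmxM ?unitmx_mul ?uV// -(invmx_unitary uU) invmxK mulmxA //.
by rewrite /invmx !unitmx_mul uV uUm /= andbT (negbTE nA).
Qed.

Lemma invgram_mulr n m (D : 'M[R[i]]_n) (X : 'M[R[i]]_(n, m)) (U : 'M[R[i]]_m) :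
  U \is unitarymx -> invgram D (X *m U) = U ^t* *m invgram D X *m U.
Proof.
move=> uU; rewrite /invgram adjM -(invmx_conj _ uU); congr invmx.
by rewrite !mulmxA.
Qed.

Lemma tperm_mx_unitary n (i j : 'I_n) : (tperm_mx i j : 'M[R[i]]_n) \is unitarymx.
Proof.
apply/unitarymxP.
have -> : (tperm_mx i j : 'M[R[i]]_n) ^t* = tperm_mx i j.
  rewrite /tperm_mx tr_perm_mx perm.tpermV; apply/matrixP => a b; rewrite !mxE; exact: conjC_nat.
by rewrite -perm_mxM perm.tperm2 perm_mx1.
Qed.

(** Exchanging two columns of [X] preserves its law. As a consequence the diagonal means are all
    finite or all infinite, which [mu_emu] uses to compare a sum of [fine] values with the [fine] of
    a sum. *)
Lemma gaussian_invgram_diag n m (G : probability (borelmx R n m) R) (D : 'M[R[i]]_n) l l' :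
  gaussian_ensemble G -> psd D ->
  \int[G]_X (complex.Re (invgram D (X : 'M[R[i]]_(n, m)) l l))%:E =
  \int[G]_X (complex.Re (invgram D (X : 'M[R[i]]_(n, m)) l' l'))%:E.
Proof.
move=> gG pD; pose F (X : borelmx R n m) := (complex.Re (invgram D (X : 'M[R[i]]_(n, m)) l l))%:E.
have mF : measurable_fun setT F.
  by apply/measurable_EFinP; have [] := @mmeas_invgram n m D l l.
have F0 X : 0 <= F X by rewrite lee_fin; have [] := psd_diag l (psd_invgram (X : 'M[R[i]]_(n, m)) pD).
rewrite -[LHS](gaussian_right_unitary gG (tperm_mx_unitary l l') mF F0).
apply: eq_integral => X _; rewrite /F invgram_mulr ?tperm_mx_unitary//.
congr ((complex.Re _)%:E).
have -> : (tperm_mx l l' : 'M[R[i]]_m) ^t* = tperm_mx l l'.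
  rewrite /tperm_mx tr_perm_mx perm.tpermV; apply/matrixP => a b; rewrite !mxE; exact: conjC_nat.
by rewrite -xrowE -xcolE !mxE perm.tpermL.
Qed.

Lemma emu_trace n m (G : probability (borelmx R n m) R) (D : 'M[R[i]]_n) : psd D ->
  emu G D = \int[G]_X (complex.Re (\tr (invgram D (X : 'M[R[i]]_(n, m)))))%:E.
Proof.
move=> pD; under [RHS]eq_integral do rewrite /mxtrace Re_sum -sumEFin.
rewrite ge0_integral_sum//; last 2 first.
- by move=> l; apply/measurable_EFinP; have [] := @mmeas_invgram n m D l l.
- by move=> l X _; rewrite lee_fin; have [] := psd_diag l (psd_invgram (X : 'M[R[i]]_(n, m)) pD).
by apply: eq_bigr => l _; rewrite unlock.
Qed.

(* When [L = N] both sides are [fine +oo = 0]. *)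
Lemma mu_emu n m (G : probability (borelmx R n m) R) (D : 'M[R[i]]_n) : (0 < m)%N ->
  gaussian_ensemble G -> psd D -> mu G D = (fine (emu G D))%:C.
Proof.
case: m G => // m G _ gG pD.
have im0 l : 'E_G[fun X => complex.Im (invgram D (X : 'M[R[i]]_(n, m.+1)) l l)] = 0.
  rewrite unlock; apply: integral0_eq => X _.
  by have [_ ->] := psd_diag l (psd_invgram (X : 'M[R[i]]_(n, m.+1)) pD).
pose e := 'E_G[fun X => complex.Re (invgram D (X : 'M[R[i]]_(n, m.+1)) ord0 ord0)].
have re l : 'E_G[fun X => complex.Re (invgram D (X : 'M[R[i]]_(n, m.+1)) l l)] = e.
  by rewrite /e unlock; exact: gaussian_invgram_diag.
have e0 : 0 <= e.
  rewrite /e unlock; apply: integral_ge0 => X _; rewrite lee_fin.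
  by have [] := psd_diag ord0 (psd_invgram (X : 'M[R[i]]_(n, m.+1)) pD).
have -> : mu G D = (\sum_(l < m.+1) (fine e)%:C)%R.
  by apply: eq_bigr => l _; rewrite mxE /cexp re im0.
have -> : emu G D = \sum_(l < m.+1) e by apply: eq_bigr => l _; exact: re.
case: e e0 {re} => [r| |] // _.
  by rewrite sumEFin /= rmorph_sum.
have -> : \sum_(l < m.+1) (+oo : \bar R) = +oo.
  rewrite big_ord_recl addye// gt_eqF//; apply: (@lt_le_trans _ _ 0); first exact: ltNy0.
  by apply: sume_ge0 => *; exact: le0y.
by rewrite /= big1.
Qed.

End transfer.

(** * Trace of the logarithm *)

Section mxlog_trace.
Context (R : realType).

Lemma ln_prod (I : finType) (s : I -> R) : (forall l, 0 < s l) ->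
  ln (\prod_l s l) = \sum_l ln (s l).
Proof.
move=> s0; suff : 0 < \prod_l s l /\ ln (\prod_l s l) = \sum_l ln (s l) by case.
apply: (big_rec2 (fun p t => 0 < p /\ ln p = t)); first by rewrite ln1.
by move=> l p t _ [p0 <-]; rewrite mulr_gt0 ?s0// lnM ?posrE ?s0.
Qed.

Lemma det_unitary_conj n (P : 'M[R[i]]_n) (s : 'rV[R]_n) : P \is unitarymx ->
  \det (P ^t* *m cdiag s *m P) = (\prod_l s 0 l)%:C.
Proof.
move=> uP; rewrite !det_mulmx mulrAC -det_mulmx (unitary_mulK uP) det1 mul1r det_diag.
by rewrite rmorph_prod; apply: eq_bigr => l _; rewrite mxE.
Qed.

Lemma psd_eigen n (H : 'M[R[i]]_n) : psd H -> exists (P : 'M[R[i]]_n) (s : 'rV[R]_n),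
  [/\ P \is unitarymx, H = P ^t* *m cdiag s *m P, forall l, 0 <= s 0 l &
      \tr (mxlog H) = (\sum_l ln (s 0 l))%:C].
Proof.
move=> pH; have [P [s [uP HE sp sd s0]]] := psd_spectral pH.
exists P, s; split => //.
rewrite /mxlog sp sd -mulmxA mxtrace_mulC -mulmxA mulmxV ?unitarymx_unit// mulmx1.
by rewrite mxtrace_diag rmorph_sum; apply: eq_bigr => l _; rewrite !mxE.
Qed.

Lemma tr_mxlog_det n (H : 'M[R[i]]_n) : psd H -> H \in unitmx ->
  [/\ \tr (mxlog H) = (ln (complex.Re (\det H)))%:C, 0 < complex.Re (\det H) &
      \det H = (complex.Re (\det H))%:C].
Proof.
move=> pH; have [P [s [uP -> s0 ->]]] := psd_eigen pH.
rewrite unitmxE unitfE det_unitary_conj //= => nz.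
have sp l : 0 < s 0 l.
  rewrite lt_neqAle s0 andbT eq_sym; apply: contraNneq nz => sl.
  by rewrite (bigD1 l)//= sl mul0r.
by rewrite -ln_prod//; split => //; apply: prodr_gt0 => l _; exact: sp.
Qed.

Lemma unitary_conj_poly n (P : 'M[R[i]]_n) (s : 'rV[R]_n) (e : R) : P \is unitarymx ->
  let H := P ^t* *m cdiag s *m P in
  (H + (e%:C)%:M = P ^t* *m cdiag (\row_l (s 0 l + e)) *m P) *
  (H *m H + e%:C *: H + (e%:C)%:M =
   P ^t* *m cdiag (\row_l (s 0 l * s 0 l + e * s 0 l + e)) *m P).
Proof.
move=> uP H.
have eE : (e%:C)%:M = P ^t* *m (e%:C)%:M *m P.
  by rewrite mul_mx_scalar -scalemxAl (unitary_mulK uP) scalemx1.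
have HH : H *m H = P ^t* *m (cdiag s *m cdiag s) *m P.
  by rewrite /H !mulmxA mulmxtVK.
split.
  rewrite eE -mulmxDl -mulmxDr; congr (_ *m _ *m _).
  by apply/matrixP => a b; rewrite !mxE; case: eqP => [->|_]; rewrite ?mulr1n ?mulr0n ?addr0// rmorphD.
rewrite HH eE /H scalemxAl scalemxAr -!mulmxDl -!mulmxDr; congr (_ *m _ *m _).
rewrite /cdiag mulmx_diag; apply/matrixP => a b; rewrite !mxE.
by case: eqP => [->|_]; rewrite ?mulr1n ?mulr0n ?mulr0 ?addr0// !rmorphD !rmorphM.
Qed.

(* An eigenvalue [s] contributes [ln (s + e / (s + e))], which tends to [ln s]
   if [0 < s], and equals [ln 1 = 0] if [s = 0], where also [ln 0 = 0]. *)
Definition mxlog_approx n (e : R) (H : 'M[R[i]]_n) : R :=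
  ln (complex.Re (\det (H *m H + e%:C *: H + (e%:C)%:M))) -
  ln (complex.Re (\det (H + (e%:C)%:M))).

Lemma mxlog_approx_cvg n (H : 'M[R[i]]_n) : psd H ->
  mxlog_approx (harmonic k) H @[k --> \oo] --> complex.Re (\tr (mxlog H)).
Proof.
move=> pH; have [P [s [uP HE s0 ->]]] := psd_eigen pH => /=.
pose u l (e : R) := ln (s 0 l * s 0 l + e * s 0 l + e) - ln (s 0 l + e).
have -> : (fun k => mxlog_approx (harmonic k) H) = (fun k => \sum_l u l (harmonic k)).
  apply/funext => k; have e0 := @harmonic_gt0 R k; move: (harmonic k) e0 => e e0.
  rewrite /mxlog_approx HE !(unitary_conj_poly s e uP) !(det_unitary_conj _ uP) /=.
  rewrite !ln_prod; last 2 first.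
  - by move=> l; rewrite mxE ltr_wpDl.
  - by move=> l; rewrite mxE ltr_wpDl// addr_ge0 ?mulr_ge0// ltW.
  by rewrite -sumrB; apply: eq_bigr => l _; rewrite !mxE.
apply: cvg_big => [|l _]; first exact: add_continuous.
have h0 := @cvg_harmonic R.
have [sl|sl] := eqVneq (s 0 l) 0.
  rewrite /u sl (@ln0 R 0)//; under eq_fun do rewrite !mulr0 !add0r subrr.
  exact: cvg_cst.
have {}sl : 0 < s 0 l by rewrite lt_neqAle eq_sym sl s0.
have -> : ln (s 0 l) = ln (s 0 l * s 0 l + 0 * s 0 l + 0) - ln (s 0 l + 0).
  by rewrite mul0r !addr0 lnM ?posrE// addrK.
apply: cvgB; apply: continuous_cvg.
- by apply: continuous_ln; rewrite mul0r !addr0 mulr_gt0.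
- apply: (cvgD _ h0); apply: cvgD; first exact: cvg_cst.
  by apply: (cvgM h0); exact: cvg_cst.
- by apply: continuous_ln; rewrite addr0.
- by apply: (cvgD _ h0); exact: cvg_cst.
Qed.

(** The eigenbasis in [mxlog] is selected without any measurability. The approximations involve only
    determinants, and they converge at every positive semidefinite matrix, singular ones
    included. *)
Lemma measurable_tr_mxlog d (T : measurableType d) n (f : T -> 'M[R[i]]_n) :
  mmeas f -> (forall w, psd (f w)) ->
  measurable_fun setT (fun w => complex.Re (\tr (mxlog (f w)))).
Proof.
move=> mf pf; apply: (measurable_fun_cvg (h := fun k w => mxlog_approx (harmonic k) (f w))).
  move=> k; rewrite /mxlog_approx; move: (harmonic k) => e.
  have mH : mmeas (fun w => f w *m f w + e%:C *: f w + (e%:C)%:M).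
    by apply: mmeasD (mmeas_cst _ _); apply: mmeasD (mmeasM mf mf) (mmeasZ (cmeas_cst _ _) mf).
  have mE : mmeas (fun w => f w + (e%:C)%:M) by exact: mmeasD mf (mmeas_cst _ _).
  have [m1 _] := cmeas_det mH; have [m2 _] := cmeas_det mE.
  by apply: measurable_funB; [exact: measurableT_comp m1|exact: measurableT_comp m2].
by move=> w _; exact: mxlog_approx_cvg.
Qed.

Lemma det_add_rank1 n (A : 'M[R[i]]_n) (u : 'cV[R[i]]_n) (v : 'rV[R[i]]_n) : A \in unitmx ->
  \det (A + u *m v) = \det A * (1 + (v *m invmx A *m u) 0 0).
Proof.
move=> uA; have D1 w (x : 'rV[R[i]]_n) : \det (1%:M + w *m x) = 1 + (x *m w) 0 0.
  (* [B T] and [T B] are block triangular with the same determinant; one shows [1 + w x], the other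
     the scalar [1 + x w]. *)
  pose B : 'M[R[i]]_(n + 1) := block_mx 1%:M w (- x) 1%:M.
  pose T : 'M[R[i]]_(n + 1) := block_mx 1%:M 0 x 1%:M.
  have T1 : \det T = 1 by rewrite det_lblock !det1 mulr1.
  have E1 : B *m T = block_mx (1%:M + w *m x) w 0 1%:M.
    by rewrite mulmx_block !(mul1mx, mulmx1, mul0mx, mulmx0, addr0, add0r) addNr.
  have E2 : T *m B = block_mx 1%:M w 0 (x *m w + 1%:M).
    by rewrite mulmx_block !(mul1mx, mulmx1, mul0mx, mulmx0, addr0, add0r) subrr.
  have := congr1 determinant E1; rewrite det_ublock det1 mulr1 => <-.
  have := congr1 determinant E2; rewrite det_ublock det1 mul1r det_mx11 !det_mulmx mulrC => ->.
  by rewrite !mxE mulr1n addrC.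
have -> : A + u *m v = A *m (1%:M + invmx A *m u *m v).
  by rewrite mulmxDr mulmx1 !mulmxA mulmxV// mul1mx.
by rewrite det_mulmx D1 !mulmxA.
Qed.

Lemma trlog_det N L (d : 'rV[R]_N) (Phi : 'M[R[i]]_(N, L)) : (forall k, 0 < d 0 k) ->
  fullrank Phi ->
  let A := Phi ^t* *m cdiag d *m Phi in
  [/\ trlog_integrand (cdiag d) Phi = (ln (complex.Re (\det A)))%:C,
      0 < complex.Re (\det A) & \det A = (complex.Re (\det A))%:C].
Proof.
move=> d0 fP A; have pA : psd A by apply: psd_gram; apply: psd_cdiag => k; exact: ltW.
have [h1 h2 h3] := tr_mxlog_det pA (gram_cdiag_unit d0 fP); by split.
Qed.

(** Each eigenvalue of the compression is a mean of the [d_k] with weights [|v_k|^2], for a unit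
    vector [v], hence lies in [[a, b]]. *)
Lemma trlog_bound N L (d : 'rV[R]_N) (Phi : 'M[R[i]]_(N, L)) (a b : R) : 0 < a ->
  (forall k, a <= d 0 k <= b) -> Phi ^t* *m Phi = 1%:M ->
  `|complex.Re (trlog_integrand (cdiag d) Phi)| <= L%:R * (`|ln a| + `|ln b|).
Proof.
move=> a0 dab iP.
have pA : psd (Phi ^t* *m cdiag d *m Phi).
  apply: psd_gram; apply: psd_cdiag => k; have /andP[h _] := dab k; exact: le_trans (ltW a0) h.
rewrite /trlog_integrand.
have [P [s [uP HE s0 ->]]] := psd_eigen pA => /=.
have bnd l : `|ln (s 0 l)| <= `|ln a| + `|ln b|.
  pose B := P *m Phi ^t*; pose v := row l B.
  have q (C : 'M[R[i]]_N) : (v *m C *m v ^t*) 0 0 = (B *m C *m B ^t*) l l.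
    by rewrite /v -row_mul !mxE; apply: eq_bigr => j _; rewrite !mxE.
  have Ba : B ^t* = Phi *m P ^t* by rewrite /B adjM trmxCK.
  have sv : s 0 l = \sum_k d 0 k * (complex.Re (v 0 k) ^+ 2 + complex.Im (v 0 k) ^+ 2).
    rewrite -quad_cdiag q Ba.
    have -> : B *m cdiag d *m (Phi *m P ^t*) = cdiag s.
      have -> : B *m cdiag d *m (Phi *m P ^t*) = P *m (Phi ^t* *m cdiag d *m Phi) *m P ^t*.
        by rewrite /B !mulmxA.
      by rewrite HE !mulmxA (unitarymxP uP) mul1mx -mulmxA (unitarymxP uP) mulmx1.
    by rewrite !mxE eqxx mulr1n.
  have nv : \sum_k (complex.Re (v 0 k) ^+ 2 + complex.Im (v 0 k) ^+ 2) = 1.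
    have := quad_cdiag (const_mx 1) v.
    have -> : cdiag (const_mx 1 : 'rV[R]_N) = 1%:M.
      by apply/matrixP => x y; rewrite !mxE.
    under [in X in _ = X]eq_bigr do rewrite mxE mul1r.
    move=> <-; rewrite q Ba mulmx1 /B -mulmxA (mulmxA (Phi ^t*)) iP mul1mx (unitarymxP uP).
    by rewrite mxE eqxx.
  have sa : a <= s 0 l.
    rewrite sv -[leLHS]mulr1 -nv mulr_sumr; apply: ler_sum => k _; have /andP[h _] := dab k.
    by rewrite ler_wpM2r// addr_ge0 ?sqr_ge0.
  have sb : s 0 l <= b.
    rewrite sv -[leRHS]mulr1 -nv mulr_sumr; apply: ler_sum => k _; have /andP[_ h] := dab k.
    by rewrite ler_wpM2r// addr_ge0 ?sqr_ge0.
  have sp : 0 < s 0 l by exact: lt_le_trans a0 sa.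
  have la : ln a <= ln (s 0 l) by rewrite ler_ln ?posrE.
  have lb : ln (s 0 l) <= ln b by rewrite ler_ln ?posrE// (lt_le_trans sp).
  have := ler_norm (ln b); have := ler_norm (- ln a); rewrite normrN => h1 h2.
  have := normr_ge0 (ln b); have := normr_ge0 (ln a); rewrite ler_norml; lra.
apply: le_trans (ler_norm_sum _ _ _) _.
apply: le_trans (ler_sum _ (fun l _ => bnd l)) _.
by rewrite sumr_const card_ord mulr_natl.
Qed.

End mxlog_trace.

(** * Differentiation through a uniform Taylor remainder *)

Section trlog_derivative.
Context (R : realType).

Lemma ae_bounded_integrable d (T : measurableType d) (P : probability T R) (f : T -> R) c :
  measurable_fun setT f -> {ae P, forall w, `|f w| <= c} -> P.-integrable setT (EFin \o f).
Proof.
move=> mf fc; apply/integrableP; split; first exact/measurable_EFinP.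
apply: (@le_lt_trans _ _ (\int[P]_w (`|c|)%:E)%E).
  apply: ae_ge0_le_integral => //.
  - by apply: measurableT_comp => //; exact/measurable_EFinP.
  by apply: ae_imply fc _ => w h _; rewrite /= lee_fin (le_trans h)// ler_norm.
by rewrite integral_cst//= (_ : P setT = 1%E) ?mule1 ?ltry//; exact: probability_setT.
Qed.

Lemma fine_integral_taylor d (T : measurableType d) (P : probability T R) (f g h : T -> R) t c :
  P.-integrable setT (EFin \o f) -> P.-integrable setT (EFin \o g) ->
  P.-integrable setT (EFin \o h) -> 0 <= c ->
  {ae P, forall w, `|f w - g w - t * h w| <= c} ->
  `|fine (\int[P]_w (f w)%:E) - fine (\int[P]_w (g w)%:E) - t * fine (\int[P]_w (h w)%:E)| <= c.
Proof.
move=> fi gi hi c0 ac.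
have fgi : P.-integrable setT (EFin \o (fun w => f w - g w)) by exact: (integrableB measurableT fi gi).
have thi : P.-integrable setT (EFin \o (fun w => t * h w)) by exact: (integrableZl measurableT t hi).
have wi : P.-integrable setT (EFin \o (fun w => f w - g w - t * h w)).
  exact: (integrableB measurableT fgi thi).
have := le_normr_Rintegral measurableT wi.
rewrite (RintegralB measurableT fgi thi) (RintegralB measurableT fi gi) (RintegralZl t measurableT hi).
move=> h1; apply: le_trans h1 _.
have nwi : P.-integrable setT (EFin \o (fun w => `|f w - g w - t * h w|)).
  exact: (integrable_norm wi).
have ci : (\int[P]_w (c%:E) = c%:E)%E.
  by rewrite integral_cst//= (_ : P setT = 1%E) ?mule1 ?ltry//; exact: probability_setT.
rewrite -lee_fin /Rintegral fineK; last exact: integrable_fin_num.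
rewrite -ci; apply: ae_ge0_le_integral => //.
- by have /integrableP[] := nwi.
- by apply: ae_imply ac _ => w hw _; rewrite lee_fin.
Qed.

(** Both sides follow from [ln (1 + y) <= y], the lower one applied to [1 / (1 + x)]. The constant 2
    bounds [1 / (1 + x)] for [x >= -1/2]. *)
Lemma ln1D_taylor (x : R) : `|x| <= 2^-1 -> `|ln (1 + x) - x| <= 2 * x ^+ 2.
Proof.
rewrite ler_norml => /andP[x1 x2].
have p : 0 < 1 + x by lra.
have h1 : ln (1 + x) <= x by apply: le_ln1Dx; lra.
have h2 : - ln (1 + x) <= - x + 2 * x ^+ 2.
  rewrite -lnV ?posrE//.
  have -> : (1 + x)^-1 = 1 + ((1 + x)^-1 - 1) by rewrite addrCA subrr addr0.
  apply: le_trans (le_ln1Dx _) _; first by rewrite ltrBrDl subrr invr_gt0.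
  have -> : (1 + x)^-1 - 1 = - x + x ^+ 2 * (1 + x)^-1.
    by field; rewrite gt_eqF.
  rewrite lerD2l mulrC ler_wpM2r ?sqr_ge0//.
  by rewrite -[leRHS]invrK lef_pV2 ?posrE ?invr_gt0//; lra.
by rewrite ler_norml; apply/andP; split; [lra|have := sqr_ge0 x; lra].
Qed.

Lemma derivable_taylor (V : normedModType R) (F : V -> R^o) (a v : V) (l r C : R) : 0 < r ->
  (forall t, `|t| < r -> `|F (t *: v + a) - F a - t * l| <= C * t ^+ 2) ->
  derivable F a v /\ 'D_v F a = l.
Proof.
move=> r0 h.
have C0 : 0 <= C.
  have r2 : `|r / 2| < r by rewrite ger0_norm; lra.
  have := le_trans (normr_ge0 _) (h _ r2); rewrite pmulr_lge0// exprn_gt0//; lra.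
have cv : (fun t => t^-1 *: (F (t *: v + a) - F a)) @ 0^' --> (l : R^o).
  apply/cvgrPdist_le => e e0; near=> t.
  have t0 : t != 0 by near: t; exact: nbhs_dnbhs_neq.
  have tr : `|t| < r by near: t; apply: dnbhs0_lt.
  have te : `|t| < e / (C + 1) by near: t; apply: dnbhs0_lt; rewrite divr_gt0//; lra.
  have -> : l - t^-1 *: (F (t *: v + a) - F a) = - t^-1 * (F (t *: v + a) - F a - t * l).
    by rewrite /GRing.scale /=; field.
  rewrite normrM normrN normfV.
  apply: le_trans (_ : `|t|^-1 * (C * t ^+ 2) <= _).
    by rewrite ler_wpM2l ?invr_ge0//; exact: h.
  have -> : `|t|^-1 * (C * t ^+ 2) = C * `|t|.
    by rewrite -[t ^+ 2]real_normK ?num_real//; field; rewrite normr_eq0.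
  have : `|t| * (C + 1) < e by rewrite -ltr_pdivlMr//; lra.
  have := normr_ge0 t; nra.
split; first by apply: cvgP cv.
exact: cvg_lim cv.
Unshelve. all: by end_near.
Qed.

End trlog_derivative.

Section trlog_mean.
Context (R : realType).

Lemma ler_norm_shift (x y z w c : R) : x = y + z -> `|z - w| <= c -> `|x - y - w| <= c.
Proof. by move=> ->; rewrite [X in X - _ - _]addrC addrK. Qed.

Lemma trlog_update N L (d : 'rV[R]_N) (Phi : 'M[R[i]]_(N, L)) k (t : R) :
  (forall k, 0 < d 0 k) -> (forall j, 0 < (t *: delta_mx 0 k + d) 0 j) -> fullrank Phi ->
  let l := complex.Re (Lambda_integrand (cdiag d) Phi k k) in
  complex.Re (trlog_integrand (cdiag (t *: delta_mx 0 k + d)) Phi) =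
  complex.Re (trlog_integrand (cdiag d) Phi) + ln (1 + t * l).
Proof.
move=> d0 d0' fP l.
have [-> A0 Ar] := trlog_det d0 fP; have [-> B0 _] := trlog_det d0' fP.
have uA := gram_cdiag_unit d0 fP.
have E : Phi ^t* *m cdiag (t *: delta_mx 0 k + d) *m Phi =
    Phi ^t* *m cdiag d *m Phi + (t%:C *: (row k Phi) ^t*) *m row k Phi.
  have -> : cdiag (t *: delta_mx 0 k + d) = cdiag d + t%:C *: delta_mx k k.
    apply/matrixP => a b; rewrite !mxE eqxx /=.
    have [->|ab] := eqVneq a b; rewrite ?mulr0n ?mulr1n.
      by rewrite addrC rmorphD rmorphM andbb; case: (b == k).
    have [ak|ak] := eqVneq a k; have [bk|bk] := eqVneq b k; rewrite /= ?mulr0 ?addr0//.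
    by rewrite ak bk eqxx in ab.
  rewrite mulmxDr mulmxDl -scalemxAr -!scalemxAl; congr (_ + _ *: _).
  have -> : delta_mx k k = (delta_mx k 0 : 'cV[R[i]]_N) *m (delta_mx 0 k : 'rV[R[i]]_N).
    by rewrite mul_delta_mx.
  have -> : (row k Phi) ^t* = Phi ^t* *m delta_mx k 0 by rewrite -colE; apply/matrixP => a b; rewrite !mxE.
  by rewrite rowE !mulmxA.
have lE : (row k Phi *m invmx (Phi ^t* *m cdiag d *m Phi) *m (t%:C *: (row k Phi) ^t*)) 0 0 =
    t%:C * Lambda_integrand (cdiag d) Phi k k.
  rewrite -scalemxAr mxE; congr (_ * _); rewrite /Lambda_integrand; move: (invmx _) => I.
  by rewrite -row_mul !mxE; apply: eq_bigr => j _; rewrite !mxE.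
(* The positivity of [1 + t l], needed to split the logarithm, comes from that of the two
   determinants. *)
move: B0; rewrite E (det_add_rank1 _ _ uA) lE Ar ReM /= mul0r subr0 ReD ReM /= mul0r subr0 -/l.
by rewrite pmulr_rgt0// => l0; rewrite lnM ?posrE.
Qed.

Context (N L : nat) (Q : probability (borelmx R N L) R).
Hypothesis isoQ : {ae Q, forall Phi, (Phi : 'M[R[i]]_(N, L)) ^t* *m Phi = 1%:M}.

Lemma trlog_cintegrable (d : 'rV[R]_N) : (forall k, 0 < d 0 k) ->
  cintegrable Q (trlog_integrand (cdiag d) : borelmx R N L -> R[i]).
Proof.
move=> d0; have pA (Phi : 'M[R[i]]_(N, L)) : psd (Phi ^t* *m cdiag d *m Phi).
  by apply: psd_gram; apply: psd_cdiag => k; exact: ltW.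
split.
  have [a [a0 ad]] := lower_bound_pos d0.
  have db k : a <= d 0 k <= \sum_j d 0 j.
    rewrite ad /= (bigD1 k)//= lerDl; apply: sumr_ge0 => j _; exact: ltW.
  apply: (@ae_bounded_integrable _ _ _ Q
    (fun Phi : borelmx R N L => complex.Re (trlog_integrand (cdiag d) (Phi : 'M[R[i]]_(N, L))))
    (L%:R * (`|ln a| + `|ln (\sum_j d 0 j)|))).
    have mi := @mmeas_id R N L.
    by apply: measurable_tr_mxlog => //; exact: mmeasM (mmeasM (mmeas_adj mi) (mmeas_cst _ _)) mi.
  by apply: ae_imply isoQ _ => Phi iP; exact: trlog_bound a0 db iP.
have -> : (fun w : borelmx R N L => (complex.Im (trlog_integrand (cdiag d) (w : 'M[R[i]]_(N, L))))%:E) = cst 0%E.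
  apply/funext => Phi; rewrite /trlog_integrand.
  by have [P [s [_ _ _ ->]]] := psd_eigen (pA (Phi : 'M[R[i]]_(N, L))).
exact: integrable0.
Qed.

Lemma trlog_mean_derivative (d : 'rV[R]_N) k : (forall k, 0 < d 0 k) ->
  derivable (trlog_mean Q) d (delta_mx 0 k) /\
  lambda Q d k =
  fine (\int[Q]_Phi (complex.Re (Lambda_integrand (cdiag d) (Phi : 'M[R[i]]_(N, L)) k k))%:E).
Proof.
move=> d0; have dk := d0 k.
have pd : psd (cdiag d) by apply: psd_cdiag => j; exact: ltW.
pose l (Phi : borelmx R N L) := complex.Re (Lambda_integrand (cdiag d) (Phi : 'M[R[i]]_(N, L)) k k).
have l0 Phi : 0 <= l Phi by have [] := psd_diag k (psd_Lambda_integrand (Phi : 'M[R[i]]_(N, L)) pd).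
have fQ : {ae Q, forall Phi, fullrank (Phi : 'M[R[i]]_(N, L))}.
  by apply: ae_imply isoQ _ => Phi; exact: isometry_fullrank.
have lb : {ae Q, forall Phi, l Phi <= (d 0 k)^-1}.
  by apply: ae_imply fQ _ => Phi; exact: Lambda_diag_bound.
have il : Q.-integrable setT (EFin \o l).
  apply: (@ae_bounded_integrable _ _ _ Q l (d 0 k)^-1).
    by have [] := @mmeas_Lambda_integrand R N L (cdiag d) k k.
  by apply: ae_imply lb _ => Phi h; rewrite ger0_norm.
have mE d' : trlog_mean Q d' = fine (\int[Q]_Phi
    (complex.Re (trlog_integrand (cdiag d') (Phi : 'M[R[i]]_(N, L))))%:E).
  by rewrite /trlog_mean /cexp unlock.
(* For [|t| < d_k / 2] the updated entry stays positive, and [l <= 1 / d_k] gives [|t l| <= 1/2],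
   the range of [ln1D_taylor]. Its remainder [2 (t l)^2] is at most [2 t^2 / d_k^2]. *)
apply: (@derivable_taylor _ _ (trlog_mean Q) d (delta_mx 0 k) _ (d 0 k / 2) (2 * ((d 0 k)^-1) ^+ 2)).
  by rewrite divr_gt0.
move=> t tr.
have d0' j : 0 < (t *: delta_mx 0 k + d) 0 j.
  rewrite !mxE eqxx /=; have [->|_] := eqVneq j k; last by rewrite mulr0 add0r.
  by move: tr; rewrite mulr1 ltr_norml => /andP[]; lra.
have [i1 _] := trlog_cintegrable d0'; have [i2 _] := trlog_cintegrable d0.
rewrite !mE; apply: (fine_integral_taylor i1 i2 il).
  by rewrite mulr_ge0 ?sqr_ge0// mulr_ge0 ?sqr_ge0.
have both := ae_imply2 fQ lb (fun Phi a b => conj a b).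
apply: ae_imply both _ => Phi [fP lP].
have E : complex.Re (trlog_integrand (cdiag (t *: delta_mx 0 k + d)) (Phi : 'M[R[i]]_(N, L))) =
    complex.Re (trlog_integrand (cdiag d) (Phi : 'M[R[i]]_(N, L))) + ln (1 + t * l Phi).
  exact: trlog_update.
apply: (ler_norm_shift E).
have tl : `|t * l Phi| <= 2^-1.
  rewrite normrM (ger0_norm (l0 Phi)).
  apply: le_trans (ler_pM (normr_ge0 t) (l0 Phi) (ltW tr) lP) _.
  by rewrite mulrAC divff ?mul1r// gt_eqF.
apply: le_trans (ln1D_taylor tl) _.
rewrite exprMn mulrA [leRHS]mulrAC ler_wpM2l//; first by apply: mulr_ge0 => //; exact: sqr_ge0.
by rewrite lerXn2r ?nnegrE ?l0// invr_ge0 ltW.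
Qed.

End trlog_mean.

(** * Block decomposition *)

Section main.
Context (R : realType).

Definition sign_flip n (k : 'I_n) : 'M[R[i]]_n := diag_mx (\row_j (-1) ^+ (j == k)).

Lemma sign_flip_adj n (k : 'I_n) : (sign_flip k) ^t* = sign_flip k.
Proof.
rewrite /sign_flip tr_diag_mx map_diag_mx; congr diag_mx; apply/matrixP => a j.
by rewrite !mxE rmorph_sign.
Qed.

Lemma sign_flip_conjE n (k : 'I_n) (A : 'M[R[i]]_n) i j :
  (sign_flip k *m A *m sign_flip k) i j = (-1) ^+ (i == k) * A i j * (-1) ^+ (j == k).
Proof. by rewrite /sign_flip mul_mx_diag mul_diag_mx !mxE. Qed.

Lemma sign_flip_cdiag n (k : 'I_n) (c : 'rV[R]_n) :
  sign_flip k *m cdiag c *m sign_flip k = cdiag c.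
Proof.
apply/matrixP => i j; rewrite sign_flip_conjE mxE.
have [->|_] := eqVneq i j; last by rewrite mulr0n mulr0 mul0r.
by rewrite mulr1n mulrAC -signr_addb addbb mul1r.
Qed.

Lemma sign_flip_unitary n (k : 'I_n) : sign_flip k \is unitarymx.
Proof.
apply/unitarymxP; rewrite sign_flip_adj.
have := sign_flip_cdiag k (const_mx 1).
suff -> : cdiag (const_mx 1 : 'rV[R]_n) = 1%:M by rewrite mulmx1.
by apply/matrixP => x y; rewrite !mxE.
Qed.

Lemma cexp_sign_flip d (T : measurableType d) (P : probability T R) n (f : T -> 'M[R[i]]_n)
    (s : T -> T) k l : mmeas f -> measurable_fun setT s ->
  (forall B, measurable B -> P [set w | B (s w)] = P B) ->
  (forall w, f (s w) = sign_flip k *m f w *m sign_flip k) -> k != l ->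
  cexp P (fun w => f w k l) = 0.
Proof.
move=> mf ms sP fs kl; have [m1 m2] := mf k l.
have E w : f (s w) k l = - f w k l.
  by rewrite fs sign_flip_conjE eqxx eq_sym (negbTE kl) expr1 mulr1 mulN1r.
rewrite /cexp unlock !(antisymmetric_integral _ ms sP)// => w.
  by rewrite E ImN.
by rewrite E ReN.
Qed.

Lemma Lambda_integrand_mull n m (D U : 'M[R[i]]_n) (X : 'M[R[i]]_(n, m)) :
  U ^t* *m D *m U = D -> Lambda_integrand D (U *m X) = U *m Lambda_integrand D X *m U ^t*.
Proof.
move=> UDU; rewrite /Lambda_integrand adjM.
have -> : X ^t* *m U ^t* *m D *m (U *m X) = X ^t* *m D *m X.
  by rewrite -[in RHS]UDU !mulmxA.
by rewrite !mulmxA.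
Qed.

(** A coisometry is read as the isometry [Psi^*], so that one integrand and one transfer result
    serve both Haar measures. *)
Lemma invcov_integrandE L M (D : 'M[R[i]]_M) (Psi : 'M[R[i]]_(L, M)) :
  invcov_integrand D Psi = Lambda_integrand D (Psi ^t*).
Proof. by rewrite /Lambda_integrand trmxCK. Qed.

Lemma Lambda_offdiag N L (Q : probability (borelmx R N L) R) (c : 'rV[R]_N) k l :
  left_invariant Q -> k != l -> Lambda Q (cdiag c) k l = 0.
Proof.
move=> iQ kl; rewrite mxE.
have mi := @mmeas_id R N L.
apply: (@cexp_sign_flip _ _ Q N _ (fun X : borelmx R N L => sign_flip k *m (X : 'M[R[i]]_(N, L)))).
- exact: mmeas_Lambda_integrand.
- by apply: mmeas_measurable; exact: mmeasM (mmeas_cst _ _) mi.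
- by move=> B mB; exact: iQ (sign_flip_unitary k) _ mB.
- move=> X; rewrite Lambda_integrand_mull sign_flip_adj//; exact: sign_flip_cdiag.
- exact: kl.
Qed.

Lemma mmeas_invcov L M (D : 'M[R[i]]_M) :
  mmeas (fun Psi : borelmx R L M => invcov_integrand D (Psi : 'M[R[i]]_(L, M))).
Proof.
have mi := @mmeas_id R L M.
have mI := mmeas_invmx (mmeasM (mmeasM mi (mmeas_cst _ D)) (mmeas_adj mi)).
exact: mmeasM (mmeasM (mmeas_adj mi) mI) mi.
Qed.

Lemma invcov_offdiag L M (P : probability (borelmx R L M) R) (c : 'rV[R]_M) k l :
  haar_coisometry P -> k != l -> invcov P (cdiag c) k l = 0.
Proof.
move=> [_ iP] kl; rewrite mxE.
have mi := @mmeas_id R L M.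
apply: (@cexp_sign_flip _ _ P M _ (fun X : borelmx R L M => (X : 'M[R[i]]_(L, M)) *m sign_flip k)).
- exact: mmeas_invcov.
- by apply: mmeas_measurable; exact: mmeasM mi (mmeas_cst _ _).
- by move=> B mB; exact: iP (sign_flip_unitary k) _ mB.
- move=> X; rewrite !invcov_integrandE adjM sign_flip_adj.
  rewrite Lambda_integrand_mull sign_flip_adj//; exact: sign_flip_cdiag.
- exact: kl.
Qed.

Lemma cexp_psd_diag d (T : measurableType d) (P : probability T R) n (f : T -> 'M[R[i]]_n) k :
  (forall w, psd (f w)) ->
  cexp P (fun w => f w k k) = (fine (\int[P]_w (complex.Re (f w k k))%:E))%:C.
Proof.
move=> pf; rewrite /cexp unlock [X in _ +i* fine X]integral0_eq// => w _.
by have [_ ->] := psd_diag k (pf w).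
Qed.

Local Open Scope ereal_scope.

Lemma measurable_adj L M : measurable_fun setT
  (fun Psi : borelmx R L M => ((Psi : 'M[R[i]]_(L, M)) ^t* : borelmx R M L)).
Proof. by apply: mmeas_measurable; exact: mmeas_adj (@mmeas_id R L M). Qed.

Lemma haar_coisometry_adj L M (P : probability (borelmx R L M) R) : haar_coisometry P ->
  left_invariant (law P (@measurable_adj L M)) /\
  {ae law P (@measurable_adj L M), forall X, (X : 'M[R[i]]_(M, L)) ^t* *m X = 1%:M}.
Proof.
move=> [P1 iP]; split.
  move=> U uU B mB.
  have mB' : measurable [set Psi : borelmx R L M | B ((Psi : 'M[R[i]]_(L, M)) ^t*)].
    exact: measurable_preimage (@measurable_adj L M) mB.
  have uU' : U ^t* \is unitarymx by rewrite trmxC_unitary.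
  have E := iP _ uU' _ mB'.
  suff -> : law P (@measurable_adj L M) [set X | B (U *m (X : 'M[R[i]]_(M, L)))] =
      P [set Psi : borelmx R L M | B (((Psi : 'M[R[i]]_(L, M)) *m U ^t*) ^t*)] by exact: E.
  apply: etrans (lawE _ _ _) _; congr (P _); apply/seteqP.
  by split=> X /=; rewrite adjM trmxCK.
have mi := @mmeas_id R M L.
apply: (@ae_law _ _ _ _ _ P _ _ [set X : borelmx R M L | (X : 'M[R[i]]_(M, L)) ^t* *m X = 1%:M]).
  have mi' := @mmeas_id R L M.
  have mS := mmeas_measurable_eq (mmeasM mi' (mmeas_adj mi')) (mmeas_cst _ 1%:M).
  by apply: ae_imply (ae_prob1 mS P1) _ => Psi /= h; rewrite trmxCK.
exact: mmeas_measurable_eq (mmeasM (mmeas_adj mi) mi) (mmeas_cst _ 1%:M).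
Qed.

Lemma haar_stiefel_iso N L (Q : probability (borelmx R N L) R) : haar_stiefel Q ->
  {ae Q, forall Phi, (Phi : 'M[R[i]]_(N, L)) ^t* *m Phi = 1%:M}.
Proof.
move=> [Q1 _]; have mi := @mmeas_id R N L.
exact: ae_prob1 (mmeas_measurable_eq (mmeasM (mmeas_adj mi) mi) (mmeas_cst _ 1%:M)) Q1.
Qed.

Lemma cdiag_row_mx0 N K (d : 'rV[R]_N) :
  cdiag (row_mx d (0%R : 'rV[R]_K)) = block_mx (cdiag d) 0%R 0%R 0%R.
Proof.
rewrite /cdiag map_row_mx diag_mx_row; congr block_mx.
by apply/matrixP => a b; rewrite !mxE mul0rn.
Qed.

Lemma adj_col_mx n1 n2 m (X : 'M[R[i]]_(n1, m)) (Y : 'M[R[i]]_(n2, m)) :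
  (col_mx X Y) ^t* = row_mx (X ^t*) (Y ^t*).
Proof. by rewrite tr_col_mx map_row_mx. Qed.

Lemma gram_col_mx0 N K m (d : 'rV[R]_N) (X : 'M[R[i]]_(N, m)) (Y : 'M[R[i]]_(K, m)) :
  (col_mx X Y) ^t* *m cdiag (row_mx d (0%R : 'rV[R]_K)) *m col_mx X Y = X ^t* *m cdiag d *m X.
Proof.
rewrite cdiag_row_mx0 adj_col_mx mul_row_block !mulmx0 !addr0 mul_row_col mul0mx addr0 //.
Qed.

Lemma Lambda_integrand_col_mx0 N K m (d : 'rV[R]_N) (X : 'M[R[i]]_(N, m)) (Y : 'M[R[i]]_(K, m)) :
  Lambda_integrand (cdiag (row_mx d (0%R : 'rV[R]_K))) (col_mx X Y) =
  let H := invgram (cdiag d) X in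
  block_mx (X *m H *m X ^t*) (X *m H *m Y ^t*) (Y *m H *m X ^t*) (Y *m H *m Y ^t*).
Proof. by rewrite /Lambda_integrand gram_col_mx0 adj_col_mx mul_col_mx mul_col_row. Qed.

Section diagonal.
Variables (L N K : nat) (LN : (L <= N)%N) (d : 'rV[R]_N) (d0 : forall k, (0 < d 0%R k)%R).
Variables (P : probability (borelmx R L (N + K)) R) (hP : haar_coisometry P).
Variables (Q : probability (borelmx R N L) R) (hQ : haar_stiefel Q).
Variables (G : probability (borelmx R N L) R) (gG : gaussian_ensemble G).
Let D := cdiag (row_mx d (0%R : 'rV[R]_K)).

Let pDN : psd (cdiag d). Proof. by apply: psd_cdiag => k; exact: ltW. Qed.
Let pD : psd D.
Proof.
apply: psd_cdiag => k; have [j ->|j ->] := split_ordP k.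
  by rewrite row_mxEl ltW.
by rewrite row_mxEr mxE.
Qed.
Let fG : {ae G, forall X, fullrank (X : 'M[R[i]]_(N, L))}. Proof. exact: gaussian_fullrank gG LN. Qed.
Let fQ : {ae Q, forall X, fullrank (X : 'M[R[i]]_(N, L))}.
Proof. by apply: ae_imply (haar_stiefel_iso hQ) _ => X; exact: isometry_fullrank. Qed.

Lemma invcov_diag_gaussian (G' : probability (borelmx R K L) R) k : gaussian_ensemble G' ->
  \int[P]_Psi (complex.Re (invcov_integrand D (Psi : 'M[R[i]]_(L, N + K)) k k))%:E =
  \int[G]_X \int[G']_Y (complex.Re (Lambda_integrand D
      (col_mx (X : 'M[R[i]]_(N, L)) (Y : 'M[R[i]]_(K, L))) k k))%:E.
Proof.
move=> gG'.
pose Ga := law (prodP G G') (@measurable_col_mx R N K L).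
have gGa : gaussian_ensemble Ga by exact: gaussian_col_mx.
have [iP isoP] := haar_coisometry_adj hP.
set P' := law P _ in iP isoP.
pose F (X : borelmx R (N + K) L) := (complex.Re (Lambda_integrand D (X : 'M[R[i]]_(N + K, L)) k k))%:E.
have mF : measurable_fun setT F.
  by apply/measurable_EFinP; have [] := @mmeas_Lambda_integrand R (N + K) L D k k.
have F0 X : 0 <= F X.
  by rewrite lee_fin; have [] := psd_diag k (psd_Lambda_integrand (X : 'M[R[i]]_(N + K, L)) pD).
have fGa : {ae Ga, forall X, fullrank (X : 'M[R[i]]_(N + K, L))}.
  exact: gaussian_fullrank gGa (leq_trans LN (leq_addr _ _)).
have fP : {ae P', forall X, fullrank (X : 'M[R[i]]_(N + K, L))}.
  by apply: ae_imply isoP _ => X; exact: isometry_fullrank.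
(* [D] is singular, so this does not follow from full rank of the stacked matrix. The Gram matrix
   involves only the block [X], whose own full rank and the positivity of [d] make it invertible. *)
have uGa : {ae Ga, forall X, (X : 'M[R[i]]_(N + K, L)) ^t* *m D *m X \in unitmx}.
  pose bad n (c : 'rV[R]_n) : set (borelmx R n L) :=
    [set X | \det ((X : 'M[R[i]]_(n, L)) ^t* *m cdiag c *m X) = 0%R].
  have mbad n (c : 'rV[R]_n) : measurable (bad n c).
    apply: cmeas_measurable_eq; last exact: cmeas_cst.
    have mi := @mmeas_id R n L.
    exact: cmeas_det (mmeasM (mmeasM (mmeas_adj mi) (mmeas_cst _ _)) mi).
  exists (bad _ (row_mx d 0%R)); split; first exact: mbad.
    apply: etrans (lawE _ _ _) _.
    have -> : [set u : borelmx R N L * borelmx R K L |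
        bad _ (row_mx d 0%R) (col_mx (u.1 : 'M[R[i]]_(N, L)) (u.2 : 'M[R[i]]_(K, L)))] =
        bad _ d `*` setT.
      apply/seteqP; split=> u; rewrite /bad /= gram_col_mx0 //.
      by move=> [].
    rewrite (prodP_rect _ _ (mbad _ d) measurableT).
    suff -> : G (bad _ d) = 0 by rewrite mul0e.
    rewrite -[X in G X]setCK; apply: ae_measure0; first exact: measurableC.
    apply: ae_imply (fullrank_gram_unit d0 fG) _ => X; rewrite unitmxE unitfE => nz /= e.
    by rewrite e eqxx in nz.
  move=> X /=; rewrite unitmxE unitfE => /negP; rewrite negbK => /eqP; exact.
have E1 : \int[P]_Psi (complex.Re (invcov_integrand D (Psi : 'M[R[i]]_(L, N + K)) k k))%:E =
    \int[P']_X F X.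
  rewrite (ge0_integral_law P (@measurable_adj L (N + K)) mF F0).
  by apply: eq_integral => Psi _; rewrite /F -invcov_integrandE.
have E2 : \int[P']_X F X = \int[Ga]_X F X.
  exact: (transfer_Lambda k iP (gaussian_left_invariant gGa) pD fP fGa uGa).
rewrite E1 E2 (ge0_integral_law (prodP G G') (@measurable_col_mx R N K L) mF F0).
apply: prodP_integral1; last by move=> u; exact: F0.
exact: measurableT_comp mF (@measurable_col_mx R N K L).
Qed.

Lemma invcov_upper_diag (k : 'I_N) :
  \int[P]_Psi (complex.Re (invcov_integrand D (Psi : 'M[R[i]]_(L, N + K)) (lshift K k) (lshift K k)))%:E =
  \int[Q]_Phi (complex.Re (Lambda_integrand (cdiag d) (Phi : 'M[R[i]]_(N, L)) k k))%:E.
Proof.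
have [G' gG'] := gaussian_exists R K L.
rewrite (invcov_diag_gaussian _ gG').
transitivity (\int[G]_X (complex.Re (Lambda_integrand (cdiag d) (X : 'M[R[i]]_(N, L)) k k))%:E).
  apply: eq_integral => X _.
  transitivity (\int[G']_Y (complex.Re (Lambda_integrand (cdiag d) (X : 'M[R[i]]_(N, L)) k k))%:E).
    by apply: eq_integral => Y _; rewrite /D Lambda_integrand_col_mx0 block_mxEul.
  by rewrite integral_cst//= (_ : G' setT = 1) ?mule1//; exact: probability_setT.
have [_ iQ] := hQ.
exact: (transfer_Lambda k (gaussian_left_invariant gG) iQ pDN fG fQ (fullrank_gram_unit d0 fQ)).
Qed.

Lemma invcov_lower_diag (k : 'I_K) :
  \int[P]_Psi (complex.Re (invcov_integrand D (Psi : 'M[R[i]]_(L, N + K)) (rshift N k) (rshift N k)))%:E =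
  emu G (cdiag d).
Proof.
have [G' gG'] := gaussian_exists R K L.
rewrite (invcov_diag_gaussian _ gG') (emu_trace G pDN).
apply: eq_integral => X _.
rewrite -(gaussian_quad k gG' (psd_invgram (X : 'M[R[i]]_(N, L)) pDN)).
by apply: eq_integral => Y _; rewrite /D Lambda_integrand_col_mx0 block_mxEdr.
Qed.

Lemma mxintegrable_Lambda :
  mxintegrable Q (Lambda_integrand (cdiag d) : borelmx R N L -> 'M[R[i]]_N).
Proof.
apply: mxintegrable_psd; first exact: mmeas_Lambda_integrand.
  by move=> X; exact: psd_Lambda_integrand.
by move=> k; exact: Lambda_diag_finite d0 fQ.
Qed.

Lemma mxintegrable_invcov : (L < N)%N ->
  mxintegrable P (invcov_integrand D : borelmx R L (N + K) -> 'M[R[i]]_(N + K)).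
Proof.
move=> ltLN; apply: mxintegrable_psd; first exact: mmeas_invcov.
  by move=> X; rewrite invcov_integrandE; exact: psd_Lambda_integrand.
move=> k; have [j ->|j ->] := split_ordP k.
  by rewrite invcov_upper_diag; exact: Lambda_diag_finite d0 fQ.
by rewrite invcov_lower_diag (emu_trace G pDN); exact: gaussian_invgram_finite.
Qed.

Lemma mxintegrable_invgram : (L < N)%N ->
  mxintegrable G (invgram (cdiag d) : borelmx R N L -> 'M[R[i]]_L).
Proof.
move=> ltLN; apply: mxintegrable_psd; first exact: mmeas_invgram.
  by move=> X; exact: psd_invgram.
move=> k; apply: le_lt_trans (gaussian_invgram_finite gG ltLN d0).
apply: ge0_le_integral => //.
- by move=> X _; rewrite lee_fin; have [] := psd_diag k (psd_invgram (X : 'M[R[i]]_(N, L)) pDN).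
- by apply/measurable_EFinP; have [] := @mmeas_invgram R N L (cdiag d) k k.
- by apply/measurable_EFinP; have [] := cmeas_tr (@mmeas_invgram R N L (cdiag d)).
move=> X _; rewrite lee_fin /mxtrace Re_sum (bigD1 k)//= lerDl; apply: sumr_ge0 => j _.
by have [] := psd_diag j (psd_invgram (X : 'M[R[i]]_(N, L)) pDN).
Qed.

Lemma Lambda_diagE : Lambda Q (cdiag d) = cdiag (\row_k lambda Q d k).
Proof.
apply/matrixP => k l; rewrite [RHS]mxE; have [<-|kl] := eqVneq k l; last first.
  by have [_ iQ] := hQ; rewrite mulr0n; exact: Lambda_offdiag.
have [_ h] := trlog_mean_derivative (haar_stiefel_iso hQ) k d0.
by rewrite !mxE mulr1n h; apply: cexp_psd_diag => X; exact: psd_Lambda_integrand.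
Qed.

Lemma invcov_block : (0 < L)%N ->
  invcov P D = block_mx (Lambda Q (cdiag d)) 0%R 0%R (mu G (cdiag d))%:M.
Proof.
move=> L0; have [_ iQ] := hQ; apply/matrixP => k l.
have dg j : invcov P D j j = (fine (\int[P]_Psi
    (complex.Re (invcov_integrand D (Psi : 'M[R[i]]_(L, N + K)) j j))%:E))%:C.
  by rewrite mxE; apply: cexp_psd_diag => X; rewrite invcov_integrandE; exact: psd_Lambda_integrand.
have [<-|kl] := eqVneq k l.
  rewrite dg; have [j ->|j ->] := split_ordP k.
    rewrite block_mxEul invcov_upper_diag mxE; apply/esym.
    by apply: cexp_psd_diag => X; exact: psd_Lambda_integrand.
  by rewrite block_mxEdr invcov_lower_diag mxE eqxx mulr1n (mu_emu L0 gG pDN).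
rewrite invcov_offdiag//; move: kl; have [i ->|i ->] := split_ordP k; have [j ->|j ->] := split_ordP l => kl.
- by rewrite block_mxEul Lambda_offdiag//; apply: contraNneq kl => ->.
- by rewrite block_mxEur mxE.
- by rewrite block_mxEdl mxE.
- rewrite block_mxEdr mxE; have [e|_] := eqVneq i j; last by rewrite mulr0n.
  by rewrite e eqxx in kl.
Qed.

End diagonal.
End main.

(* [K = M - N], kept abstract so that the cast can be eliminated. *)
Lemma mainTheorem5_cast (R : realType) (L N K M : nat) (e : (N + K = M)%N)
    (L_ge1 : (1 <= L)%N) (leLN : (L <= N)%N)
    (d : 'rV[R]_N) (d_gt0 : forall k, 0 < d 0 k)
    (P : probability (borelmx R L M) R) (haarP : haar_coisometry P)
    (Q : probability (borelmx R N L) R) (haarQ : haar_stiefel Q)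
    (G : probability (borelmx R N L) R) (gaussG : gaussian_ensemble G) :
  let DN := cdiag d in
  let D := castmx (e, e) (block_mx DN 0 0 (0 : 'M[R[i]]_K)) in
  [/\ invcov P D = castmx (e, e) (block_mx (Lambda Q DN) 0 0 ((mu G DN)%:M : 'M[R[i]]_K)),
      Lambda Q DN = cdiag (\row_k lambda Q d k) &
      (forall k : 'I_N, derivable (trlog_mean Q) d (delta_mx 0 k))] /\
  (forall k : 'I_M, (N <= k)%N ->
     'E_P[fun Psi => complex.Re (@invcov_integrand R L M D Psi k k)]%E =
     emu G DN) /\
  [/\ mxintegrable Q (@Lambda_integrand R L N DN),
      cintegrable Q (@trlog_integrand R L N DN) &
      ((L < N)%N -> mxintegrable P (@invcov_integrand R L M D) /\
                    mxintegrable G (@invgram R L N DN))].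
Proof.
case: M / e P haarP => P haarP DN D.
have -> : D = cdiag (row_mx d (0 : 'rV[R]_K)) by rewrite cdiag_row_mx0 /D castmx_id.
split; [split|split; [|split]].
- by rewrite castmx_id; exact: invcov_block.
- exact: Lambda_diagE.
- by move=> k; have [] := trlog_mean_derivative (haar_stiefel_iso haarQ) k d_gt0.
- move=> k; have [j ->|j ->] := split_ordP k; first by rewrite leqNgt /= ltn_ord.
  by move=> _; rewrite unlock; exact: (invcov_lower_diag leLN d_gt0 haarP gaussG).
- exact: mxintegrable_Lambda.
- exact: (trlog_cintegrable (haar_stiefel_iso haarQ)).
- by move=> ltLN; split; [exact: (mxintegrable_invcov leLN d_gt0 haarP haarQ gaussG)|exact: mxintegrable_invgram].
Qed.


Theorem mainTheorem5 (R : realType) (L N M : nat)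
    (L_ge1 : (1 <= L)%N) (leLN : (L <= N)%N) (ltNM : (N < M)%N)
    (d : 'rV[R]_N) (d_gt0 : forall k, 0 < d 0 k)
    (P : probability (borelmx R L M) R) (haarP : haar_coisometry P)
    (Q : probability (borelmx R N L) R) (haarQ : haar_stiefel Q)
    (G : probability (borelmx R N L) R) (gaussG : gaussian_ensemble G) :
  let DN := cdiag d in
  let D := bdiag (ltnW ltNM) DN 0 in
  (* the decomposition, and the formula for the lambda_k *)
  [/\ invcov P D = bdiag (ltnW ltNM) (Lambda Q DN) ((mu G DN)%:M),
      Lambda Q DN = cdiag (\row_k lambda Q d k) &
      (forall k : 'I_N, derivable (trlog_mean Q) d (delta_mx 0 k))] /\
  (* the lower diagonal entries as expectations in [0, +oo], for L = N too *)
  (forall k : 'I_M, (N <= k)%N ->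
     'E_P[fun Psi => complex.Re (@invcov_integrand R L M D Psi k k)]%E =
     emu G DN) /\
  (* the expectations exist *)
  [/\ mxintegrable Q (@Lambda_integrand R L N DN),
      cintegrable Q (@trlog_integrand R L N DN) &
      ((L < N)%N -> mxintegrable P (@invcov_integrand R L M D) /\
                    mxintegrable G (@invgram R L N DN))].
Proof.
exact: (mainTheorem5_cast (subnKC (ltnW ltNM)) L_ge1 leLN d_gt0 haarP haarQ gaussG).
Qed.
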